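(* There exists $n_0 \in \mathbb{N}$ such that the following holds. Suppose that $H$ is a $4$-uniform hypergraph on $n \ge n_0$ vertices, where $n$ is divisible by $4$. If $$\delta_2(H) > \frac{n^2}{4} - \frac{5n}{4} - \frac{\sqrt{n-3}}{2} + \frac{3}{2},$$ then $H$ contains a perfect matching. Furthermore, this minimum degree condition is best possible, in the sense that there are infinitely many $n$ divisible by $4$ for which there is a $4$-uniform hypergraph $H$ on $n$ vertices with $$\delta_2(H) = \frac{n^2}{4} - \frac{5n}{4} - \frac{\sqrt{n-3}}{2} + \frac{3}{2}$$ that contains no perfect matching.
   Context: A perfect matching in a hypergraph $H$ is a collection of vertex-disjoint edges of $H$ covering $V(H)$. For a $4$-uniform hypergraph $H$, the minimum $2$-degree $\delta_2(H)$ is the minimum, over all $2$-element sets $S$ of vertices of $H$, of the number of edges of $H$ containing $S$. *)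

(* Defs.v *)
From HB Require Import structures.
From mathcomp Require Import all_boot all_order all_algebra.
From mathcomp Require Import reals.

Set Implicit Arguments.
Unset Strict Implicit.
Unset Printing Implicit Defensive.

Import Order.TTheory GRing.Theory Num.Theory.

(* A hypergraph on the vertex set V is given by its set of edges. *)
Section Hypergraph.

Variable V : finType.
Implicit Types (E M : {set {set V}}) (S : {set V}).

Definition uniform (k : nat) E : bool := [forall e in E, #|e| == k].

Definition degree E S : nat := #|[set e in E | S \subset e]|.

(* The neutral value #|E| bounds every degree from above, so this is the true
   minimum as soon as V has a subset with l elements, i.e. l <= #|V|. *)
Definition min_degree (l : nat) E : nat :=
  \big[minn/#|E|]_(S : {set V} | #|S| == l) degree E S.

Definition perfect_matching E M : bool :=
  [&& M \subset E, trivIset M & cover M == [set: V]].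

Definition has_perfect_matching E : Prop := exists M, perfect_matching E M.

End Hypergraph.

Local Open Scope ring_scope.

Definition threshold (R : realType) (n : nat) : R :=
  n%:R ^+ 2 / 4 - 5 * n%:R / 4 - Num.sqrt (n%:R - 3) / 2 + 3 / 2.

(* Main.v *)
Require Import Defs.
From HB Require Import structures.
From mathcomp Require Import all_boot all_order all_algebra.
From mathcomp Require Import reals.
From mathcomp Require Import boolp zify ring lra.

(** Every pair of vertices has degree almost [n ^ 2 / 4], half of the maximum, or more. The extremal
    hypergraphs are those of the parity type: fix a set [A] of about half of the vertices and take all
    quadruples that meet [A] in an even number of vertices (and let [A] be odd), or in an odd number.
    The proof shows that a hypergraph of this degree either is far from every parity hypergraph, and
    then absorption yields a perfect matching, or is close to one, and then a single edge of the wrong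
    parity suffices to build a perfect matching by hand; above the threshold such an edge must exist.

    Absorption. Two vertices are exchangeable when there are many sets of bounded size that can be
    perfectly matched together with either of them. If all pairs are exchangeable
    ([closed]), then every bounded set has a positive density of absorbers ([dense_absorbers]), a
    greedy choice with exponentially decaying failure gives one small set [W] that absorbs every
    leftover of a fixed size ([absorbing_set]), and it remains to match all but boundedly
    many vertices outside [W] ([almost_perfect_matching]). For the latter, take a maximum matching
    and boundedly many pairs of uncovered vertices. Each pair has a bipartite pattern between any two
    edges of the matching. A pattern with three disjoint links, repeated for three pairs, enlarges the
    matching; without three disjoint links at most [8] of the [16] links are present, and [8] only when
    two vertices on one side see the whole other side ([bipartite_patterns]). As the average is
    essentially [8], most patterns have the latter form, and two of them chained along three edges
    allow to replace three edges by four ([blocks_average]).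

    The dichotomy. Call two vertices linked when their links share a positive proportion of the
    triples; linked vertices are exchangeable. Every link contains almost half of all triples, so
    among any three vertices two are linked ([linked_of3]), and a resampling inequality shows that
    every vertex is linked to a positive proportion of the others ([linked_degree]). Hence either any
    two vertices are exchangeable directly or through a common neighbour, or [V] is, up to few
    vertices, a union of two cliques [A], [B] of the link graph. In the second case, if there are many
    edges of two types that differ by moving one vertex from [A] to [B], then these edges make [A] and
    [B] exchangeable and again all vertices are ([closed_or_two_cliques]). Otherwise no two adjacent
    types are both frequent, and the degree condition leaves only one possibility ([type_numerics]):
    [A] and [B] have nearly the same size and almost all edges meet [A] in the same parity
    ([closed_or_near_extremal]).

    The near-extremal case. Every vertex that misses many edges of the right parity is moved to the
    side where it has at least half of its edges right. If divisibility is violated, one edge of the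
    wrong parity repairs it; then right edges cover the remaining bad vertices greedily. What is left
    is cut arbitrarily into blocks of the right parity, of at most three types, each frequent. A block
    that is not an edge is recombined along a Latin square with three suitable blocks of its type into
    four edges ([recombine], [blocks_split]).

    The exact threshold enters only through the existence of a wrong edge: otherwise [H] is contained
    in a parity hypergraph, whose degrees are explicit, and with [s] the square root of [n - 3] and
    [|A| = n / 2 + d] the pairs across [A] and the pairs on one side of [A] force contradictory bounds
    on [|d|] ([even_degrees_small], [odd_degrees_small]). In the even case they meet exactly when
    [2 * |d| = s + 1], which is realised by [s = 4 * i + 1] and gives the sharp examples. *)

Set Implicit Arguments.
Unset Strict Implicit.
Unset Printing Implicit Defensive.

Import Order.TTheory GRing.Theory Num.Theory.
Local Open Scope ring_scope.

(** * Counting words over the vertex set *)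

Section Words.
Local Open Scope nat_scope.
Variable V : finType.
Local Notation n := #|V|.
Implicit Types (s t : seq V) (F G : seq V -> nat) (P Q : seq V -> Prop).

(** Words may repeat letters. This makes the number of words multiplicative under concatenation,
    while words with repetitions or with letters in a small set are negligible. *)
Fixpoint wsum m F : nat :=
  if m is m'.+1 then \sum_(x : V) wsum m' (fun s => F (x :: s)) else F [::].

Lemma leq_wsum m F G :
  (forall s, size s = m -> F s <= G s) -> wsum m F <= wsum m G.
Proof.
elim: m F G => [|m IHm] F G leFG /=; first exact: leFG.
by apply: leq_sum => x _; apply: IHm => s sz_s; apply: leFG; rewrite /= sz_s.
Qed.

Lemma eq_wsum m F G :
  (forall s, size s = m -> F s = G s) -> wsum m F = wsum m G.
Proof.
by move=> eqFG; apply/eqP; rewrite eqn_leq !leq_wsum // => s /eqFG->.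
Qed.

Lemma wsum_cat m1 m2 F :
  wsum (m1 + m2) F = wsum m1 (fun s => wsum m2 (fun t => F (s ++ t))).
Proof. by elim: m1 F => //= m1 IHm F; apply: eq_bigr => x _; rewrite IHm. Qed.

Lemma wsum_const m c : wsum m (fun=> c) = n ^ m * c.
Proof.
elim: m => [|m IHm] /=; first by rewrite mul1n.
by rewrite IHm sum_nat_const expnS mulnA.
Qed.

Lemma wsum_mulr m F c : wsum m (fun s => F s * c) = wsum m F * c.
Proof.
elim: m F => //= m IHm F; rewrite big_distrl; apply: eq_bigr => x _.
exact: (IHm (fun s => F (x :: s))).
Qed.

Lemma wsum_add m F G : wsum m (fun s => F s + G s) = wsum m F + wsum m G.
Proof.
elim: m F G => //= m IHm F G; rewrite -big_split; apply: eq_bigr => x _.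
exact: (IHm (fun s => F (x :: s)) (fun s => G (x :: s))).
Qed.

Lemma exchange_wsum (I : Type) (r : seq I) (p : pred I) m (F : I -> seq V -> nat) :
  wsum m (fun s => \sum_(i <- r | p i) F i s) = \sum_(i <- r | p i) wsum m (F i).
Proof.
elim: m F => //= m IHm F; rewrite exchange_big; apply: eq_bigr => x _.
exact: (IHm (fun i s => F i (x :: s))).
Qed.

Lemma wsum_exchange m1 m2 (F : seq V -> seq V -> nat) :
  wsum m1 (fun s => wsum m2 (F s)) = wsum m2 (fun t => wsum m1 (F^~ t)).
Proof.
elim: m1 F => //= m IHm F; rewrite exchange_wsum; apply: eq_bigr => x _.
exact: (IHm (fun s => F (x :: s))).
Qed.

Lemma leq_wsum_word F s : F s <= wsum (size s) F.
Proof.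
elim: s F => //= x s IHs F; rewrite (bigD1 x) //=.
by apply: leq_trans (leq_addr _ _); apply: (IHs (fun s => F (x :: s))).
Qed.

Lemma wsum_gt0 m F : 0 < wsum m F -> exists2 s, size s = m & 0 < F s.
Proof.
elim: m F => [|m IHm] F /=; first by move=> F0; exists [::].
rewrite lt0n sum_nat_eq0 negb_forall => /existsP[x]; rewrite /= -lt0n.
by case/IHm=> s sz_s Fs; exists (x :: s); rewrite //= sz_s.
Qed.

Definition wcount m P : nat := wsum m (fun s => `[< P s >]).

Lemma leq_wcount m P Q :
  (forall s, size s = m -> P s -> Q s) -> wcount m P <= wcount m Q.
Proof.
move=> PQ; apply: leq_wsum => s sz_s; case: asboolP => // Ps.
by rewrite (asboolT (PQ s sz_s Ps)).
Qed.

Lemma wcount_max m P : wcount m P <= n ^ m.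
Proof.
rewrite -[X in _ <= X]muln1 -wsum_const; apply: leq_wsum => s _.
exact: leq_b1.
Qed.

(** The constant is a natural number, the inverse of the density, which keeps the counting free of
    fractions. *)
Definition dense m K P : Prop := n ^ m <= K * wcount m P.

Lemma dense_sub m K P Q :
  (forall s, size s = m -> P s -> Q s) -> dense m K P -> dense m K Q.
Proof. by move=> PQ /leq_trans; apply; rewrite leq_mul2l leq_wcount ?orbT. Qed.

Lemma dense_leq m K K' P : K <= K' -> dense m K P -> dense m K' P.
Proof. by move=> leK /leq_trans; apply; rewrite leq_mul2r leK orbT. Qed.

(** The inverse densities of independent choices multiply. All gadgets below are assembled letter by
    letter and piece by piece with this lemma. *)
Lemma dense_cat m1 m2 K1 K2 P1 P :
    dense m1 K1 P1 ->
    (forall s, size s = m1 -> P1 s -> dense m2 K2 (fun t => P (s ++ t))) ->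
  dense (m1 + m2) (K1 * K2) P.
Proof.
move=> dP1 dP2; rewrite /dense expnD.
apply: (@leq_trans ((K1 * wcount m1 P1) * n ^ m2)); first by rewrite leq_mul2r dP1 orbT.
rewrite -!mulnA leq_mul2l; apply/orP; right.
rewrite /wcount wsum_cat -wsum_mulr mulnC -wsum_mulr; apply: leq_wsum => s sz_s.
case: asboolP => [P1s|_]; last by rewrite mul0n.
by rewrite mul1n mulnC; apply: dP2.
Qed.

Lemma wcount_or m P Q : wcount m (fun s => P s \/ Q s) <= wcount m P + wcount m Q.
Proof.
rewrite -wsum_add; apply: leq_wsum => s _.
by rewrite asbool_or; do 2!case: `[< _ >].
Qed.

Lemma sum_mem (X : {set V}) : \sum_x (x \in X : nat) = #|X|.
Proof. by rewrite -sum1_card [RHS]big_mkcond; apply: eq_bigr => x _; case: (x \in X). Qed.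

(** A union bound over the letters: each letter lies in [X] or repeats an earlier letter with
    probability at most [(m + #|X|) / n]. *)
Lemma wcount_not_fresh m (X : {set V}) :
  n * wcount m (fun s => ~~ (uniq s && ~~ has (mem X) s)) <= m * (m + #|X|) * n ^ m.
Proof.
elim: m X => [|m IHm] X; first by rewrite /wcount /= asboolb muln0.
have step x : wcount m (fun s => ~~ (uniq (x :: s) && ~~ has (mem X) (x :: s)))
    <= (x \in X) * n ^ m +
       wcount m (fun s => ~~ (uniq s && ~~ has (mem (x |: X)) s)).
  case: (boolP (x \in X)) => [Xx|X'x].
    by rewrite mul1n (leq_trans (wcount_max _ _)) ?leq_addr.
  rewrite mul0n add0n; apply: leq_wcount => s _; apply: contra => /andP[Us].
  rewrite /= Us (negPf X'x) andbT /= => /hasPn sX.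
  apply/andP; split; first by apply/negP => /sX /=; rewrite !inE eqxx.
  by apply/hasPn => y /sX /=; rewrite !inE negb_or => /andP[].
have cardU x : #|x |: X| <= #|X|.+1.
  by rewrite cardsU1; case: (x \in X); rewrite /= ?add0n ?add1n ?leqnSn.
have le1 : wcount m.+1 (fun s => ~~ (uniq s && ~~ has (mem X) s)) <=
    \sum_x ((x \in X) * n ^ m +
       wcount m (fun s => ~~ (uniq s && ~~ has (mem (x |: X)) s))).
  by apply: leq_sum => x _; apply: step.
apply: (leq_trans (leq_mul (leqnn n) le1)).
rewrite big_split /= -big_distrl /= sum_mem mulnDr big_distrr /=.
have le2 : \sum_x n * wcount m (fun s => ~~ (uniq s && ~~ has (mem (x |: X)) s)) <=
    n * (m * (m + #|X|.+1) * n ^ m).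
  rewrite -[X in _ <= X]sum_nat_const; apply: leq_sum => x _.
  by apply: leq_trans (IHm _) _; rewrite leq_mul2r leq_mul2l leq_add2l cardU !orbT.
apply: (leq_trans (leq_add (leqnn _) le2)); rewrite expnS.
have -> : n * (#|X| * n ^ m) + n * (m * (m + #|X|.+1) * n ^ m)
          = (#|X| + m * (m + #|X|.+1)) * (n * n ^ m) by lia.
by rewrite leq_mul2r; apply/orP; right; lia.
Qed.
End Words.

(** * Edges, matchings and words that split into edges *)

Section Edges.
Local Open Scope nat_scope.
Variables (V : finType) (H : {set {set V}}).
Implicit Types (s t : seq V) (M R N : {set {set V}}).

Definition edge_word s := (size s == 4) && ([set x in s] \in H).
Local Notation ed := edge_word.

(** Gluing partial matchings is concatenation, and only the multiset of letters matters;
    disjointness is imposed once, on the final word. *)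
Definition splits s : Prop := exists2 ws, all ed ws & perm_eq s (flatten ws).

Lemma edge_word_perm s t : perm_eq s t -> ed s = ed t.
Proof.
move=> st; rewrite /ed (perm_size st); congr (_ && (_ \in H)).
by apply/setP=> x; rewrite !inE (perm_mem st).
Qed.

Lemma splits_perm s t : perm_eq s t -> splits s -> splits t.
Proof.
by move=> st [ws ed_ws s_ws]; exists ws => //; rewrite -(permPl st).
Qed.

Lemma splits_cat s t : splits s -> splits t -> splits (s ++ t).
Proof.
move=> [ws ed_ws s_ws] [ws' ed_ws' t_ws']; exists (ws ++ ws').
  by rewrite all_cat ed_ws.
by rewrite flatten_cat perm_cat.
Qed.

Lemma splits_nil : splits [::].
Proof. by exists [::]. Qed.

Lemma splits_edge s : ed s -> splits s.
Proof. by move=> ed_s; exists [:: s]; rewrite /= ?ed_s // cats0. Qed.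

Definition matching M := (M \subset H) && trivIset M.

Lemma matching_sub M R : R \subset M -> matching M -> matching R.
Proof.
move=> sRM /andP[sMH tM]; rewrite /matching (subset_trans sRM sMH).
exact: trivIsetS sRM tM.
Qed.

Lemma matchingU M N :
    matching M -> matching N -> [disjoint cover M & cover N] ->
  matching (M :|: N).
Proof.
move=> /andP[sMH tM] /andP[sNH tN] dMN.
by rewrite /matching subUset sMH sNH trivIsetU.
Qed.

Lemma cover_setU M N : cover (M :|: N) = cover M :|: cover N.
Proof. by rewrite /cover bigcup_setU. Qed.

Hypothesis Hunif : uniform 4 H.

Lemma card_edge e : e \in H -> #|e| = 4.
Proof. by move/(forall_inP Hunif)/eqP. Qed.

Lemma edge_word_uniq s : ed s -> uniq s.
Proof.
case/andP=> /eqP sz_s /card_edge; rewrite cardsE => card_s.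
by apply/card_uniqP; rewrite card_s.
Qed.

Lemma card_cover_matching M : matching M -> #|cover M| = 4 * #|M|.
Proof.
case/andP=> sMH; rewrite /trivIset => /eqP <-.
rewrite mulnC -sum_nat_const; apply: eq_bigr => e eM.
exact/card_edge/(subsetP sMH).
Qed.

Lemma matchingU_card M N :
    matching M -> matching N -> [disjoint cover M & cover N] ->
  #|M :|: N| = #|M| + #|N|.
Proof.
move=> mM mN dMN; have /card_cover_matching := matchingU mM mN dMN.
rewrite cover_setU cardsU (disjoint_setI0 dMN) cards0 subn0.
by rewrite !card_cover_matching //; lia.
Qed.

Lemma matchingD_cover M R : matching M -> R \subset M ->
  cover (M :\: R) = cover M :\: cover R.
Proof.
move=> /andP[_ tM] sRM; apply/setP=> x; rewrite !inE.
apply/bigcupP/andP=> [[e /setDP[eM eR] xe] | [xR /bigcupP[e eM xe]]].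
  split; last by apply/bigcupP; exists e.
  apply/bigcupP=> [[f fR xf]]; case/negP: eR.
  suff -> : e = f by [].
  apply: contraTeq xe => nef; have /trivIsetP := tM.
  move=> /(_ e f eM (subsetP sRM _ fR) nef) /disjointFl -> //.
exists e => //; rewrite inE eM andbT; apply: contra xR => eR.
by apply/bigcupP; exists e.
Qed.

Lemma words_matching ws : all ed ws -> uniq (flatten ws) ->
  exists M, [/\ matching M, cover M = [set x in flatten ws] & #|M| = size ws].
Proof.
elim: ws => [|w ws IHws] /=.
  move=> _ _; exists set0; rewrite /matching sub0set /trivIset /cover !big_set0 !cards0.
  by split=> //; apply/setP=> x; rewrite !inE.
case/andP=> ed_w /IHws{}IHws; rewrite cat_uniq => /and3P[Uw /hasPn dw /IHws[M [mM cM sM]]].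
have cw : cover [set [set x in w]] = [set x in w] by rewrite /cover big_set1.
have mw : matching [set [set x in w]].
  case/andP: ed_w => _ wH; rewrite /matching sub1set wH /trivIset big_set1 cw eqxx //.
have dwM : [disjoint cover [set [set x in w]] & cover M].
  rewrite cw cM disjoint_sym disjoints_subset.
  by apply/subsetP => x; rewrite !inE => /dw.
exists ([set [set x in w]] :|: M); split; first exact: matchingU.
  by rewrite cover_setU cw cM; apply/setP=> x; rewrite !inE mem_cat.
by rewrite matchingU_card // cards1 sM.
Qed.

Lemma splits_matching s : splits s -> uniq s ->
  exists2 M, matching M & cover M = [set x in s].
Proof.
case=> ws ed_ws s_ws Us; have [|M [mM cM _]] := words_matching ed_ws.
  by rewrite -(perm_uniq s_ws).
by exists M => //; rewrite cM; apply/setP=> x; rewrite !inE (perm_mem s_ws).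
Qed.

Lemma matching_augment M R ws :
    matching M -> R \subset M -> all ed ws -> uniq (flatten ws) ->
    {subset flatten ws <= cover R :|: ~: cover M} -> #|R| < size ws ->
  exists M', [/\ matching M', #|M| < #|M'| &
                 cover M' \subset cover M :|: [set x in flatten ws]].
Proof.
move=> mM sRM ed_ws Uws sub_ws ltR.
have [N [mN cN sN]] := words_matching ed_ws Uws.
have mD : matching (M :\: R) by apply: matching_sub mM; exact: subsetDl.
have dDN : [disjoint cover (M :\: R) & cover N].
  rewrite matchingD_cover // cN disjoints_subset.
  apply/subsetP=> x; rewrite !inE => /andP[xR xM].
  by apply/negP=> /sub_ws; rewrite !inE (negPf xR) xM.
exists (M :\: R :|: N); split; first exact: matchingU.
  rewrite matchingU_card // sN; have := cardsID R M.
  by rewrite (setIidPr sRM); lia.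
rewrite cover_setU cN setSU // matchingD_cover //; exact: subsetDl.
Qed.

End Edges.

(** * Bipartite patterns between two blocks *)

Section BipartitePatterns.
Local Open Scope nat_scope.
Implicit Types (f : 'I_4 -> 'I_4 -> bool).

Lemma sum_ord4 (F : 'I_4 -> nat) :
  \sum_(u < 4) F u = F (inord 0) + F (inord 1) + F (inord 2) + F (inord 3).
Proof.
rewrite !big_ord_recr big_ord0 /= add0n.
congr (_ + _ + _ + _); congr F; apply: val_inj; rewrite /= inordK //.
Qed.

Definition two_rows f := exists u, exists u', u != u' /\ forall v, f u v && f u' v.

Definition three_matching f := exists qs : seq ('I_4 * 'I_4),
  [/\ size qs = 3, uniq (unzip1 qs), uniq (unzip2 qs) & all (fun q => f q.1 q.2) qs].

Lemma ord4P (P : 'I_4 -> Prop) :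
  P (inord 0) -> P (inord 1) -> P (inord 2) -> P (inord 3) -> forall u, P u.
Proof.
move=> P0 P1 P2 P3 [[|[|[|[|//]]]] lt_u4].
- by rewrite (_ : Ordinal _ = inord 0) //; apply: val_inj; rewrite /= inordK.
- by rewrite (_ : Ordinal _ = inord 1) //; apply: val_inj; rewrite /= inordK.
- by rewrite (_ : Ordinal _ = inord 2) //; apply: val_inj; rewrite /= inordK.
- by rewrite (_ : Ordinal _ = inord 3) //; apply: val_inj; rewrite /= inordK.
Qed.

Lemma eq_inord4 i j : i < 4 -> j < 4 -> (inord i == inord j :> 'I_4) = (i == j).
Proof. by move=> lti ltj; rewrite -val_eqE /= !inordK. Qed.

(** The complete bipartite graph is the union of four perfect matchings, each of which holds at most
    two edges of a pattern without three disjoint edges. Equality everywhere makes the matrix of the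
    pattern a sum of a row function and a column function. *)
Lemma bipartite_patterns f :
  [\/ three_matching f, \sum_u \sum_v f u v <= 7
   | \sum_u \sum_v f u v <= 8 /\ (two_rows f \/ two_rows (fun u v => f v u))].
Proof.
have [h|no3] := pselect (three_matching f); first by constructor 1.
pose g i j : nat := f (inord i) (inord j).
have gle1 i j : g i j <= 1 by exact: leq_b1.
have no3' i1 i2 i3 j1 j2 j3 : uniq [:: i1; i2; i3] -> uniq [:: j1; j2; j3] ->
   all (ltn^~ 4) [:: i1; i2; i3; j1; j2; j3] -> g i1 j1 + g i2 j2 + g i3 j3 <= 2.
  move=> /= Ui Uj /and5P[? ? ? ? /and3P[? ? _]].
  rewrite leqNgt; apply/negP=> g3; case: no3.
  exists [:: (inord i1, inord j1); (inord i2, inord j2); (inord i3, inord j3)].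
  split=> //=; first by move: Ui; rewrite !inE !eq_inord4.
    by move: Uj; rewrite !inE !eq_inord4.
  by move: g3; rewrite /g; do 3!case: (f _ _).
have pm j0 j1 j2 j3 : uniq [:: j0; j1; j2; j3] && all (ltn^~ 4) [:: j0; j1; j2; j3] ->
    g 0 j0 + g 1 j1 + g 2 j2 + g 3 j3 <= 2.
  rewrite /= !inE !negb_or -!andbA => /and5P[n01 n02 n03 n12 /and5P[n13 n23 _ lt0 /and4P[lt1 lt2 lt3 _]]].
  have U012 : uniq [:: j0; j1; j2] by rewrite /= !inE negb_or n01 n02 n12.
  have U013 : uniq [:: j0; j1; j3] by rewrite /= !inE negb_or n01 n03 n13.
  have U023 : uniq [:: j0; j2; j3] by rewrite /= !inE negb_or n02 n03 n23.
  have U123 : uniq [:: j1; j2; j3] by rewrite /= !inE negb_or n12 n13 n23.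
  have := no3' 0 1 2 _ _ _ isT U012; have := no3' 0 1 3 _ _ _ isT U013.
  have := no3' 0 2 3 _ _ _ isT U023; have := no3' 1 2 3 _ _ _ isT U123.
  rewrite /= lt0 lt1 lt2 lt3 /= => /(_ isT) h1 /(_ isT) h2 /(_ isT) h3 /(_ isT) h4.
  have := gle1 0 j0; have := gle1 1 j1; have := gle1 2 j2; have := gle1 3 j3; lia.
have S16 : \sum_u \sum_v f u v =
   (g 0 0 + g 0 1 + g 0 2 + g 0 3) + (g 1 0 + g 1 1 + g 1 2 + g 1 3) +
   (g 2 0 + g 2 1 + g 2 2 + g 2 3) + (g 3 0 + g 3 1 + g 3 2 + g 3 3).
  by rewrite sum_ord4 !sum_ord4.
have le8 : \sum_u \sum_v f u v <= 8.
  have := pm 0 1 2 3 isT; have := pm 1 2 3 0 isT; have := pm 2 3 0 1 isT; have := pm 3 0 1 2 isT.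
  by rewrite S16; lia.
have [|gt7] := leqP (\sum_u \sum_v f u v) 7; [by constructor 2 | constructor 3; split => //].
(* Every perfect matching of the complete bipartite graph belongs to a partition into four perfect
   matchings. Each holds at most two edges of the pattern and there are eight of them, so each holds
   exactly two. *)
have pm2 j0 j1 j2 j3 : perm_eq [:: j0; j1; j2; j3] [:: 0; 1; 2; 3] ->
    g 0 j0 + g 1 j1 + g 2 j2 + g 3 j3 = 2.
  move=> pj; have Uj : uniq [:: j0; j1; j2; j3] by rewrite (perm_uniq pj).
  have ltj : all (ltn^~ 4) [:: j0; j1; j2; j3] by rewrite (perm_all _ pj).
  have row i : g i 0 + g i 1 + g i 2 + g i 3 = g i j0 + g i j1 + g i j2 + g i j3.
    have : \sum_(j <- [:: j0; j1; j2; j3]) g i j = \sum_(j <- [:: 0; 1; 2; 3]) g i j.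
      exact: perm_big.
    by rewrite !big_cons !big_nil; lia.
  have ok k : uniq (rot k [:: j0; j1; j2; j3]) && all (ltn^~ 4) (rot k [:: j0; j1; j2; j3]).
    by rewrite rot_uniq Uj (perm_all _ (permEl (perm_rot k _))).
  have := pm _ _ _ _ (ok 0); have := pm _ _ _ _ (ok 1).
  have := pm _ _ _ _ (ok 2); have := pm _ _ _ _ (ok 3).
  by move: gt7; rewrite S16 !row; lia.
(* Transposing two columns keeps the sum equal to two, so the pattern is a sum of a row function and
   a column function. *)
have m11 : g 1 1 + g 0 0 = g 0 1 + g 1 0.
  by have := pm2 0 1 2 3 isT; have := pm2 1 0 2 3 isT; lia.
have m12 : g 1 2 + g 0 0 = g 0 2 + g 1 0.
  by have := pm2 0 2 1 3 isT; have := pm2 2 0 1 3 isT; lia.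
have m13 : g 1 3 + g 0 0 = g 0 3 + g 1 0.
  by have := pm2 0 3 1 2 isT; have := pm2 3 0 1 2 isT; lia.
have m21 : g 2 1 + g 0 0 = g 0 1 + g 2 0.
  by have := pm2 0 2 1 3 isT; have := pm2 1 2 0 3 isT; lia.
have m22 : g 2 2 + g 0 0 = g 0 2 + g 2 0.
  by have := pm2 0 1 2 3 isT; have := pm2 2 1 0 3 isT; lia.
have m23 : g 2 3 + g 0 0 = g 0 3 + g 2 0.
  by have := pm2 0 1 3 2 isT; have := pm2 3 1 0 2 isT; lia.
have m31 : g 3 1 + g 0 0 = g 0 1 + g 3 0.
  by have := pm2 0 2 3 1 isT; have := pm2 1 2 3 0 isT; lia.
have m32 : g 3 2 + g 0 0 = g 0 2 + g 3 0.
  by have := pm2 0 1 3 2 isT; have := pm2 2 1 3 0 isT; lia.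
have m33 : g 3 3 + g 0 0 = g 0 3 + g 3 0.
  by have := pm2 0 1 2 3 isT; have := pm2 3 1 2 0 isT; lia.
have pick (h : nat -> nat) : (forall i, h i <= 1) -> h 0 + h 1 + h 2 + h 3 = 2 ->
    exists a, exists b, [/\ a < 4, b < 4, a != b, h a = 1 & h b = 1].
  move=> h1 h2; have := h1 0; have := h1 1; have := h1 2; have := h1 3.
  have [h01|h01] := eqVneq (h 0) 1; have [h11|h11] := eqVneq (h 1) 1;
  have [h21|h21] := eqVneq (h 2) 1 => *;
    by [exists 0; exists 1; split=> //; lia | exists 0; exists 2; split=> //; lia |
        exists 0; exists 3; split=> //; lia | exists 1; exists 2; split=> //; lia |
        exists 1; exists 3; split=> //; lia | exists 2; exists 3; split=> //; lia | lia].
rewrite S16 in gt7 le8.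
(* A 0-1 matrix that is such a sum is constant along all columns or along all rows. *)
have [[c1 c2 c3]|[r1 r2 r3]] : [/\ g 1 0 = g 0 0, g 2 0 = g 0 0 & g 3 0 = g 0 0] \/
                             [/\ g 0 1 = g 0 0, g 0 2 = g 0 0 & g 0 3 = g 0 0].
- have [/and3P[/eqP ? /eqP ? /eqP ?]|nc] :=
    boolP [&& g 1 0 == g 0 0, g 2 0 == g 0 0 & g 3 0 == g 0 0]; first by left.
  right; have := gle1 1 1; have := gle1 2 1; have := gle1 3 1; have := gle1 1 2.
  have := gle1 2 2; have := gle1 3 2; have := gle1 1 3; have := gle1 2 3; have := gle1 3 3.
  have := gle1 0 0; have := gle1 0 1; have := gle1 0 2; have := gle1 0 3.
  have := gle1 1 0; have := gle1 2 0; have := gle1 3 0.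
  suff : (g 1 0 != g 0 0) || (g 2 0 != g 0 0) || (g 3 0 != g 0 0).
    by move=> H0 *; split; move: H0 => /orP[/orP[]|]; lia.
  by move: nc; rewrite !negb_and orbA.
- right; have [a [b [lta ltb nab ga gb]]] : exists a, exists b,
     [/\ a < 4, b < 4, a != b, g 0 a = 1 & g 0 b = 1] by apply: (pick (g 0)) => //; lia.
  have col j : j < 4 -> g 0 j = 1 -> forall u, f u (inord j).
    move=> ltj gj; apply: (@ord4P (fun u => f u (inord j))); apply: contraT => /negPf fF.
    + by move: gj; rewrite /g fF.
    + have : g 1 j = 0 by rewrite /g fF.
      by move: j ltj gj {fF} => [|[|[|[|]]]] //; lia.
    + have : g 2 j = 0 by rewrite /g fF.
      by move: j ltj gj {fF} => [|[|[|[|]]]] //; lia.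
    + have : g 3 j = 0 by rewrite /g fF.
      by move: j ltj gj {fF} => [|[|[|[|]]]] //; lia.
  exists (inord a), (inord b); split; first by rewrite eq_inord4.
  by move=> v; rewrite !col.
- left; have [a [b [lta ltb nab ga gb]]] : exists a, exists b,
     [/\ a < 4, b < 4, a != b, g a 0 = 1 & g b 0 = 1] by apply: (pick (g^~ 0)) => //; lia.
  have row j : j < 4 -> g j 0 = 1 -> forall v, f (inord j) v.
    move=> ltj gj; apply: (@ord4P (fun u => f (inord j) u)); apply: contraT => /negPf fF.
    + by move: gj; rewrite /g fF.
    + have : g j 1 = 0 by rewrite /g fF.
      by move: j ltj gj {fF} => [|[|[|[|]]]] //; lia.
    + have : g j 2 = 0 by rewrite /g fF.
      by move: j ltj gj {fF} => [|[|[|[|]]]] //; lia.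
    + have : g j 3 = 0 by rewrite /g fF.
      by move: j ltj gj {fF} => [|[|[|[|]]]] //; lia.
  exists (inord a), (inord b); split; first by rewrite eq_inord4.
  by move=> v; rewrite !row.
Qed.
End BipartitePatterns.

(** * Augmenting a matching block by block *)

Section Auxiliary.
Local Open Scope nat_scope.

Lemma pigeonhole_fiber (I C : finType) (c : I -> C) (A : {set I}) r :
  r * #|C| < #|A| -> exists d, r < #|[set i in A | c i == d]|.
Proof.
move=> ltA; apply/existsP; apply: contraLR ltA; rewrite negb_exists -leqNgt => /forallP fib.
rewrite -sum1_card (partition_big c xpredT) //= mulnC -sum_nat_const.
apply: leq_sum => d _; rewrite sum1_card; move: (fib d); rewrite -leqNgt.
by apply: leq_trans; apply: subset_leq_card; apply/subsetP => i; rewrite !inE.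
Qed.

Lemma card_uniq_seq (I : finType) (A : {set I}) r :
  r <= #|A| -> exists s : seq I, [/\ size s = r, uniq s & {subset s <= A}].
Proof.
move=> le_rA; exists (take r (enum A)); split.
- by rewrite size_take -cardE; move: le_rA; rewrite leq_eqVlt => /orP[/eqP->|->]; rewrite ?ltnn.
- exact/take_uniq/enum_uniq.
- by move=> x /mem_take; rewrite mem_enum.
Qed.

Lemma quarter_le T u v s : u <= v -> 4 * v <= 3 * T -> u + s = T -> T <= 4 * s.
Proof. lia. Qed.

Lemma average_le (I : eqType) (s : seq I) (F : I -> nat) c :
  0 < size s -> \sum_(i <- s) F i <= c * size s -> exists2 i, i \in s & F i <= c.
Proof.
move=> s_gt0 leF; apply: contrapT => noF.
have : \sum_(i <- s) c.+1 <= \sum_(i <- s) F i.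
  rewrite big_seq [X in _ <= X]big_seq; apply: leq_sum => i si.
  by rewrite ltnNge; apply/negP=> leFi; apply: noF; exists i.
by rewrite big_const_seq count_predT iter_addn_0; nia.
Qed.

Variable V : eqType.
Implicit Types (ps qs : seq (V * V)) (bl : seq (seq V)).

Definition pair_letters ps : seq V := flatten [seq [:: p.1; p.2] | p <- ps].
Definition quads ps qs := [seq [:: r.1.1; r.1.2; r.2.1; r.2.2] | r <- zip ps qs].

Lemma perm_quads ps qs : size ps = size qs ->
  perm_eq (flatten (quads ps qs)) (pair_letters ps ++ pair_letters qs).
Proof.
elim: ps qs => [|p ps IHps] [|q qs] //= [/IHps IH].
rewrite /pair_letters /= -/(pair_letters _) -/(pair_letters _) -/(quads _ _) !perm_cons.
rewrite (perm_trans (_ : perm_eq _ ([:: q.1; q.2] ++ (pair_letters ps ++ pair_letters qs)))) //.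
  by rewrite /= !perm_cons.
by rewrite perm_catCA.
Qed.

Lemma mem_zip2 (A B : eqType) (s : seq A) (t : seq B) x :
  x \in zip s t -> (x.1 \in s) && (x.2 \in t).
Proof.
elim: s t => [|y s IHs] [|z t] //=; rewrite inE => /predU1P[->|/IHs/andP[xs xt]].
  by rewrite /= !inE !eqxx.
by rewrite !inE xs xt !orbT.
Qed.

Lemma perm_pair_letters ps : perm_eq (pair_letters ps) (unzip1 ps ++ unzip2 ps).
Proof.
elim: ps => //= p ps IHps; rewrite /pair_letters /= perm_cons -/(pair_letters ps).
by rewrite perm_sym -cat1s perm_catCA /= perm_cons perm_sym.
Qed.

Lemma uniq_flatten_word bl w : uniq (flatten bl) -> w \in bl -> uniq w.
Proof.
elim: bl => //= v bl IHbl; rewrite cat_uniq inE => /and3P[Uv _ Ubl] /predU1P[-> //|].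
exact: IHbl.
Qed.

Lemma uniq_of_flatten bl : uniq (flatten bl) -> (forall w, w \in bl -> w != [::]) -> uniq bl.
Proof.
elim: bl => //= w s IHs; rewrite cat_uniq => /and3P[_ /hasPn dw Us] ne.
rewrite IHs ?andbT // => [|v vs]; last by apply: ne; rewrite inE vs orbT.
apply/negP=> ws; have := ne w (mem_head _ _); case def_w: (w) => [|x w1] // _.
have /dw : x \in flatten s by apply/flattenP; exists w; rewrite // def_w mem_head.
by rewrite def_w mem_head.
Qed.

Lemma uniq_flatten_disjoint bl w w' x : uniq (flatten bl) ->
  w \in bl -> w' \in bl -> x \in w -> x \in w' -> w = w'.
Proof.
elim: bl => //= v bl IHbl; rewrite cat_uniq !inE => /and3P[Uv /hasPn dv Ubl].
have no y u : u \in bl -> y \in u -> y \in v -> False.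
  by move=> ubl yu yv; have /dv/negP[] : y \in flatten bl by apply/flattenP; exists u.
move=> /predU1P[->|wbl] /predU1P[->|w'bl] xw xw' //.
- by case: (no x w').
- by case: (no x w).
- exact: IHbl.
Qed.

Lemma uniq_flatten_sub bl bs : uniq (flatten bl) -> uniq bs -> {subset bs <= bl} ->
  uniq (flatten bs).
Proof.
move=> Ubl; elim: bs => //= w bs IHbs /andP[w'bs Ubs] sub.
rewrite cat_uniq IHbs // => [|v vbs]; last by apply: sub; rewrite inE vbs orbT.
rewrite (uniq_flatten_word Ubl (sub w (mem_head _ _))) /= andbT.
apply/hasPn => x /flattenP[v vbs xv]; apply: contra w'bs => /= xw.
by rewrite (uniq_flatten_disjoint Ubl _ _ xw xv) // sub ?mem_head // inE vbs orbT.
Qed.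

End Auxiliary.

Section AugmentingBlocks.
Local Open Scope nat_scope.
Variables (V : finType) (H : {set {set V}}).
Hypothesis Hunif : uniform 4 H.
Local Notation ed := (edge_word H).
Variables (W0 : {set V}) (M : {set {set V}}) (T : nat) (a b : 'I_T -> V) (bl : seq (seq V)).
Variable x0 : V.
Hypothesis matM : matching H M.
Hypothesis MW0 : cover M \subset ~: W0.
Hypothesis max_M : forall M', matching H M' -> cover M' \subset ~: W0 -> #|M'| <= #|M|.
Hypothesis uniq_pairs :
  forall ts, uniq ts -> uniq (pair_letters [seq (a t, b t) | t <- ts]).
Hypothesis bl_size : forall w, w \in bl -> size w = 4.
Hypothesis Ubl : uniq (flatten bl).
Hypothesis real_or_fake : forall w, w \in bl ->
  [set x in w] \in M \/ {in w, forall x, x \notin cover M}.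
Hypothesis blW0 : {in flatten bl, forall x, x \notin W0}.
Hypothesis pairs_out : forall t x, x \in [:: a t; b t] ->
  [/\ x \notin flatten bl, x \notin cover M & x \notin W0].

(** The new edges use one pair of uncovered vertices each. They replace the blocks [bs] that are
    edges of [M]; the other blocks of [bs] consist of uncovered vertices and cost nothing, so a
    larger number of new edges would contradict the maximality of [M]. *)
Lemma blocks_no_augment bs ts qs : uniq ts -> size ts = size qs ->
    {subset bs <= bl} -> uniq (pair_letters qs) -> {subset pair_letters qs <= flatten bs} ->
    (forall t q, t \in ts -> q \in qs -> ed [:: a t; b t; q.1; q.2]) ->
  size qs <= size bs.
Proof.
move=> Uts sz_ts sub_bs Uqs sub_qs ed_qs; rewrite leqNgt; apply/negP=> lt_bs.
pose ps := [seq (a t, b t) | t <- ts].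
have sz_ps : size ps = size qs by rewrite size_map.
pose R := M :&: [set e in [seq [set x in w] | w : seq V <- bs]].
have in_ps x : x \in pair_letters ps -> exists t, x \in [:: a t; b t].
  by case/flattenP=> w /mapP[p /mapP[t _ ->] ->] xt; exists t.
have bs_flat x : x \in flatten bs -> x \in flatten bl.
  by case/flattenP=> w /sub_bs wbl xw; apply/flattenP; exists w.
have pq := perm_quads sz_ps.
have [|||||M' [mM' ltM sM']] := @matching_augment V H Hunif M R (quads ps qs) matM.
- exact: subsetIl.
- apply/allP=> w /mapP[[p q] /mem_zip2/andP[/= /mapP[t tts ->] qqs] ->] /=.
  exact: ed_qs.
- rewrite (perm_uniq pq) cat_uniq uniq_pairs // Uqs andbT /=; apply/hasPn=> x /sub_qs/bs_flat xbl.
  by apply/negP=> /in_ps[t /pairs_out[]]; rewrite xbl.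
- move=> x; rewrite (perm_mem pq) mem_cat => /orP[/in_ps[t /pairs_out[_ xM _]]|/sub_qs].
    by rewrite !inE xM orbT.
  case/flattenP=> w wbs xw; rewrite inE; have [wM|fake] := real_or_fake (sub_bs _ wbs).
    apply/orP; left; apply/bigcupP; exists [set y in w]; rewrite inE // wM inE /=.
    exact: map_f.
  by rewrite !inE fake ?orbT.
- rewrite size_map size_zip sz_ps minnn; apply: leq_ltn_trans lt_bs.
  apply: (@leq_trans #|[set e in [seq [set x in w] | w : seq V <- bs]]|).
    exact/subset_leq_card/subsetIr.
  by rewrite cardsE (leq_trans (card_size _)) ?size_map.
- suff /(max_M mM') : cover M' \subset ~: W0 by rewrite leqNgt ltM.
  apply: subset_trans sM' _; rewrite subUset MW0; apply/subsetP=> x.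
  rewrite !inE (perm_mem pq) mem_cat => /orP[/in_ps[t /pairs_out[]] //|].
  by move=> /sub_qs/bs_flat/blW0.
Qed.

Definition pattern w w' t : {ffun 'I_4 * 'I_4 -> bool} :=
  [ffun uv : 'I_4 * 'I_4 => ed [:: a t; b t; nth x0 w uv.1; nth x0 w' uv.2]].

Local Notation pat := pattern.
Definition relation_of (p : {ffun 'I_4 * 'I_4 -> bool}) u v := p (u, v).
Local Notation K16 := #|{ffun 'I_4 * 'I_4 -> bool}|.

Lemma word_of_index w (i : 'I_4) : w \in bl -> nth x0 w i \in w.
Proof. by move=> wbl; rewrite mem_nth // bl_size. Qed.

Lemma uniq_map_nth w (us : seq 'I_4) : w \in bl -> uniq us -> uniq [seq nth x0 w i | i : 'I_4 <- us].
Proof.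
move=> wbl Uus; rewrite map_inj_in_uniq // => i j _ _ /eqP.
rewrite nth_uniq ?bl_size ?(uniq_flatten_word Ubl) //.
by move/eqP/val_inj.
Qed.

(** Three pairs with the same pattern give three edges that replace the two blocks. *)
Lemma few_three_matchings w w' : w \in bl -> w' \in bl -> w != w' ->
  #|[set t | `[< three_matching (relation_of (pat w w' t)) >]]| <= 2 * K16.
Proof.
move=> wbl w'bl nww'; rewrite leqNgt; apply/negP=> /(pigeonhole_fiber (pat w w')).
case=> p /card_uniq_seq[ts [sz_ts Uts sub_ts]].
have patp t : t \in ts -> pat w w' t = p by move/sub_ts; rewrite inE => /andP[_ /eqP].
have [qs [sz_qs U1 U2 all_qs]] : three_matching (relation_of p).
  case: ts sz_ts patp sub_ts {Uts} => // t ts _ patp /(_ t (mem_head _ _)).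
  by rewrite !inE => /andP[/asboolP + _]; rewrite patp ?mem_head.
pose xs := [seq (nth x0 w q.1, nth x0 w' q.2) | q : 'I_4 * 'I_4 <- qs].
suff: size xs <= size [:: w; w'] by rewrite size_map sz_qs.
apply: (@blocks_no_augment _ ts) => //.
- by rewrite sz_ts size_map.
- by move=> v; rewrite !inE => /orP[] /eqP->.
- rewrite (perm_uniq (perm_pair_letters _)) cat_uniq.
  rewrite /unzip1 /unzip2 -!map_comp.
  have -> : [seq (fst \o (fun q : 'I_4 * 'I_4 => (nth x0 w q.1, nth x0 w' q.2))) i | i <- qs]
       = [seq nth x0 w i | i : 'I_4 <- unzip1 qs] by rewrite -map_comp.
  have -> : [seq (snd \o (fun q : 'I_4 * 'I_4 => (nth x0 w q.1, nth x0 w' q.2))) i | i <- qs]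
       = [seq nth x0 w' i | i : 'I_4 <- unzip2 qs] by rewrite -map_comp.
  rewrite !uniq_map_nth // andbT /=; apply/hasPn=> x /mapP[i _ ->].
  apply/negP=> /mapP[j _] eq_x; case/eqP: nww'.
  apply: (uniq_flatten_disjoint Ubl wbl w'bl (word_of_index j wbl)).
  by rewrite -eq_x word_of_index.
- move=> x /flattenP[v /mapP[q /mapP[r _ ->] ->]]; rewrite !inE /= cats0 mem_cat.
  by case/orP=> /eqP->; rewrite word_of_index ?orbT.
- move=> t q tts /mapP[r rqs ->] /=; have /allP/(_ r rqs) := all_qs.
  by rewrite /relation_of -(patp t tts) ffunE.
Qed.

(** If two vertices of [e] see all of [f], and two vertices of [f] see all of [g], then two edges go
    from [e] to the other two vertices of [f], and two edges from the first two vertices of [f] to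
    [g]: four edges replace three blocks. *)
Lemma no_dominating_path e f g ts : e \in bl -> f \in bl -> g \in bl ->
    e != f -> f != g -> e != g -> uniq ts -> size ts = 4 ->
    (forall t, t \in ts -> pat e f t = pat e f (nth t ts 0)) ->
    (forall t, t \in ts -> pat f g t = pat f g (nth t ts 0)) ->
    (forall t, t \in ts -> two_rows (relation_of (pat e f t))) ->
    (forall t, t \in ts -> two_rows (relation_of (pat f g t))) ->
  False.
Proof.
move=> ebl fbl gbl nef nfg neg Uts sz_ts pef pfg def dfg.
have [t0 t0ts eq_t0] : exists2 t0, t0 \in ts & forall t, nth t ts 0 = t0.
  by case: (ts) sz_ts => // t ts' _; exists t => //; exact: mem_head.
have [u [u' [nuu' duu']]] := def _ t0ts; have [z [z' [nzz' dzz']]] := dfg _ t0ts.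
(* The vertices [c] and [c'] of [f] receive the edges from [e], while [z] and [z'] send edges to
   [g]. *)
have /cards2P[c [c' [ncc' cc']]] : #|~: [set z; z']| == 2.
  by have := cardsC [set z; z']; rewrite cards2 nzz' card_ord -[4]/(2 + 2) => /addnI ->.
have /setP/(_ c) := cc'; rewrite !inE eqxx /= negb_or => /andP[ncz ncz'].
have /setP/(_ c') := cc'; rewrite !inE eqxx orbT /= negb_or => /andP[nc'z nc'z'].
pose o0 : 'I_4 := inord 0; pose o1 : 'I_4 := inord 1.
have no01 : o0 != o1 by rewrite eq_inord4.
pose N w (i : 'I_4) := nth x0 w i.
pose qs := [:: (N e u, N f c); (N e u', N f c'); (N f z, N g o0); (N f z', N g o1)].
have: ~~ (size qs <= size [:: e; f; g]) by [].
move/negP; apply.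
have Nin w i : w \in bl -> N w i \in w by apply: word_of_index.
have inj w i j : w \in bl -> (N w i == N w j) = (i == j).
  by move=> wbl; rewrite /N nth_uniq ?bl_size ?(uniq_flatten_word Ubl).
have dis w w' i j : w \in bl -> w' \in bl -> w != w' -> N w i == N w' j = false.
  move=> wbl w'bl nww'; apply/eqP=> eqN; case/eqP: nww'.
  apply: (uniq_flatten_disjoint Ubl wbl w'bl (Nin w i wbl)).
  by rewrite eqN Nin.
apply: (@blocks_no_augment _ ts) => //.
- by move=> w; rewrite !inE => /or3P[] /eqP->.
- rewrite (perm_uniq (perm_pair_letters _)) /= !inE !inj // !dis // 1?eq_sym //.
  rewrite !negb_or (eq_sym u') (eq_sym z c) (eq_sym z c') (eq_sym z' c) (eq_sym z' c').
  by rewrite nuu' nzz' ncc' ncz ncz' nc'z nc'z' no01.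
- move=> x; rewrite /= cats0 !mem_cat !inE in_nil orbF -!orbA /=.
  by do ?[case/orP=> [/eqP->|]; first by rewrite !Nin ?orbT]; move/eqP->; rewrite !Nin ?orbT.
- move=> t q tts; rewrite !inE.
  have Ef i j : (relation_of (pat e f t0) i j) -> ed [:: a t; b t; N e i; N f j].
    by rewrite /relation_of -(eq_t0 t) -pef // ffunE.
  have Eg i j : (relation_of (pat f g t0) i j) -> ed [:: a t; b t; N f i; N g j].
    by rewrite /relation_of -(eq_t0 t) -pfg // ffunE.
  case/or4P=> /eqP->; [apply: Ef | apply: Ef | apply: Eg | apply: Eg].
  + by have /andP[] := duu' c.
  + by have /andP[] := duu' c'.
  + by have /andP[] := dzz' o0.
  + by have /andP[] := dzz' o1.
Qed.

Definition dominated w w' t :=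
  let r := relation_of (pat w w' t) in two_rows r \/ two_rows (fun u v => r v u).

Definition bad_pairs w w' := [set t | (w == w') || ~~ `[< dominated w w' t >]].

Definition link_count t w w' : nat :=
  \sum_(x <- w) \sum_(y <- w') ed [:: a t; b t; x; y].

Lemma link_countE t w w' : w \in bl -> w' \in bl ->
  link_count t w w' = \sum_u \sum_v relation_of (pat w w' t) u v.
Proof.
move=> wbl w'bl; rewrite /link_count (big_nth x0) bl_size // big_mkord.
apply: eq_bigr => u _; rewrite (big_nth x0) bl_size // big_mkord.
by apply: eq_bigr => v _; rewrite /relation_of ffunE.
Qed.

(** A pair without three disjoint links contributes at most [8], and at most [7] when it is bad. The
    boundedly many other pairs contribute at most [16 + 1], an excess of [9] over [8] for each. The
    last term accounts for the diagonal. *)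
Lemma sum_link_count w w' : w \in bl -> w' \in bl ->
  \sum_t link_count t w w' + #|bad_pairs w w'| <= 8 * T + 18 * K16 + (w == w') * (9 * T).
Proof.
move=> wbl w'bl; rewrite -[#|bad_pairs _ _|]sum_mem -big_split /=.
have sumT c : \sum_(t < T) c = c * T by rewrite sum_nat_const card_ord mulnC.
have [eqw|neqw] := eqVneq w w'.
  apply: (@leq_trans (\sum_(t < T) 17)); last by rewrite sumT; lia.
  apply: leq_sum => t _; rewrite link_countE //.
  have : \sum_u \sum_v relation_of (pat w w' t) u v <= \sum_(u < 4) \sum_(v < 4) 1.
    by do 2!(apply: leq_sum => ? _); exact: leq_b1.
  rewrite !sum_nat_const !card_ord; have := leq_b1 (t \in bad_pairs w w'); lia.
rewrite mul0n addn0; have := few_three_matchings wbl w'bl neqw.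
set A := [set t | _] => leA.
apply: (@leq_trans (\sum_(t < T) (8 + 9 * (t \in A)))); last first.
  by rewrite big_split /= sumT -big_distrr /= sum_mem; lia.
apply: leq_sum => t _; rewrite link_countE // !inE (negPf neqw) /=.
have [h|h|[h1 h2]] := bipartite_patterns (relation_of (pat w w' t)).
- rewrite (asboolT h); have : \sum_u \sum_v relation_of (pat w w' t) u v <= \sum_(u < 4) \sum_(v < 4) 1.
    by do 2!(apply: leq_sum => ? _); exact: leq_b1.
  rewrite !sum_nat_const !card_ord => le16.
  exact: leq_trans (leq_add le16 (leq_b1 _)) _.
- exact: leq_trans (leq_add h (leq_b1 _)) (leq_addr _ _).
- by rewrite (asboolT (h2 : dominated w w' t)) /= addn0 (leq_trans h1) ?leq_addr.
Qed.

Lemma pattern_sym w w' t u v :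
  relation_of (pat w w' t) u v = relation_of (pat w' w t) v u.
Proof.
rewrite /relation_of !ffunE; apply: edge_word_perm.
by rewrite /= !perm_cons -[[:: _; _]]/([:: _] ++ [:: _]) perm_catC.
Qed.

(** The number of links is [8] on average, so [sum_link_count] leaves room for a quarter of bad
    patterns at most. Some three blocks then have dominated patterns for a quarter of the pairs, of
    which four have the same patterns. Domination orients the three pairs of blocks, and a
    tournament on three vertices contains a directed path. *)
Lemma blocks_average slack :
    0 < size bl -> 144 * K16 <= T -> 12 * (K16 * (K16 * K16)) < T ->
    8 * slack + 72 * size bl <= size bl ^ 2 ->
    (forall t, 8 * size bl ^ 2 <=
      \sum_(x <- flatten bl) \sum_(y <- flatten bl) ed [:: a t; b t; x; y] + slack) ->
  False.
Proof.
set k := size bl => k_gt0 leK16 ltK48 le_slack lb.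
have lb' t : 8 * k ^ 2 <= \sum_(w <- bl) \sum_(w' <- bl) link_count t w w' + slack.
  apply: (leq_trans (lb t)); rewrite leq_add2r big_flatten /=; apply: leq_sum => w _.
  rewrite exchange_big big_flatten; apply: leq_sum => w' _.
  by rewrite exchange_big.
have sum_bad : 4 * \sum_(w <- bl) \sum_(w' <- bl) #|bad_pairs w w'| <= T * k ^ 2.
  have h1 : \sum_(w <- bl) \sum_(w' <- bl) (\sum_t link_count t w w' + #|bad_pairs w w'|)
     <= \sum_(w <- bl) \sum_(w' <- bl) (8 * T + 18 * K16 + (w == w') * (9 * T)).
    rewrite big_seq [X in _ <= X]big_seq; apply: leq_sum => w wbl.
    rewrite big_seq [X in _ <= X]big_seq; apply: leq_sum => w' w'bl.
    exact: sum_link_count.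
  have Ubl' : uniq bl by apply: uniq_of_flatten Ubl _ => w /bl_size; case: w.
  have h2 : \sum_(w <- bl) \sum_(w' <- bl) (8 * T + 18 * K16 + (w == w') * (9 * T))
      = k * (k * (8 * T + 18 * K16)) + k * (9 * T).
    transitivity (\sum_(w <- bl) (k * (8 * T + 18 * K16) + 9 * T)); last first.
      by rewrite big_const_seq count_predT iter_addn_0 mulnC mulnDr.
    apply: eq_big_seq => w wbl; rewrite big_split /=; congr (_ + _).
      by rewrite big_const_seq count_predT iter_addn_0 mulnC.
    rewrite -big_distrl /= -[RHS]mul1n; congr (_ * _).
    rewrite (bigD1_seq w) //= eqxx big1 ?addn0 // => i.
    by rewrite eq_sym => /negPf->.
  have h3 : T * (8 * k ^ 2) <=
      \sum_(w <- bl) \sum_(w' <- bl) \sum_t link_count t w w' + T * slack.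
    have -> : \sum_(w <- bl) \sum_(w' <- bl) \sum_t link_count t w w' =
              \sum_t \sum_(w <- bl) \sum_(w' <- bl) link_count t w w'.
      by rewrite [RHS]exchange_big; apply: eq_bigr => w _; rewrite [RHS]exchange_big.
    have -> : T * slack = \sum_(t < T) slack by rewrite sum_nat_const card_ord.
    have -> : T * (8 * k ^ 2) = \sum_(t < T) (8 * k ^ 2) by rewrite sum_nat_const card_ord.
    by rewrite -big_split; apply: leq_sum => t _; apply: lb'.
  have h4 : \sum_(w <- bl) \sum_(w' <- bl) (\sum_t link_count t w w' + #|bad_pairs w w'|) =
      \sum_(w <- bl) \sum_(w' <- bl) \sum_t link_count t w w' +
      \sum_(w <- bl) \sum_(w' <- bl) #|bad_pairs w w'|.
    by rewrite -big_split; apply: eq_bigr => w _; rewrite -big_split.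
  move: h1; rewrite h2 h4; move: h3 => /=.
  move: (\sum_(w <- bl) \sum_(w' <- bl) \sum_t _) => x.
  move: (\sum_(w <- bl) \sum_(w' <- bl) _) => y h3 h1.
  have h5 : 4 * y <= 4 * (T * slack) + 72 * K16 * (k * k) + 36 * T * k.
    move: h3 h1; rewrite -mulnn; move: (T * slack) => z; lia.
  have h6 : 72 * K16 * (k * k) <= T * (k * k) - 72 * K16 * (k * k).
    by move: leK16; move: K16 => K leK; rewrite -mulnBl leq_mul2r; apply/orP; right; lia.
  have h7 : T * (8 * slack + 72 * k) <= T * (k * k) by rewrite leq_mul2l -mulnn in le_slack *; rewrite le_slack orbT.
  by move: h5 h6 h7; rewrite -mulnn; move: K16 => K; lia.
(* Averaging over triples of blocks, one block at a time. *)
have [e ebl he] : exists2 e, e \in bl & \sum_(f <- bl) \sum_(g <- bl)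
    4 * (#|bad_pairs e f| + #|bad_pairs f g| + #|bad_pairs e g|) <= 3 * T * k * k.
  apply: average_le => //.
  pose S3 F : nat := \sum_(e <- bl) \sum_(f <- bl) \sum_(g <- bl) F e f g.
  have -> : \sum_(e <- bl) \sum_(f <- bl) \sum_(g <- bl)
     4 * (#|bad_pairs e f| + #|bad_pairs f g| + #|bad_pairs e g|) =
     3 * (k * (4 * \sum_(w <- bl) \sum_(w' <- bl) #|bad_pairs w w'|)).
    have kc c : \sum_(g <- bl) c = k * c by rewrite big_const_seq count_predT iter_addn_0 mulnC.
    transitivity (4 * (S3 (fun e f g => #|bad_pairs e f|) + S3 (fun e f g => #|bad_pairs f g|)
                       + S3 (fun e f g => #|bad_pairs e g|))).
      rewrite /S3 -!big_split big_distrr; apply: eq_bigr => e _.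
      rewrite -!big_split big_distrr; apply: eq_bigr => f _.
      by rewrite -!big_split big_distrr.
    set B := \sum_(w <- bl) \sum_(w' <- bl) _.
    have -> : S3 (fun e f g => #|bad_pairs e f|) = k * B.
      rewrite /S3 /B big_distrr; apply: eq_bigr => e _.
      by rewrite big_distrr; apply: eq_bigr => f _; rewrite kc.
    have -> : S3 (fun e f g => #|bad_pairs f g|) = k * B by rewrite /S3 kc.
    have -> : S3 (fun e f g => #|bad_pairs e g|) = k * B.
      by rewrite /S3 /B big_distrr; apply: eq_bigr => e _; rewrite kc.
    lia.
  move: sum_bad; rewrite -/k -mulnn; set B := \sum_(w <- bl) _.
  move: B => B leB; have := leq_mul (leqnn (3 * k)) leB;  lia.
have [f fbl hf] := average_le k_gt0 he.
have [g gbl {he hf}hg] := average_le k_gt0 hf.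
pose S := ~: (bad_pairs e f :|: bad_pairs f g :|: bad_pairs e g).
have leS : T <= 4 * #|S|.
  have hU : #|bad_pairs e f :|: bad_pairs f g :|: bad_pairs e g|
     <= #|bad_pairs e f| + #|bad_pairs f g| + #|bad_pairs e g|.
    exact: leq_trans (leq_card_setU _ _) (leq_add (leq_card_setU _ _) (leqnn _)).
  have cS : #|bad_pairs e f :|: bad_pairs f g :|: bad_pairs e g| + #|S| = T.
    by rewrite cardsC card_ord.
  exact: (quarter_le hU hg cS).
have SP t w w' : t \in S -> (w, w') \in [:: (e, f); (f, g); (e, g)] -> w != w' /\ dominated w w' t.
  rewrite !inE !negb_or => /andP[/andP[h1 h2] h3].
  by case/or3P=> /eqP[-> ->]; [move: h1 | move: h2 | move: h3];
    rewrite ?negb_or negbK => /andP[? /asboolP].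
pose c t := (pat e f t, (pat f g t, pat e g t)).
have [|d /card_uniq_seq[ts [sz_ts Uts sub_ts]]] := @pigeonhole_fiber _ _ c S 3.
  rewrite !card_prod -[_ < _](ltn_pmul2l (isT : 0 < 4)).
  by apply: leq_trans leS; rewrite mulnA.
have inS t : t \in ts -> t \in S by move/sub_ts; rewrite inE => /andP[].
have ct t : t \in ts -> c t = d by move/sub_ts; rewrite inE => /andP[_ /eqP].
have [t0 t0ts eq_t0] : exists2 t0, t0 \in ts & forall t, nth t ts 0 = t0.
  by case: (ts) sz_ts => // t ts' _; exists t => //; exact: mem_head.
pose const w w' := forall t, t \in ts -> pat w w' t = pat w w' t0.
pose arrow w w' := two_rows (relation_of (pat w w' t0)).
have const_sym w w' : const w w' -> const w' w.
  move=> cw t tts; apply/ffunP=> -[u v].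
  by have := pattern_sym w' w t u v; have := pattern_sym w' w t0 u v; rewrite /relation_of cw // => -> ->.
have cef : const e f by move=> t tts; have := ct t tts; rewrite -(ct t0) // => -[].
have cfg : const f g by move=> t tts; have := ct t tts; rewrite -(ct t0) // => -[].
have ceg : const e g by move=> t tts; have := ct t tts; rewrite -(ct t0) // => -[].
have arrowP w w' : (w, w') \in [:: (e, f); (f, g); (e, g)] -> arrow w w' \/ arrow w' w.
  move=> /(SP t0 w w' (inS _ t0ts))[_ [|[u [u' [nu du]]]]]; first by left.
  by right; exists u, u'; split=> // v; rewrite !(pattern_sym w' w).
have nef : e != f by have [] := SP t0 e f (inS _ t0ts) (mem_head _ _).
have nfg : f != g by have [] := SP t0 f g (inS _ t0ts); rewrite // !inE eqxx orbT.
have neg : e != g by have [] := SP t0 e g (inS _ t0ts); rewrite // !inE eqxx !orbT.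
have path w1 w2 w3 : w1 \in bl -> w2 \in bl -> w3 \in bl ->
    w1 != w2 -> w2 != w3 -> w1 != w3 -> const w1 w2 -> const w2 w3 ->
    arrow w1 w2 -> arrow w2 w3 -> False.
  move=> b1 b2 b3 n12 n23 n13 c12 c23 a12 a23.
  apply: (@no_dominating_path w1 w2 w3 ts) => // t tts; rewrite ?eq_t0 ?c12 ?c23 //.
have [nfe ngf nge] : [/\ f != e, g != f & g != e] by rewrite !(eq_sym _ e) (eq_sym g f).
have [cfe cgf cge] : [/\ const f e, const g f & const g e] by split; apply: const_sym.
(* Each orientation of the triangle contains a directed path with two edges. *)
have [aef|afe] := arrowP e f (mem_head _ _); have [|afg|agf] := arrowP f g.
- by rewrite !inE eqxx orbT.
- exact: (path e f g).
- have [|aeg|age] := arrowP e g; first by rewrite !inE eqxx !orbT.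
  + exact: (path e g f).
  + exact: (path g e f).
- by rewrite !inE eqxx orbT.
- have [|aeg|age] := arrowP e g; first by rewrite !inE eqxx !orbT.
  + exact: (path f e g).
  + exact: (path f g e).
- exact: (path g f e).
Qed.
End AugmentingBlocks.

(** * Almost perfect matchings *)

Section CodegreeCounts.
Local Open Scope nat_scope.

Lemma chop4 (A : Type) (s : seq A) : exists ws r,
  [/\ s = flatten ws ++ r, all (fun w => size w == 4) ws & size r < 4].
Proof.
have [m] := ubnP (size s); elim: m s => // m IHm s; rewrite ltnS => le_sm.
have [lt4|ge4] := ltnP (size s) 4; first by exists [::], s.
have [|ws [r [def_s sz_ws lt_r]]] := IHm (drop 4 s); first by rewrite size_drop; lia.
exists (take 4 s :: ws), r; split=> //=.
  by rewrite -catA -def_s cat_take_drop.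
by rewrite sz_ws size_take; move: ge4; rewrite leq_eqVlt => /orP[/eqP<-|->].
Qed.

Variables (V : finType) (H : {set {set V}}).
Local Notation n := #|V|.
Local Notation ed := (edge_word H).

(** Each edge that contains [x] and [y] is counted twice, once for each order of the other two
    vertices. *)
Definition codeg x y : nat := \sum_z \sum_w ed [:: x; y; z; w].

(** The degree condition of all approximate arguments: every pair of vertices has degree at least [n
    ^ 2 / 4 - 3 * n / 2]. *)
Definition large_codegrees : Prop := forall x y, x != y -> n ^ 2 <= 2 * codeg x y + 6 * n.

Hypothesis Hunif : uniform 4 H.

Lemma codeg_restrict x y (s : seq V) : uniq s ->
  codeg x y <= \sum_(z <- s) \sum_(w <- s) ed [:: x; y; z; w] + 2 * ((n - size s) * n).
Proof.
move=> Us.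
have le_out (F : V -> nat) c : (forall z, F z <= c) -> \sum_z F z <= \sum_(z <- s) F z + (n - size s) * c.
  move=> leF; rewrite (bigID (mem s)) /= leq_add //.
    by rewrite -big_uniq.
  apply: (@leq_trans (\sum_(z in [predC s]) c)); first by apply: leq_sum => z _.
  rewrite sum_nat_const leq_mul2r; apply/orP; right.
  by rewrite -(cardC (mem s)) (card_uniqP Us) addKn.
have le_n z : \sum_w ed [:: x; y; z; w] <= n.
  rewrite -[n]muln1 -sum_nat_const; apply: leq_sum => w _; exact: leq_b1.
apply: leq_trans (le_out _ _ le_n) _; rewrite mul2n -addnn addnA leq_add2r.
apply: (@leq_trans (\sum_(z <- s) (\sum_(w <- s) ed [:: x; y; z; w] + (n - size s)))).
  by apply: leq_sum => z _; rewrite -[n - size s]muln1; apply: le_out => w; exact: leq_b1.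
rewrite big_split leq_add2l big_const_seq count_predT iter_addn_0 leq_mul2l.
by rewrite -(card_uniqP Us) max_card orbT.
Qed.

Lemma matching_words M : matching H M ->
  [/\ uniq (flatten [seq enum e | e : {set V} <- enum M]),
      flatten [seq enum e | e : {set V} <- enum M] =i cover M
    & {in [seq enum e | e : {set V} <- enum M], forall w, size w = 4 /\ [set x in w] \in M}].
Proof.
move=> mM; have memM : flatten [seq enum e | e : {set V} <- enum M] =i cover M.
  move=> x; apply/flattenP/bigcupP=> [[w /mapP[e + ->]]|[e eM xe]].
    by rewrite !mem_enum => eM; exists e.
  exists (enum e); rewrite ?mem_enum //; apply/mapP; exists e; rewrite ?mem_enum //.
have sz : {in [seq enum e | e : {set V} <- enum M], forall w, size w = 4 /\ [set x in w] \in M}.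
  move=> w /mapP[e + ->]; rewrite mem_enum => eM; rewrite set_enum eM -cardE.
  by case/andP: mM => /subsetP/(_ e eM)/(card_edge Hunif).
split=> //; apply/card_uniqP; rewrite (eq_card memM) (card_cover_matching Hunif) //.
rewrite size_flatten /shape -map_comp sumnE big_map (eq_big_seq (fun=> 4)) => [|e].
  by rewrite big_const_seq count_predT iter_addn_0 -cardE.
move=> eM /=; have [] // := sz (enum e); by apply/mapP; exists e.
Qed.
End CodegreeCounts.

Section AlmostPerfect.
Local Open Scope nat_scope.

Lemma slack_small n k : 10 * 10 * 10 * 10 <= n -> 4 * k <= n -> 500 * (n - 4 * k) <= n ->
  8 * (2 * ((n - 4 * k) * n) + 3 * n) + 72 * k <= k ^ 2.
Proof.
move=> n_big le_kn le_d; have p1 := leq_mul le_d (leqnn n).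
have le_n5 : n <= 5 * k by lia.
have p2 := leq_mul le_n5 le_n5; have p3 := leq_mul n_big (leqnn n).
by rewrite -mulnn; move: p1 p2 p3; move: (n - 4 * k) => d; lia.
Qed.

Lemma density_half n k c S d : n ^ 2 <= 2 * c + 6 * n -> c <= S + 2 * (d * n) -> 4 * k <= n ->
  8 * k ^ 2 <= S + (2 * (d * n) + 3 * n).
Proof. by move=> h1 h2 h3; have := leq_mul h3 h3; move: h1; rewrite -!mulnn; lia. Qed.

Lemma uniq_index_pairs T (ts : seq 'I_T) : uniq ts ->
  uniq (pair_letters [seq (2 * t, (2 * t).+1) | t : 'I_T <- ts]).
Proof.
rewrite (perm_uniq (perm_pair_letters _)) cat_uniq /unzip1 /unzip2 -!map_comp => Uts.
rewrite !map_inj_uniq ?Uts /=; last 2 first.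
- by move=> i j /= /eqP; rewrite eqSS eqn_mul2l /= => /eqP/val_inj.
- by move=> i j /= /eqP; rewrite eqn_mul2l /= => /eqP/val_inj.
by rewrite andbT; apply/hasPn => x /mapP[i _ ->]; apply/negP => /mapP[j _] /=; lia.
Qed.

(** A maximum matching is cut into blocks together with the uncovered vertices, four at a time,
    except for [T] pairs of uncovered vertices. The blocks then cover all but a small proportion of
    the vertices, so that the codegree of each pair is carried by the blocks, and [blocks_average]
    applies. *)
Lemma larger_matching_avoiding : exists q L n0 : nat, forall (V : finType) (H : {set {set V}}),
  uniform 4 H -> n0 <= #|V| ->
  large_codegrees H ->
  forall (W0 : {set V}) (M : {set {set V}}), #|W0| * L <= #|V| -> matching H M -> cover M \subset ~: W0 ->
    q <= #|~: (W0 :|: cover M)| ->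
  exists M', [/\ matching H M', cover M' \subset ~: W0 & #|M'| = #|M|.+1].
Proof.
have [K16 defK16] : exists K16, K16 = #|{ffun 'I_4 * 'I_4 -> bool}| by exists #|{ffun 'I_4 * 'I_4 -> bool}|.
have [T [T_gt0 leT ltT]] : exists T,
    [/\ 0 < T, 144 * K16 <= T & 12 * (K16 * (K16 * K16)) < T].
  by exists (144 * K16 + 12 * (K16 * (K16 * K16))).+1; split; lia.
exists (2 * T), (10 * 10 * 10), (10 * 10 * 10 * (2 * T + 13)).
move=> V H Hunif le_n0 deg W0 M leW0 mM MW0 le_q.
(* A strictly larger matching contains one with exactly one more edge. *)
suff [M' [mM' cM' ltM]] : exists M', [/\ matching H M', cover M' \subset ~: W0 & #|M| < #|M'|].
  have [s [sz_s Us sM]] := card_uniq_seq ltM.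
  have sM' : [set e in s] \subset M' by apply/subsetP=> e; rewrite inE => /sM.
  exists [set e in s]; split; first exact: matching_sub mM'.
    apply: subset_trans cM'; apply/bigcupsP => e es; apply: bigcup_sup.
    exact: (subsetP sM').
  by rewrite cardsE -sz_s; apply/card_uniqP.
apply: contrapT => no_bigger.
have max_M M' : matching H M' -> cover M' \subset ~: W0 -> #|M'| <= #|M|.
  by move=> mM' cM'; rewrite leqNgt; apply/negP => ltM; apply: no_bigger; exists M'.
set U := ~: (W0 :|: cover M) in le_q.
pose us := enum U; have sz_us : size us = #|U| by rewrite -cardE.
have Uus : uniq us by exact: enum_uniq.
have usP x : x \in us = (x \notin W0) && (x \notin cover M).
  by rewrite mem_enum !inE negb_or.
have [x0 _] : exists x0, x0 \in us.
  by case def_us: us sz_us => [|x0 s] sz; [exfalso; move: le_q; rewrite -sz /=; lia | exists x0; rewrite mem_head].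
pose a (t : 'I_T) := nth x0 us (2 * t); pose b (t : 'I_T) := nth x0 us (2 * t).+1.
have lt2 (t : 'I_T) : (2 * t).+1 < 2 * T by have := ltn_ord t; lia.
have [ws [r [def_rest ws4 lt_r]]] := chop4 (drop (2 * T) us).
have [UM memM wM] := matching_words Hunif mM.
set bM := [seq enum e | e : {set V} <- enum M] in UM memM wM.
pose bl := bM ++ ws.
have Uwsr : uniq (flatten ws ++ r) by rewrite -def_rest drop_uniq.
have wsP x : x \in flatten ws -> x \in drop (2 * T) us.
  by move=> xws; rewrite def_rest mem_cat xws.
have Ubl : uniq (flatten bl).
  rewrite flatten_cat cat_uniq UM; move: Uwsr; rewrite cat_uniq => /and3P[-> _ _].
  rewrite andbT /=; apply/hasPn=> x /wsP/mem_drop; rewrite usP => /andP[_].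
  by rewrite /= memM.
have bl4 w : w \in bl -> size w = 4.
  by rewrite mem_cat => /orP[/wM[]|/(allP ws4)/eqP].
have szF : size (flatten bl) = 4 * size bl.
  rewrite size_flatten /shape sumnE big_map (eq_big_seq (fun=> 4)) //.
  by rewrite big_const_seq count_predT iter_addn_0.
have pairs_drop (t : 'I_T) x : x \in [:: a t; b t] -> x \in us /\ x \notin drop (2 * T) us.
  move=> xab; have : x \in take (2 * T) us.
    have nt i : i < 2 * T -> nth x0 us i \in take (2 * T) us.
      by move=> lti; rewrite -(nth_take _ lti) mem_nth // size_take sz_us; case: ifP; clear -lti le_q; lia.
    have l2 := lt2 t; move: xab; rewrite !inE => /orP[] /eqP->; apply: nt; clear -l2; lia.
  move=> xt; split; first exact: mem_take xt.
  move: Uus; rewrite -{1}(cat_take_drop (2 * T) us) cat_uniq => /and3P[_ /hasPn nd _].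
  by apply/negP=> /nd; rewrite /= xt.
have n_split : #|V| <= 4 * size bl + (#|W0| + 2 * T + 3).
  have cMn : #|cover M| = size (flatten bM) by rewrite -(eq_card memM); apply/card_uniqP.
  have cU : #|V| <= #|W0| + #|cover M| + #|U|.
    rewrite -(cardsC (W0 :|: cover M)) leq_add2r; exact: leq_card_setU.
  have sz_drop : size us - 2 * T = size (flatten ws) + size r.
    by rewrite -size_drop def_rest size_cat.
  move: szF; rewrite flatten_cat size_cat -cMn => szF.
  rewrite sz_us in sz_drop; lia.
have szbl : 4 * size bl <= #|V|.
  by rewrite -szF -(card_uniqP Ubl) max_card.
have L1000 : 500 * (#|V| - 4 * size bl) <= #|V| by lia.
apply: (@blocks_average V H Hunif W0 M T a b bl x0 mM MW0 max_M _ bl4 Ubl _ _ _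
   (2 * ((#|V| - 4 * size bl) * #|V|) + 3 * #|V|)) => //.
- move=> ts Uts; have -> : pair_letters [seq (a t, b t) | t <- ts] =
      [seq nth x0 us i | i <- pair_letters [seq (2 * t, (2 * t).+1) | t : 'I_T <- ts]].
    by elim: ts {Uts} => //= t ts IH; rewrite /pair_letters /= -!/(pair_letters _) IH.
  rewrite map_inj_in_uniq ?uniq_index_pairs // => i j.
  have lt_us k : k \in pair_letters [seq (2 * t, (2 * t).+1) | t : 'I_T <- ts] -> k < size us.
    case/flattenP=> w /mapP[p /mapP[t _ ->] ->]; rewrite sz_us !inE /= => /orP[] /eqP->;
    by have := lt2 t; clear -le_q; lia.
  by move=> /lt_us lti /lt_us ltj /eqP; rewrite nth_uniq // => /eqP.
- move=> w; rewrite mem_cat => /orP[/wM[_]|wws]; first by left.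
  right=> x xw; have : x \in us by apply/mem_drop/wsP/flattenP; exists w.
  by rewrite usP => /andP[].
- move=> x; rewrite flatten_cat mem_cat memM => /orP[/(subsetP MW0)|/wsP/mem_drop].
    by rewrite inE.
  by rewrite usP => /andP[].
- move=> t x /pairs_drop[xus xd]; move: xus; rewrite usP => /andP[xW0 xM]; split=> //.
  by rewrite flatten_cat mem_cat memM negb_or xM; apply: contra xd => /wsP.
- by rewrite lt0n; apply/negP=> /eqP k0; move: L1000; rewrite k0; lia.
- by rewrite -defK16.
- by rewrite -defK16.
- by apply: slack_small => //; apply: leq_trans le_n0; rewrite leq_mul2l; clear; lia.
- move=> t; apply: (@density_half #|V| _ (codeg H (a t) (b t))) => //.
    apply: deg; rewrite nth_uniq //; have := lt2 t; rewrite ?sz_us; clear -le_q; lia.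
  by rewrite -szF; apply: codeg_restrict.
Qed.

(** Adding one edge at a time is possible as long as [q] vertices outside [W0] are uncovered. The
    set [W0] is reserved for absorption. *)
Lemma almost_perfect_matching : exists q L n0 : nat, forall (V : finType) (H : {set {set V}}),
  uniform 4 H -> n0 <= #|V| ->
  large_codegrees H ->
  forall (W0 : {set V}) j, #|W0| * L <= #|V| -> 4 * j + q <= #|~: W0| ->
  exists M, [/\ matching H M, cover M \subset ~: W0 & #|M| = j].
Proof.
have [q [L [n0 step]]] := larger_matching_avoiding.
exists q, L, n0 => V H Hunif le_n0 deg W0 j leW0.
elim: j => [|j IHj] le_j.
  exists set0; rewrite /matching sub0set /trivIset /cover !big_set0 cards0 sub0set.
  by split=> //; rewrite cards0.
have [|M [mM cM sM]] := IHj; first by apply: leq_trans le_j; lia.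
have [|M' [mM' cM' sM']] := step V H Hunif le_n0 deg W0 M leW0 mM cM; last first.
  by exists M'; rewrite sM' sM.
have := card_cover_matching Hunif mM; rewrite sM => cardM.
have : #|~: W0| <= #|~: (W0 :|: cover M)| + #|cover M|.
  rewrite -(cardsID (cover M) (~: W0)) addnC leq_add //.
    by apply: subset_leq_card; rewrite setDE setCU.
  exact/subset_leq_card/subsetIr.
by rewrite cardM; lia.
Qed.
End AlmostPerfect.

(** * Absorbing sets *)

Section Absorption.
Local Open Scope nat_scope.

Lemma bernoulli b i : b ^ i * (b + i) <= b * b.+1 ^ i.
Proof.
elim: i => [|i IHi]; first by rewrite !expn0 addn0 mul1n muln1.
have := leq_mul IHi (leqnn b.+1); rewrite !expnS.
move: (b ^ i) (b.+1 ^ i) => x y h; apply: (@leq_trans (x * (b + i) * b.+1)); last by lia.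
have -> : b * x * (b + i.+1) = x * (b * (b + i.+1)) by lia.
by rewrite -mulnA leq_mul2l; apply/orP; right; lia.
Qed.

(** By the inequality of Bernoulli, [i] rounds gain a factor [(b + i) / b] and hence [i * q.+1]
    rounds gain a polynomial of degree [q.+1], which exceeds [n ^ q] already when [i] is a small
    fraction of [n]. *)
Lemma exponential_decay b q c : 0 < b -> 0 < c -> exists n0, forall n, n0 <= n ->
  exists J, c * J <= n /\ b ^ J * n ^ q < b.+1 ^ J.
Proof.
move=> b_gt0 c_gt0; exists ((c * q.+1 * b) ^ q.+1).+1 => n lt_n.
pose C := c * q.+1; pose i := n %/ C.
have C_gt0 : 0 < C by rewrite muln_gt0 c_gt0.
exists (i * q.+1); split.
  by rewrite mulnC -mulnA (mulnC q.+1); exact: leq_trunc_div.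
have le_n : n <= C * (b + i).
  have := ltn_ceil n C_gt0; rewrite -/i; nia.
have h1 : n * n ^ q <= C ^ q.+1 * (b + i) ^ q.+1 by rewrite -expnS -expnMn leq_exp2r.
have h2 : b ^ (i * q.+1) * (b + i) ^ q.+1 <= b ^ q.+1 * b.+1 ^ (i * q.+1).
  by rewrite !expnM -!expnMn leq_exp2r // bernoulli.
have n_gt0 : 0 < n by case: n lt_n {le_n h1 i h2}.
have nq_gt0 : 0 < n ^ q by rewrite expn_gt0 n_gt0.
have h3 : (C * b) ^ q.+1 * n ^ q < n * n ^ q by rewrite ltn_pmul2r.
have h4 : b ^ q.+1 * n ^ q < (b + i) ^ q.+1.
  have Cq : 0 < C ^ q.+1 by rewrite expn_gt0 C_gt0.
  by rewrite -(ltn_pmul2l Cq) mulnA -expnMn; apply: leq_trans h3 h1.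
have bJ : 0 < b ^ (i * q.+1) by rewrite expn_gt0 b_gt0.
have bq : 0 < b ^ q.+1 by rewrite expn_gt0 b_gt0.
rewrite -(ltn_pmul2l bq); apply: leq_trans h2.
by rewrite mulnCA ltn_pmul2l.
Qed.

Section Greedy.
Variables (V : finType) (H : {set {set V}}) (q m K : nat).
Local Notation n := #|V|.
Hypothesis Hunif : uniform 4 H.
Hypothesis K_gt0 : 0 < K.
Hypothesis n_gt0 : 0 < n.
Definition absorbs (t Q : seq V) := splits H t /\ splits H (Q ++ t).
Hypothesis dense_absorbers : forall Q : seq V, size Q = q -> dense m K (absorbs^~ Q).

Definition unabsorbed (S : seq (seq V)) Q := ~ exists2 t, t \in S & absorbs t Q.
Definition disjoint_words S :=
  uniq (flatten S) /\ forall t, t \in S -> size t = m /\ splits H t.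

(** Only a small proportion of the words of length [m] meets the words chosen so far. Hence every
    word [Q] is still absorbed by a proportion [1 / (2 * K)] of the available words, and on average
    an available word absorbs this proportion of the words that are not yet absorbed. *)
Lemma greedy_absorber_step S : disjoint_words S ->
    2 * K * (m * (m + m * size S)) <= n -> 0 < wcount q (unabsorbed S) ->
  exists t, disjoint_words (t :: S) /\
    2 * K * wcount q (unabsorbed (t :: S)) + wcount q (unabsorbed S) <= 2 * K * wcount q (unabsorbed S).
Proof.
move=> [US wS] le_n r_gt0; pose X := [set x in flatten S].
have leX : #|X| <= m * size S.
  apply: leq_trans (_ : size (flatten S) <= _); first by rewrite cardsE card_size.
  rewrite size_flatten /shape sumnE big_map (eq_big_seq (fun=> m)) => [|t /wS[] //].
  by rewrite big_const_seq count_predT iter_addn_0.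
pose ok t := uniq t && ~~ has (mem X) t.
have bad : 2 * K * wcount m (fun s => ~~ ok s) <= n ^ m.
  have := wcount_not_fresh m X; rewrite -/ok => hb.
  rewrite -(leq_pmul2l n_gt0); apply: leq_trans (_ : 2 * K * (m * (m + #|X|) * n ^ m) <= _).
    by rewrite mulnCA leq_mul2l hb orbT.
  rewrite mulnA leq_mul2r; apply/orP; right; apply: leq_trans le_n.
  by rewrite leq_mul2l leq_mul2l leq_add2l leX !orbT.
have good Q : size Q = q -> n ^ m <= 2 * K * wcount m (fun t => absorbs t Q /\ ok t).
  move=> szQ; have := dense_absorbers szQ; rewrite /dense.
  have : wcount m (absorbs^~ Q) <= wcount m (fun t => absorbs t Q /\ ok t) + wcount m (fun s => ~~ ok s).
    apply: leq_trans (wcount_or _ _ _); apply: leq_wcount => t _ abt.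
    by case: (boolP (ok t)); [left | right].
  move=> h1 h2; have := leq_mul (leqnn K) h1.
  by move: h2 bad; rewrite mulnDr -!mulnA; lia.
pose rem Q : nat := `[< unabsorbed S Q >].
pose g t := wsum q (fun Q => rem Q * `[< absorbs t Q /\ ok t >]).
have sum_g : n ^ m * wcount q (unabsorbed S) <= 2 * K * wsum m g.
  have -> : wsum m g = wsum q (fun Q => wsum m (fun t => `[< absorbs t Q /\ ok t >]) * rem Q).
    transitivity (wsum m (fun t => wsum q (fun Q => `[< absorbs t Q /\ ok t >] * rem Q))).
      by apply: eq_wsum => t _; apply: eq_wsum => Q _; rewrite mulnC.
    by rewrite wsum_exchange; apply: eq_wsum => Q _; rewrite wsum_mulr.
  rewrite mulnC -wsum_mulr [X in _ <= X]mulnC -wsum_mulr; apply: leq_wsum => Q szQ.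
  have swap x y z : x * y * z = y * (z * x) by lia.
  by rewrite swap leq_mul2l good ?orbT.
have [t szt gt] : exists2 t, size t = m & wcount q (unabsorbed S) <= 2 * K * g t.
  apply: contrapT => no_t.
  have : wsum m (fun t => 2 * K * g t + 1) <= wsum m (fun _ : seq V => wcount q (unabsorbed S)).
    apply: leq_wsum => t szt; rewrite addn1 ltnNge; apply/negP=> le_t; apply: no_t; by exists t.
  rewrite wsum_add !wsum_const muln1.
  have -> : wsum m (fun t => 2 * K * g t) = 2 * K * wsum m g.
    by rewrite [RHS]mulnC -wsum_mulr; apply: eq_wsum => t _; rewrite mulnC.
  have : 0 < n ^ m by rewrite expn_gt0 n_gt0.
  by move: sum_g; lia.
have [Q0 _ ] : exists2 Q, size Q = q & 0 < rem Q * `[< absorbs t Q /\ ok t >].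
  by apply: wsum_gt0; rewrite -/(g t) lt0n; apply: contraL r_gt0 => /eqP g0; move: gt; rewrite g0 muln0; case: wcount.
rewrite muln_gt0 => /andP[_]; rewrite lt0b => /asboolP[[st _] /andP[Ut /hasPn tX]].
exists t; split.
  split=> [|u]; last by rewrite inE => /predU1P[-> //|/wS].
  rewrite /= cat_uniq Ut US andbT /=; apply/hasPn=> x xS; apply/negP=> /tX.
  by rewrite /= inE xS.
suff : wcount q (unabsorbed (t :: S)) + g t <= wcount q (unabsorbed S).
  move=> le_r; apply: leq_trans (leq_add (leqnn _) gt) _.
  by rewrite -mulnDr leq_mul2l le_r orbT.
rewrite -wsum_add; apply: leq_wsum => Q _; rewrite /rem.
case: (asboolP (unabsorbed (t :: S) Q)) => [un|_].
  rewrite (asboolF (_ : ~ (absorbs t Q /\ ok t))) ?muln0.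
    by rewrite asboolT // => -[u uS abu]; apply: un; exists u; rewrite // inE uS orbT.
  by move=> [abt _]; apply: un; exists t; rewrite ?mem_head.
by case: `[< unabsorbed S Q >]; rewrite ?mul0n // mul1n leq_b1.
Qed.

Lemma greedy_absorber j : 2 * K * (m * (m + m * j)) <= n ->
  exists S, [/\ disjoint_words S, size S <= j &
    wcount q (unabsorbed S) * (2 * K) ^ j <= (2 * K).-1 ^ j * n ^ q].
Proof.
elim: j => [|j IHj] le_n.
  exists [::]; split=> //.
  by rewrite !expn0 muln1 mul1n wcount_max.
have [|S [dS szS leS]] := IHj.
  apply: leq_trans le_n; rewrite !leq_mul2l leq_add2l leq_mul2l leqnSn; lia.
have [r0|r_gt0] := posnP (wcount q (unabsorbed S)).
  by exists S; split; rewrite ?r0 // ltnW.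
have [|t [dt let_]] := greedy_absorber_step dS _ r_gt0.
  apply: leq_trans le_n; rewrite !leq_mul2l leq_add2l leq_mul2l (leqW szS); lia.
exists (t :: S); split=> //.
move: let_ leS; set r' := wcount q (unabsorbed (t :: S)); set r := wcount q (unabsorbed S).
have [k ->] : exists k, 2 * K = k.+1 by exists (2 * K).-1; rewrite prednK // muln_gt0.
rewrite /= !expnS => h1 h2; have h3 : k.+1 * r' <= k * r by lia.
apply: (@leq_trans (k * r * k.+1 ^ j)).
  by rewrite mulnA (mulnC r') leq_mul2r h3 orbT.
by rewrite -!mulnA leq_mul2l h2 orbT.
Qed.

Lemma splits_flatten S : (forall t, t \in S -> splits H t) -> splits H (flatten S).
Proof.
elim: S => [|t S IHS] wS /=; first exact: splits_nil.
by apply: splits_cat; [apply: wS; exact: mem_head | apply: IHS => u uS; apply: wS; rewrite inE uS orbT].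
Qed.

(** One word of [S] absorbs [Q], and all the others split on their own. *)
Lemma absorb_word S Q : disjoint_words S -> ~ unabsorbed S Q -> splits H (Q ++ flatten S).
Proof.
move=> [US wS] /contrapT[t tS [_ stQ]].
apply: (@splits_perm _ _ ((Q ++ t) ++ flatten (rem t S))).
  by rewrite -catA perm_cat2l perm_sym -[t ++ _]/(flatten (t :: rem t S)) perm_flatten ?perm_to_rem.
by apply: splits_cat => //; apply: splits_flatten => u /mem_rem /wS[].
Qed.
End Greedy.

(** After [J] rounds, with [J] a small fraction of [n], the greedy choice leaves fewer than one
    unabsorbed word. The factor [D] makes the absorbing set as small as desired relative to [n]. *)
Lemma absorbing_set q m K D : exists n0, forall (V : finType) (H : {set {set V}}),
    uniform 4 H -> n0 <= #|V| ->
    (forall Q : seq V, size Q = q -> dense m K (fun t => absorbs H t Q)) ->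
  exists W : {set V}, [/\ #|W| * D <= #|V|, 4 %| #|W| &
    forall Q : {set V}, #|Q| = q -> [disjoint Q & W] ->
      exists2 M, matching H M & cover M = Q :|: W].
Proof.
wlog K_gt0 : K / 0 < K => [wlogK|].
  have [n0 h] := wlogK K.+1 isT; exists n0 => V H Hu le_n0 dQ; apply: h => // Q szQ.
  by apply: dense_leq (dQ Q szQ).
have [||n1 decay] := @exponential_decay (2 * K).-1 q (D * m + 4 * K * m * m + 1); try lia.
exists (n1 + 4 * K * m * m + 1) => V H Hunif le_n dQ.
have [J [leJ ltJ]] : exists J, (D * m + 4 * K * m * m + 1) * J <= #|V| /\
    (2 * K).-1 ^ J * #|V| ^ q < (2 * K).-1.+1 ^ J by apply: decay; lia.
have n_gt0 : 0 < #|V| by lia.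
have [|S [[US wS] szS leS]] := greedy_absorber (j := J) Hunif K_gt0 n_gt0 dQ.
  lia.
have r0 : wcount q (unabsorbed H S) = 0.
  apply/eqP; rewrite -leqn0 leqNgt; apply/negP=> r_gt0.
  move: leS; rewrite leqNgt => /negP; apply; move: ltJ.
  rewrite prednK ?muln_gt0 //; move/leq_trans; apply.
  by rewrite -[X in X <= _]mul1n leq_mul2r r_gt0 orbT.
have sF : splits H (flatten S) by apply: splits_flatten => t /wS[].
exists [set x in flatten S]; split.
- have : size (flatten S) <= m * J.
    rewrite size_flatten /shape sumnE big_map (eq_big_seq (fun=> m)) => [|t /wS[] //].
    by rewrite big_const_seq count_predT iter_addn_0 leq_mul2l szS orbT.
  have : #|[set x in flatten S]| <= size (flatten S) by rewrite cardsE card_size.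
  move: leJ => /=; nia.
- have [M mM <-] := splits_matching Hunif sF US.
  by rewrite (card_cover_matching Hunif mM) dvdn_mulr.
move=> Q szQ dQW; have US' : uniq (enum Q ++ flatten S).
  rewrite cat_uniq enum_uniq US andbT /=; apply/hasPn => x xS; rewrite mem_enum.
  by rewrite disjoint_sym in dQW; rewrite (disjointFr dQW) // inE.
have [|M mM cM] := splits_matching Hunif _ US'.
  apply: (absorb_word (m := m)) => //.
  move=> un; have := leq_wsum_word (fun Q => `[< unabsorbed H S Q >]) (enum Q).
  by rewrite -cardE szQ -/(wcount q _) r0 asboolT.
exists M => //; rewrite cM; apply/setP=> x.
by rewrite !inE mem_cat mem_enum.
Qed.
End Absorption.

(** * Almost constant symmetric relations *)

Section Resampling.
Local Open Scope nat_scope.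
Variables (V : finType) (f : V -> V -> V -> bool).
Local Notation n := #|V|.
Hypothesis f12 : forall x y z, f x y z = f y x z.
Hypothesis f23 : forall x y z, f x y z = f x z y.

Definition weight : nat := \sum_x \sum_y \sum_z f x y z.
(** Pairs of members that differ in one coordinate only. *)
Definition twin_weight : nat := \sum_x \sum_y \sum_z \sum_w f x z w * f y z w.

Lemma sum_constV c : \sum_(x : V) c = n * c.
Proof. by rewrite sum_nat_const. Qed.

(** Changing the coordinates one at a time leads from [p = f x y z] through [q = f x' y z] and [r =
    f x' y' z] to an independent [t = f x' y' z']. For bits, [p * q + q * r + r * t <= q + r + p *
    t]; the lemma is the sum of this inequality. Thus if [f] rarely changes with one coordinate, its
    density is close to [0] or [1]. *)
Lemma resampling : 3 * (n ^ 2 * twin_weight) <= 2 * (n ^ 3 * weight) + weight ^ 2.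
Proof.
pose S6 (F : V -> V -> V -> V -> V -> V -> nat) :=
  \sum_x \sum_y \sum_z \sum_x' \sum_y' \sum_z' F x y z x' y' z'.
pose S4 (F : V -> V -> V -> V -> nat) := \sum_x \sum_y \sum_z \sum_w F x y z w.
have S6D F G : S6 (fun x y z x' y' z' => F x y z x' y' z' + G x y z x' y' z') = S6 F + S6 G.
  rewrite /S6; do 6!(rewrite -big_split; apply: eq_bigr => ? _).
  by [].
have le6 : S6 (fun x y z x' y' z' => f x y z * f x' y z + f x' y z * f x' y' z + f x' y' z * f x' y' z')
   <= S6 (fun x y z x' y' z' => f x' y z + f x' y' z + f x y z * f x' y' z').
  rewrite /S6; do 6!(apply: leq_sum => ? _).
  by do 4!case: (f _ _ _).
rewrite !S6D in le6.
have pull4 c F : S4 (fun x y z w => c * F x y z w) = c * S4 F.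
  by rewrite /S4; do 4!(rewrite big_distrr; apply: eq_bigr => ? _).
have pull3 c (F : V -> V -> V -> nat) :
    \sum_x \sum_y \sum_z c * F x y z = c * \sum_x \sum_y \sum_z F x y z.
  by do 3!(rewrite big_distrr; apply: eq_bigr => ? _).
have s23 F : S4 F = S4 (fun x y z w => F x z y w).
  by rewrite /S4; apply: eq_bigr => x _; rewrite exchange_big.
have s34 F : S4 F = S4 (fun x y z w => F x y w z).
  by rewrite /S4; do 2!(apply: eq_bigr => ? _); rewrite exchange_big.
have tw2 : n ^ 2 * twin_weight = n * S4 (fun x y z w => n * (f x z w * f y z w)).
  by rewrite pull4 -mulnn mulnA.
have e1 : S6 (fun x y z x' y' z' => f x y z * f x' y z) = n ^ 2 * twin_weight.
  rewrite tw2 -pull4 s23 s34 /S4 /S6; do 4!(apply: eq_bigr => ? _).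
  by rewrite !sum_constV.
have e2 : S6 (fun x y z x' y' z' => f x' y z * f x' y' z) = n ^ 2 * twin_weight.
  rewrite tw2 /S6 sum_constV; congr (_ * _).
  transitivity (S4 (fun y z x' y' => n * (f x' y z * f x' y' z))).
    by do 4!(apply: eq_bigr => ? _); rewrite sum_constV.
  rewrite s34 s23 s34 /S4; apply: eq_bigr => x _; apply: eq_bigr => y _.
  by apply: eq_bigr => z _; apply: eq_bigr => w _; rewrite !(f12 z).
have e3 : S6 (fun x y z x' y' z' => f x' y' z * f x' y' z') = n ^ 2 * twin_weight.
  rewrite tw2 pull4 /S6 !sum_constV; congr (_ * (_ * _)).
  rewrite -/(S4 _) s34 s23 /S4; apply: eq_bigr => x _; apply: eq_bigr => y _.
  by apply: eq_bigr => z _; apply: eq_bigr => w _; rewrite !(f23 z w) !(f12 z).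
have e4 : S6 (fun x y z x' y' z' => f x' y z) = n ^ 3 * weight.
  have -> : n ^ 3 * weight = n * \sum_x \sum_y \sum_z n * (n * f x y z).
    by rewrite !pull3 !expnS expn0 muln1 -!mulnA.
  rewrite /S6 sum_constV; congr (_ * _).
  under eq_bigr do rewrite exchange_big.
  rewrite exchange_big; do 3!(apply: eq_bigr => ? _).
  by rewrite !sum_constV.
have e5 : S6 (fun x y z x' y' z' => f x' y' z) = n ^ 3 * weight.
  have -> : n ^ 3 * weight = n * (n * \sum_x \sum_y \sum_z n * f x y z).
    by rewrite !pull3 !expnS expn0 muln1 -!mulnA.
  rewrite /S6 !sum_constV; congr (_ * (_ * _)).
  rewrite exchange_big; apply: eq_bigr => x _; rewrite exchange_big; apply: eq_bigr => y _.
  by apply: eq_bigr => z _; rewrite sum_constV.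
have e6 : S6 (fun x y z x' y' z' => f x y z * f x' y' z') = weight ^ 2.
  rewrite /S6 -mulnn /weight; do 3!(rewrite big_distrl; apply: eq_bigr => ? _).
  by do 3!(rewrite big_distrr; apply: eq_bigr => ? _).
by rewrite e1 e2 e3 e4 e5 e6 in le6; lia.
Qed.
End Resampling.

(** * Linked vertices *)

Section LinkGraph.
Local Open Scope nat_scope.
Variables (V : finType) (H : {set {set V}}).
Local Notation n := #|V|.
Local Notation ed := (edge_word H).
Hypothesis deg : large_codegrees H.

Definition link_size x : nat := wcount 3 (fun s => ed (x :: s)).
Definition edge_total : nat := \sum_x \sum_y codeg H x y.

Lemma link_sizeE x : link_size x = \sum_y codeg H x y.
Proof. by rewrite /link_size /wcount; do 3!(apply: eq_bigr => ? _); rewrite /= asboolb. Qed.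

Lemma link_size_lb x : n ^ 3 <= 2 * link_size x + 7 * n ^ 2.
Proof.
rewrite link_sizeE.
have : \sum_(y | y != x) n ^ 2 <= \sum_(y | y != x) (2 * codeg H x y + 6 * n).
  by apply: leq_sum => y nyx; apply: deg; rewrite eq_sym.
rewrite big_split /= -[\sum_(y | _) 2 * _]big_distrr /= !sum_nat_const.
have -> : #|[pred i | i != x]| = n.-1.
  by have := cardC1 x => <-; apply: eq_card => y; rewrite !inE.
have : \sum_(y | y != x) codeg H x y <= \sum_y codeg H x y by rewrite [X in _ <= X](bigD1 x) //= leq_addl.
have : 0 < n by apply/card_gt0P; exists x.
rewrite !expnS expn0 !muln1; move: (\sum_(y | _) _) (\sum_y _) => u v.
case: n => // k _ /=;  nia.
Qed.

Lemma edge_total_lb : n ^ 4 <= 2 * edge_total + 7 * n ^ 3.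
Proof.
have : \sum_(x : V) n ^ 3 <= \sum_x (2 * link_size x + 7 * n ^ 2).
  by apply: leq_sum => x _; exact: link_size_lb.
rewrite big_split /= !sum_constV.
have -> : \sum_x 2 * link_size x = 2 * edge_total.
  by rewrite -big_distrr; congr (_ * _); apply: eq_bigr => x _; rewrite link_sizeE.
by rewrite !expnS expn0; move: edge_total (#|V|) => E N; lia.
Qed.

Lemma wcount4_edges : wcount 4 (fun s => ed s) = edge_total.
Proof. by rewrite /wcount /edge_total; do 4!(apply: eq_bigr => ? _); rewrite asboolb. Qed.

Lemma dense_edges : 14 <= n -> dense 4 4 (fun s => ed s).
Proof.
move=> n_big; rewrite /dense wcount4_edges; have := edge_total_lb.
rewrite [n ^ 4]expnS; have := leq_mul n_big (leqnn (n ^ 3)).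
by move: (n * n ^ 3) (n ^ 3) edge_total => w u v; lia.
Qed.

(** Being linked is a sufficient condition for exchangeability that can be read off from the links
    alone. *)
Definition linked x y : Prop := dense 3 80 (fun s => ed (x :: s) /\ ed (y :: s)).

Lemma linked_sym x y : linked x y -> linked y x.
Proof. by apply: dense_sub => s _ []. Qed.

(** The links of three vertices have total density almost [3 / 2], so they cannot be pairwise almost
    disjoint. *)
Lemma linked_of3 x y z : 42 <= n -> [\/ linked x y, linked y z | linked x z].
Proof.
move=> n_big; pose c u v := wcount 3 (fun s => ed (u :: s) /\ ed (v :: s)).
have : link_size x + link_size y + link_size z <= n ^ 3 + (c x y + c y z + c x z).
  rewrite -[n ^ 3]muln1 -wsum_const /link_size /c /wcount -!wsum_add; apply: leq_wsum => s _.
  by rewrite !asboolb !asbool_and !asboolb; do 3!case: (ed _).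
have := link_size_lb x; have := link_size_lb y; have := link_size_lb z.
have [?|] := leqP (n ^ 3) (80 * c x y); first by constructor 1.
have [?|] := leqP (n ^ 3) (80 * c y z); first by constructor 2.
have [?|] := leqP (n ^ 3) (80 * c x z); first by constructor 3.
move: (c x y) (c y z) (c x z) => c1 c2 c3.
rewrite [n ^ 3]expnS; have := leq_mul n_big (leqnn (n ^ 2)).
move: (link_size _) (link_size _) (link_size _) (n * n ^ 2) (n ^ 2) => l1 l2 l3 w u.
lia.
Qed.

(** Up to powers of [N], the numbers are the density [P] of one link, its twin density [Q], the edge
    density [E] and the overlap [T] of the links. The claim is that [T] is bounded below. If [P]
    exceeds [3 / 4], this follows from the last hypothesis, as [E] is almost [1 / 2]. Otherwise, the
    resampling bound says that [P - Q] is at least [P * (1 - P) / 3], and the first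
    inclusion-exclusion bound turns this gap into a lower bound on [T]. *)
Lemma degree_numerics N P Q T E : 600 <= N ->
    N ^ 3 <= 2 * P + 7 * N ^ 2 -> P <= N ^ 3 -> N ^ 4 <= 2 * E + 7 * N ^ 3 ->
    2 * (N * P) + E <= N ^ 4 + Q + 2 * T ->
    3 * (N ^ 2 * Q) <= 2 * (N ^ 3 * P) + P ^ 2 ->
    N * P + E <= N ^ 4 + T ->
  N ^ 4 <= 40 * T.
Proof.
move=> N_big hP leP hE h1 h2 h3.
have [P_small|P_big] := leqP (4 * P) (3 * N ^ 3); last first.
  have := leq_mul (leqnn N) (ltnW P_big); have := leq_mul N_big (leqnn (N ^ 3)).
  rewrite (mulnCA N 3) (mulnCA N 4) -expnS => hN hP'; clear -h3 hE hN hP'.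
  by move: h3 hE hN hP'; move: (N * P) (N ^ 4) (N ^ 3) => A B C; lia.
have h5 : N * P <= Q + (7 * N ^ 3 + 2 * T).
  have hP' : N ^ 4 <= 2 * (N * P) + 7 * N ^ 3.
    by have := leq_mul (leqnn N) hP; rewrite mulnDr -expnS (mulnCA N 2) (mulnCA N 7) -expnS.
  clear -h1 hE hP'; move: h1 hE hP'; move: (N * P) (N ^ 4) (N ^ 3) => A B C; lia.
have h4 : N ^ 3 * P <= P ^ 2 + 3 * (N ^ 2 * (7 * N ^ 3 + 2 * T)).
  have := leq_mul (leqnn (N ^ 2)) h5; rewrite mulnA -expnSr mulnDr.
  clear -h2; move: h2; move: (N ^ 3 * P) (N ^ 2 * Q) (N ^ 2 * _) (P ^ 2) => A B C D; lia.
have h6 : N ^ 3 <= 4 * P.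
  have := leq_mul N_big (leqnn (N ^ 2)); rewrite -expnS => hN.
  clear -hP hN; move: hP hN; move: (N ^ 3) (N ^ 2) => u v; lia.
have h7 : 3 * (N ^ 3 * N ^ 3) + 16 * (P * P) <= 16 * (N ^ 3 * P).
  clear -P_small h6; move: P_small h6; move: (N ^ 3) => C ? ?; nia.
have h8 : 3 * (N ^ 2 * N ^ 4) <= 48 * (N ^ 2 * (7 * N ^ 3 + 2 * T)).
  rewrite -mulnn in h4; rewrite -expnD; rewrite -expnD in h7; clear -h4 h7.
  move: h4 h7; move: (N ^ (3 + 3)) (P * P) (N ^ 3 * P) (N ^ 2 * _) => A B C D; lia.
have N2 : 0 < N ^ 2 by rewrite expn_gt0 (leq_trans _ N_big).
have h9 : 3 * N ^ 4 <= 48 * (7 * N ^ 3 + 2 * T).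
  by move: h8; rewrite mulnCA (mulnCA 48) leq_pmul2l.
have := leq_mul N_big (leqnn (N ^ 3)); rewrite -expnS => hN.
clear -h9 hN; move: h9 hN; move: (N ^ 3) (N ^ 4) => u v; lia.
Qed.

(** If [v] were linked to few vertices, the link of almost every [x] would be essentially the
    complement of the link [f] of [v]. Then [f y z w] and [f x z w] would both be opposite to the
    edge [x y z w] for almost all quadruples, so [f] would rarely change with one coordinate. By
    resampling its density would be close to [0] or [1]. It is at least almost [1 / 2], and a
    density above [3 / 4] makes the link overlap with the edges directly. *)
Lemma linked_degree v : 600 <= n -> n <= 80 * #|[set y | `[< linked v y >]]|.
Proof.
move=> n_big; pose f x z w := ed [:: v; x; z; w]; pose E x y z w := ed [:: x; y; z; w].
have f12 x y z : f x y z = f y x z.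
  by apply: edge_word_perm; rewrite /= perm_cons (perm_catCA [:: x] [:: y] [:: z]).
have f23 x y z : f x y z = f x z y.
  by apply: edge_word_perm; rewrite /= !perm_cons (perm_catC [:: y] [:: z]).
pose S4 (F : V -> V -> V -> V -> nat) := \sum_x \sum_y \sum_z \sum_w F x y z w.
have S4D F G : S4 (fun x y z w => F x y z w + G x y z w) = S4 F + S4 G.
  rewrite /S4; do 4!(rewrite -big_split; apply: eq_bigr => ? _).
  by [].
have S4c c : S4 (fun _ _ _ _ => c) = n ^ 4 * c.
  by rewrite /S4 !sum_constV !expnS expn0; lia.
have le4 F G : (forall x y z w, F x y z w <= G x y z w) -> S4 F <= S4 G.
  by move=> leFG; do 4!(apply: leq_sum => ? _).
pose T := S4 (fun x y z w => f y z w * E x y z w).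
pose P := weight f; pose Q := twin_weight f.
have P_link : P = link_size v by rewrite link_sizeE.
have e1 : S4 (fun x y z w => f y z w) = n * P by rewrite /S4 sum_constV.
have e2 : S4 (fun x y z w => f x z w) = n * P.
  by rewrite -e1 /S4 exchange_big.
have e3 : S4 (fun x y z w => f x z w * E x y z w) = T.
  rewrite /T /S4 exchange_big; do 4!(apply: eq_bigr => ? _); congr (_ * _).
  by congr nat_of_bool; apply: edge_word_perm; rewrite (perm_catCA [:: _] [:: _] [:: _; _]).
have e4 : S4 (fun x y z w => f x z w * f y z w) = Q by [].
have e5 : S4 (fun x y z w => E x y z w) = edge_total by [].
have leT : n ^ 4 <= 40 * T.
  apply: (@degree_numerics n P Q T edge_total) => //.
  - by rewrite P_link link_size_lb.
  - by rewrite P_link; apply: wcount_max.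
  - exact: edge_total_lb.
  - have : S4 (fun x y z w => f x z w + f y z w + E x y z w) <=
       S4 (fun x y z w => 1 + f x z w * f y z w + f x z w * E x y z w + f y z w * E x y z w).
      apply: le4 => x y z w; by case: (f x z w); case: (f y z w); case: (E _ _ _ _).
    rewrite !S4D e1 e2 e3 S4c e4 e5 -/T muln1; clear.
    by move: (n * P) (n ^ 4) edge_total Q T => A B C D F; lia.
  - exact: resampling.
  - have : S4 (fun x y z w => f y z w + E x y z w) <=
       S4 (fun x y z w => 1 + f y z w * E x y z w).
      by apply: le4 => x y z w; case: (f y z w); case: (E _ _ _ _).
    by rewrite !S4D e1 e5 S4c muln1.
have sumT : T = \sum_y wcount 3 (fun s => ed (v :: s) /\ ed (y :: s)).
  rewrite /T; do 4!(apply: eq_bigr => ? _); rewrite asbool_and !asboolb /f /E /=.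
  by do 2!case: (ed _).
set D := [set y | _].
have : 80 * T <= \sum_y (80 * n ^ 3 * (y \in D) + n ^ 3).
  rewrite sumT big_distrr; apply: leq_sum => y _; rewrite inE.
  case: asboolP => [_|nl]; first by apply: leq_trans (leq_addr _ _); rewrite muln1 leq_mul2l wcount_max.
  by rewrite muln0 add0n ltnW // ltnNge; apply/negP.
rewrite big_split -big_distrr /= sum_mem sum_constV.
move=> leT80; have u_gt0 : 0 < n ^ 3 by rewrite expn_gt0 (leq_trans _ n_big).
rewrite -(leq_pmul2l u_gt0); move: leT leT80; rewrite [n ^ 4]expnS; clear.
by move: (n ^ 3) (#|V|) (#|D|) T => u N d t; lia.
Qed.
End LinkGraph.

(** * Exchangeable vertices and absorbers *)

Section Reachability.
Local Open Scope nat_scope.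
Variables (V : finType) (H : {set {set V}}).
Local Notation n := #|V|.
Local Notation ed := (edge_word H).
Implicit Types s t : seq V.

(** The basic relation of the absorption method: a set that can be matched with [x] can release [x]
    and take [y] instead. *)
Definition exchanges x y s := splits H (x :: s) /\ splits H (y :: s).
Definition reachable m K x y : Prop := dense m K (exchanges x y).
Definition closed m K : Prop := forall x y, reachable m K x y.

Lemma exchanges_sym x y s : exchanges x y s -> exchanges y x s.
Proof. by case. Qed.

Lemma reachable_sym m K x y : reachable m K x y -> reachable m K y x.
Proof. by apply: dense_sub => s _; apply: exchanges_sym. Qed.

Lemma reachable_leq m K K' x y : K <= K' -> reachable m K x y -> reachable m K' x y.
Proof. exact: dense_leq. Qed.

(** The intermediate vertex [y] is matched with [t] or with [s], according to which of [x] and [z]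
    is present. *)
Lemma exchanges_comp x y z s t : exchanges x y s -> exchanges y z t ->
  exchanges x z (y :: s ++ t).
Proof.
move=> [xs ys] [yt zt]; split.
  apply: (splits_perm (s := (x :: s) ++ (y :: t))); last exact: splits_cat.
  by rewrite /= perm_cons -[y :: t]cat1s perm_catCA.
apply: (splits_perm (s := (z :: t) ++ (y :: s))); last exact: splits_cat.
by rewrite /= perm_cons -[y :: s]cat1s perm_catCA /= perm_cons perm_catC.
Qed.

(** The letter [y] of the composed exchange ranges over [Y]. *)
Lemma reachable_comp m1 m2 Kc K1 K2 x z (Y : {set V}) : n <= Kc * #|Y| ->
    (forall y, y \in Y -> reachable m1 K1 x y /\ reachable m2 K2 y z) ->
  reachable (1 + (m1 + m2)) (Kc * (K1 * K2)) x z.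
Proof.
move=> leY rY; apply: (@dense_cat _ _ _ _ _ (fun s => exists2 y, s = [:: y] & y \in Y)).
  rewrite /dense expn1; apply: leq_trans leY _; rewrite leq_mul2l -sum_mem; apply/orP; right.
  apply: leq_sum => y _; case: (boolP (y \in Y)) => // yY.
  by rewrite /= asboolT //; exists y.
move=> _ _ [y -> yY]; have [r1 r2] := rY y yY.
apply: (dense_cat r1) => s _ ex_s; apply: dense_sub r2 => t _ ex_t.
exact: exchanges_comp ex_s ex_t.
Qed.

(** An arbitrary edge can be added to an exchanging word. This adjusts lengths, so that all pairs of
    vertices are exchanged by words of one common length. *)
Lemma reachable_pad m K x y : dense 4 4 (fun s => ed s) ->
  reachable m K x y -> reachable (m + 4) (K * 4) x y.
Proof.
move=> d4 r; apply: (dense_cat r) => s _ [xs ys]; apply: dense_sub d4 => t _ /splits_edge st.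
by split; rewrite -cat_cons; apply: splits_cat.
Qed.

Lemma reachable_pads m K k x y : dense 4 4 (fun s => ed s) ->
  reachable m K x y -> reachable (m + 4 * k) (K * 4 ^ k) x y.
Proof.
move=> d4 r; elim: k => [|k IHk]; first by rewrite muln0 addn0 muln1.
rewrite (_ : m + 4 * k.+1 = m + 4 * k + 4) ?expnSr ?mulnA; last by lia.
exact: reachable_pad.
Qed.

(** A word of four letters is absorbed by an arbitrary edge together with exchanges between its
    letters and the vertices of the edge: on its own, the exchanging words take the vertices of the
    edge, and in presence of the four letters they take these and release the edge. *)
Lemma dense_absorbers m K r : dense 4 4 (fun s => ed s) -> closed m K ->
  forall Q : seq V, size Q = 4 * r ->
  dense (r * (4 + (m + (m + (m + m))))) ((4 * (K * (K * (K * K)))) ^ r) (fun t => absorbs H t Q).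
Proof.
move=> d4 cl; elim: r => [|r IHr] Q.
  rewrite muln0 => /size0nil -> /=; rewrite /dense /wcount /=.
  by rewrite mul0n /= asboolT // /absorbs; split; exact: splits_nil.
rewrite mulnS (mulSn r) expnS; case: Q => [|x1 [|x2 [|x3 [|x4 Q]]]] // [szQ].
apply: (@dense_cat _ _ _ _ _ (fun s => absorbs H s [:: x1; x2; x3; x4])); last first.
  move=> s _ [ss sQs]; apply: dense_sub (IHr Q szQ) => t _ [st sQt].
  split; first exact: splits_cat.
  apply: (splits_perm (s := ([:: x1; x2; x3; x4] ++ s) ++ (Q ++ t))); last exact: splits_cat.
  by rewrite -catA -[X in perm_eq _ X]/([:: x1; x2; x3; x4] ++ Q ++ s ++ t) perm_cat2l perm_catCA.
apply: (dense_cat d4) => e sz_e ed_e.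
case: e sz_e ed_e => [|y1 [|y2 [|y3 [|y4 [|? ?]]]]] // _ ed_e.
apply: (dense_cat (cl x1 y1)) => s1 _ [xs1 ys1]; apply: (dense_cat (cl x2 y2)) => s2 _ [xs2 ys2].
apply: (dense_cat (cl x3 y3)) => s3 _ [xs3 ys3]; apply: dense_sub (cl x4 y4) => s4 _ [xs4 ys4].
have regroup z1 z2 z3 z4 : splits H (z1 :: s1) -> splits H (z2 :: s2) -> splits H (z3 :: s3) ->
    splits H (z4 :: s4) -> splits H ([:: z1; z2; z3; z4] ++ s1 ++ s2 ++ s3 ++ s4).
  move=> h1 h2 h3 h4.
  apply: (splits_perm (s := (z1 :: s1) ++ (z2 :: s2) ++ (z3 :: s3) ++ (z4 :: s4))); last first.
    by do 3!(apply: splits_cat => //).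
  rewrite /= perm_cons -[z2 :: s2 ++ _]cat1s perm_catCA /= perm_cons catA.
  rewrite -[z3 :: s3 ++ _]cat1s perm_catCA /= perm_cons -!catA catA catA -[z4 :: s4]cat1s perm_catCA.
  by rewrite /= -!catA.
split; first exact: regroup.
apply: (splits_perm (s := [:: y1; y2; y3; y4] ++ ([:: x1; x2; x3; x4] ++ s1 ++ s2 ++ s3 ++ s4))).
  by rewrite perm_catCA.
apply: splits_cat; last exact: regroup.
exact: splits_edge.
Qed.
End Reachability.

(** * Exchange through the whole vertex set, or two cliques *)

Section Transfer.
Local Open Scope nat_scope.
Variables (V : finType) (H : {set {set V}}).
Local Notation n := #|V|.
Local Notation ed := (edge_word H).
Implicit Types (s t : seq V) (A B : {set V}).

Lemma linked_reachable x y : linked H x y -> reachable H 3 80 x y.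
Proof. by apply: dense_sub => s _ [xs ys]; split; apply: splits_edge. Qed.

Lemma splits_cat4 s1 s2 s3 s4 t : splits H s1 -> splits H s2 -> splits H s3 -> splits H s4 -> splits H t ->
  splits H (s1 ++ s2 ++ s3 ++ s4 ++ t).
Proof. by move=> *; do 4!(apply: splits_cat => //). Qed.

(** Let the edges [q x y z] and [p x' y' z'] have linked last three vertices. Common triples of [x,
    x'], of [y, y'] and of [z, z'] then complete either of the two triples, whence [q] and [p] are
    exchangeable, and so are [a] linked to [p] and [b] linked to [q]. Five triples and the two edges
    have [23] letters. *)
Lemma transfer_gadget K a b :
    dense 8 K (fun s => exists q x y z p x' y' z', [/\ s = [:: q; x; y; z; p; x'; y'; z'],
      ed [:: q; x; y; z], ed [:: p; x'; y'; z'], linked H x x' &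
      [/\ linked H y y', linked H z z', linked H a p & linked H q b]]) ->
  reachable H 23 (K * (80 * (80 * (80 * (80 * 80))))) a b.
Proof.
move=> d8; apply: (dense_cat d8 (m2 := 15)).
move=> _ _ [q [x [y [z [p [x' [y' [z' [-> qe pe xx' [yy' zz' ap qb]]]]]]]]]].
apply: (dense_cat xx' (m2 := 12)) => s1 _ [xs1 x's1].
apply: (dense_cat yy' (m2 := 9)) => s2 _ [ys2 y's2].
apply: (dense_cat zz' (m2 := 6)) => s3 _ [zs3 z's3].
apply: (dense_cat ap) => sa _ [asa psa]; apply: dense_sub qb => sb _ [qsb bsb]; split.
  apply: (splits_perm (s := (a :: sa) ++ [:: p; x'; y'; z'] ++ (x :: s1) ++ (y :: s2) ++
    ((z :: s3) ++ (q :: sb)))).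
    apply/permP => P; rewrite /= !count_cat /= !count_cat /= !count_cat /= !count_cat /=; clear.
    by do 9![move: (nat_of_bool (P _)) => ?]; do 5![move: (count P _) => ?]; lia.
  by apply: splits_cat4; do ?apply: splits_cat; apply: splits_edge.
apply: (splits_perm (s := (b :: sb) ++ [:: q; x; y; z] ++ (x' :: s1) ++ (y' :: s2) ++
    ((z' :: s3) ++ (p :: sa)))).
  apply/permP => P; rewrite /= !count_cat /= !count_cat /= !count_cat /= !count_cat /=; clear.
  by do 9![move: (nat_of_bool (P _)) => ?]; do 5![move: (count P _) => ?]; lia.
by apply: splits_cat4; do ?apply: splits_cat; apply: splits_edge.
Qed.

Definition side A B (c : bool) : {set V} := if c then A else B.
Definition typed_edges A B (bs : seq bool) : nat :=
  wcount 4 (fun s => ed s && all2 (fun c x => x \in side A B c) bs s).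

Definition clique A := forall x y, x \in A -> y \in A -> linked H x y.

Lemma transfer L A B bs a b : clique A -> clique B -> size bs = 3 ->
    n ^ 4 <= L * typed_edges A B (false :: bs) -> n ^ 4 <= L * typed_edges A B (true :: bs) ->
    a \in A -> b \in B ->
  reachable H 23 (L * L * (80 * (80 * (80 * (80 * 80))))) a b.
Proof.
move=> cA cB sz_bs dB dA aA bB; apply: transfer_gadget; apply: (dense_cat dB (m2 := 4)).
case: bs sz_bs {dB} dA => [|b2 [|b3 [|b4 [|? ?]]]] //= _ dA [|q [|x [|y [|z [|? ?]]]]] // _.
rewrite /side /= andbT => /andP[qe /and4P[qB xs ys zs]].
apply: dense_sub dA => [[|p [|x' [|y' [|z' [|? ?]]]]]] // _.
rewrite /= andbT => /andP[pe /and4P[pA x's y's z's]].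
have cl (c : bool) u v : u \in (if c then A else B) -> v \in (if c then A else B) -> linked H u v.
  by case: c; [apply: cA | apply: cB].
exists q, x, y, z, p, x', y', z'; split=> //; first exact: (cl b2).
by split; [exact: (cl b3) | exact: (cl b4) | exact: cA | exact: cB].
Qed.
End Transfer.

Section Dichotomy.
Local Open Scope nat_scope.

(** Suppose that [x0] and [y0] are not linked and have few common neighbours; otherwise common
    neighbours exchange all pairs. By [linked_of3] every vertex is linked to [x0] or [y0], and the
    vertices not linked to a given vertex form a clique, so the private neighbourhoods [A] and [B]
    are cliques that cover almost everything. If two adjacent edge types are both dense, [transfer]
    exchanges [A] with [B], and every vertex has many neighbours in [A] or [B]. *)
Lemma closed_or_two_cliques g L : 160 <= g -> exists K n0 : nat, forall (V : finType) (H : {set {set V}}),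
    uniform 4 H -> n0 <= #|V| ->
    large_codegrees H ->
  closed H 31 K \/ exists A B : {set V},
    [/\ [disjoint A & B], #|~: (A :|: B)| * g < #|V|, #|V| <= 160 * #|A|, #|V| <= 160 * #|B|
      & forall b2 b3 b4, typed_edges H A B [:: false; b2; b3; b4] * L < #|V| ^ 4
                      \/ typed_edges H A B [:: true; b2; b3; b4] * L < #|V| ^ 4].
Proof.
move=> g_big; have [c5 def_c5] : exists c, c = 4 ^ 5 by eexists.
have [c6 def_c6] : exists c, c = 4 ^ 6 by eexists.
have [e5 def_e5] : exists e, e = 80 * (80 * (80 * (80 * 80))) by eexists.
pose K23 := 80 * c5 + L * L * e5; pose K31 := 160 * (160 * (80 * K23) * 80).
pose K7 := g * (80 * 80) + 80 * 4.
exists (K7 * c6 + K31), 600 => V H Hunif n_big deg.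
have d4 : dense 4 4 (fun s => edge_word H s) by apply: dense_edges => //; apply: leq_trans n_big.
have n42 : 42 <= #|V| by apply: leq_trans n_big.
pose N x := [set y | `[< linked H x y >]].
have NP x y : reflect (linked H x y) (y \in N x) by rewrite inE; apply: asboolP.
have reach3 x y : linked H x y -> reachable H 3 80 x y by apply: linked_reachable.
have [allG|] := pselect (forall x y, linked H x y \/ #|V| <= g * #|N x :&: N y|).
  (* Direct links give words of length 3 and common neighbours words of length 7; all are padded to
     length 31. *)
  left=> x y; apply: (reachable_leq (K := (K7 * c6))); first exact: leq_addr.
  rewrite def_c6; rewrite -[31]/(7 + 4 * 6); apply: reachable_pads => //.
  have [xy|com] := allG x y.
    apply: (reachable_leq (K := (80 * 4))); first exact: leq_addl.
    by rewrite -[7]/(3 + 4); apply: reachable_pad => //; apply: reach3.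
  apply: (reachable_leq (K := (g * (80 * 80)))); first exact: leq_addr.
  apply: (reachable_comp (m1 := 3) (m2 := 3) com) => z.
  by rewrite inE => /andP[/NP xz /NP /linked_sym zy]; split; apply: reach3.
move=> /existsNP[x0 /existsNP[y0 /not_orP[nxy /negP]]]; rewrite -ltnNge => comm.
pose A := N x0 :\: N y0; pose B := N y0 :\: N x0.
have xor z : z \in N x0 \/ z \in N y0.
  have [//|/linked_sym yz|xz] := linked_of3 deg x0 y0 z n42; first by right; apply/NP/linked_sym.
  by left; apply/NP.
have out z : z \in ~: (A :|: B) -> z \in N x0 :&: N y0.
  by rewrite in_setC in_setU !in_setD in_setI; case: (xor z) => ->; rewrite ?andbT ?negbK /=; case: (z \in _).
have leC : #|~: (A :|: B)| * g < #|V|.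
  apply: leq_ltn_trans comm; rewrite mulnC leq_mul2l; apply/orP; right.
  by apply/subset_leq_card/subsetP => z /out.
have cliq u v : clique H (N u :\: N v).
  move=> x y; rewrite !in_setD => /andP[/NP nvx _] /andP[/NP nvy _].
  by have [/linked_sym||] := linked_of3 deg x v y n42.
have cA : clique H A by apply: cliq.
have cB : clique H B by apply: cliq.
have degN x : #|V| <= 80 * #|N x| by apply: linked_degree.
have leCg : 160 * #|~: (A :|: B)| <= #|V|.
  by apply: leq_trans (ltnW leC); rewrite mulnC leq_mul2l g_big orbT.
have degAB x : #|V| <= 160 * #|N x :&: (A :|: B)|.
  have := degN x; rewrite -(cardsID (A :|: B) (N x)).
  have : #|N x :\: (A :|: B)| <= #|~: (A :|: B)|.
    by apply/subset_leq_card; rewrite setDE; exact: subsetIr.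
  move: leCg; clear; move: #|~: _| (#|V|) #|_ :\: _| #|_ :&: _| => c k d e; lia.
have leA u v : #|N u :&: N v| <= #|~: (A :|: B)| -> #|V| <= 160 * #|N u :\: N v|.
  move: leCg (degN u); rewrite -(cardsID (N v) (N u)); clear.
  by move: #|~: _| (#|V|) #|_ :\: _| #|_ :&: _| => c k d e; lia.
have CE : N x0 :&: N y0 \subset ~: (A :|: B).
  by apply/subsetP=> z; rewrite in_setI in_setC in_setU !in_setD => /andP[-> ->].
have [[b2 [b3 [b4 [dF dT]]]]|no_b] := pselect (exists b2 b3 b4,
     #|V| ^ 4 <= L * typed_edges H A B [:: false; b2; b3; b4] /\
     #|V| ^ 4 <= L * typed_edges H A B [:: true; b2; b3; b4]); last first.
  right; exists A, B; split=> //.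
  - by rewrite -setI_eq0; apply/eqP/setP=> z; rewrite !in_setI !in_setD in_set0;
      case: (z \in N x0); case: (z \in N y0).
  - by apply: leA; apply: subset_leq_card.
  - by apply: leA; rewrite setIC; apply: subset_leq_card.
  move=> b2 b3 b4; have [ltF|dF] := ltnP (typed_edges H A B [:: false; b2; b3; b4] * L) (#|V| ^ 4); first by left.
  right; rewrite ltnNge; apply/negP=> dT; apply: no_b; exists b2, b3, b4.
  by split; rewrite mulnC.
left.
have r23 a b : a \in A -> b \in B -> reachable H 23 K23 a b.
  move=> aA bB; apply: (reachable_leq (K := (L * L * e5))); first exact: leq_addl.
  by rewrite def_e5; apply: (transfer cA cB _ dF dT).
have r23c a b : linked H a b -> reachable H 23 K23 a b.
  move=> ab; apply: (reachable_leq (K := (80 * c5))); first exact: leq_addr.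
  by rewrite def_c5; rewrite -[23]/(3 + 4 * 5); apply: reachable_pads => //; apply: reach3.
have rAB a b : a \in A :|: B -> b \in A :|: B -> reachable H 23 K23 a b.
  case/setUP=> [aA|aB] /setUP[bA|bB].
  - exact/r23c/cA.
  - exact: r23.
  - by apply: reachable_sym; apply: r23.
  - exact/r23c/cB.
have r27 u b : b \in A :|: B -> reachable H 27 (160 * (80 * K23)) u b.
  move=> bAB; apply: (reachable_comp (m1 := 3) (m2 := 23) (degAB u)) => a.
  by rewrite in_setI => /andP[/NP ua aAB]; split; [apply: reach3 | apply: rAB].
move=> u v; apply: (reachable_leq (K := K31)); first exact: leq_addl.
apply: (reachable_comp (m1 := 27) (m2 := 3) (degAB v)) => b.
by rewrite in_setI => /andP[/NP /linked_sym bv bAB]; split; [apply: r27 | apply: reach3].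
Qed.
End Dichotomy.

(** * Densities of the edge types *)

Section TypeNumerics.
Variable F : realFieldType.

Lemma cancel_small (mu x y e : F) : 0 < mu -> mu <= x -> x * y <= e -> 0 <= e -> y * mu <= e.
Proof.
move=> mu0 lex lexy e0; have [y0|y0] := lerP 0 y; last by nra.
by apply: le_trans lexy; rewrite mulrC ler_wpM2r.
Qed.

(** Here [a], [b] are the densities of the two sides and [s_i] is the density of the edges with a
    given pattern of [i] letters in the side of density [a]. The three degree conditions are those
    of pairs of the two sides. As no two adjacent [s_i] are both large, either only the even or only
    the odd ones are, or a lone [s_1] or [s_3] together with an end type is. If [s_2] is large, or
    both [s_1] and [s_3] are, the degree conditions give [1 <= 4 * a * b] up to a small error, hence
    [a = b] almost. If [s_1], [s_2], [s_3] are all small, the pairs across have too small a degree.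
    In the remaining cases the conditions would give [1 <= 2 * a ^ 2] and [1 <= 2 * b ^ 2], which is
    impossible as [a + b <= 1]. *)
Lemma type_numerics (m eps : F) : 0 < m -> m <= 1 -> 0 < eps -> eps <= 1 ->
  exists2 eta : F, 0 < eta /\ eta <= eps &
  forall a b s0 s1 s2 s3 s4 : F,
    m <= a -> m <= b -> a + b <= 1 ->
    a ^+ 2 <= 2 * (s4 + 2 * s3 + s2) + eta ->
    a * b <= 2 * (s3 + 2 * s2 + s1) + eta ->
    b ^+ 2 <= 2 * (s2 + 2 * s1 + s0) + eta ->
    s4 <= a ^+ 4 -> s3 <= a ^+ 3 * b -> s2 <= a ^+ 2 * b ^+ 2 -> s1 <= a * b ^+ 3 -> s0 <= b ^+ 4 ->
    s0 <= eta \/ s1 <= eta -> s1 <= eta \/ s2 <= eta ->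
    s2 <= eta \/ s3 <= eta -> s3 <= eta \/ s4 <= eta ->
  `|a - b| <= eps /\
  ([/\ s1 <= eta & s3 <= eta] \/ [/\ s0 <= eta, s2 <= eta & s4 <= eta]).
Proof.
move=> m0 m1 e0 e1; pose mu := m ^+ 2; pose eta := mu ^+ 2 * eps ^+ 2 / 10.
have mu0 : 0 < mu by rewrite exprn_gt0.
have mu1 : mu <= 1 by rewrite exprn_ile1 // ltW.
have ee0 : 0 < eps ^+ 2 by rewrite exprn_gt0.
have ee1 : eps ^+ 2 <= eps by rewrite expr2; nra.
have mm1 : mu ^+ 2 <= mu by rewrite expr2; nra.
have mm0 : 0 < mu ^+ 2 by rewrite exprn_gt0.
have h1 : mu ^+ 2 * eps ^+ 2 <= mu * eps ^+ 2 by rewrite ler_wpM2r // ltW.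
have h2 : mu ^+ 2 * eps ^+ 2 <= mu ^+ 2 by nra.
have h3 : mu * eps ^+ 2 <= eps by nra.
have h4 : 0 < mu ^+ 2 * eps ^+ 2 by rewrite mulr_gt0.
have eta10 : 10 * eta = mu ^+ 2 * eps ^+ 2 by rewrite /eta; field.
clearbody eta; exists eta; first by split; lra.
move=> a b s0 s1 s2 s3 s4 ma mb ab AA AB BB l4 l3 l2 l1 l0 c01 c12 c23 c34.
have a0 : 0 < a by apply: lt_le_trans ma.
have b0 : 0 < b by apply: lt_le_trans mb.
have aa : mu <= a ^+ 2 by rewrite lerXn2r ?nnegrE // ltW.
have bb : mu <= b ^+ 2 by rewrite lerXn2r ?nnegrE // ltW.
have abm : mu <= a * b by rewrite /mu expr2 ler_pM // ltW.
(* As [a + b <= 1], the square of [a - b] is at most [1 - 4 * a * b]. *)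
have close : (1 - 4 * (a * b)) * mu <= 5 * eta -> `|a - b| <= eps.
  move=> h; have h5 : (1 - 4 * (a * b)) <= eps ^+ 2 by rewrite -(ler_pM2r mu0); lra.
  rewrite -(@ler_pXn2r _ 2) ?nnegrE ?normr_ge0 ?(ltW e0) // real_normK ?num_real //.
  apply: le_trans h5; have : (a + b) ^+ 2 <= 1 by rewrite exprn_ile1 // addr_ge0 // ltW.
  rewrite sqrrB sqrrD; lra.
have [s2e|s2e] := lerP s2 eta; last first.
  have s1e : s1 <= eta by case: c12 => //; lra.
  have s3e : s3 <= eta by case: c23 => //; lra.
  split; last by left.
  apply: close; apply: (cancel_small mu0 abm); last by lra.
  have -> : a * b * (1 - 4 * (a * b)) = a * b - 4 * (a ^+ 2 * b ^+ 2) by ring.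
  lra.
have [s1e|s1e] := lerP s1 eta; have [s3e|s3e] := lerP s3 eta.
- by exfalso; lra.
- have s4e : s4 <= eta by case: c34 => //; lra.
  exfalso; have hb : (1 - 2 * b ^+ 2) * mu <= 7 * eta.
    apply: (cancel_small mu0 bb); last by lra.
    have -> : b ^+ 2 * (1 - 2 * b ^+ 2) = b ^+ 2 - 2 * b ^+ 4 by ring.
    lra.
  have ha : (1 - 2 * a ^+ 2) * mu <= 7 * eta.
    apply: (cancel_small mu0 abm); last by lra.
    have -> : a * b * (1 - 2 * a ^+ 2) = a * b - 2 * (a ^+ 3 * b) by ring.
    lra.
  have : (a + b) ^+ 2 <= 1 by rewrite exprn_ile1 // addr_ge0 // ltW.
  rewrite sqrrD => hab; have : (4 * mu) * mu <= 14 * eta.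
    have h5 : 4 * mu <= (1 - 2 * a ^+ 2) + (1 - 2 * b ^+ 2) by lra.
    by have := ler_wpM2r (ltW mu0) h5; rewrite [X in _ <= X]mulrDl; lra.
  rewrite (_ : 4 * mu * mu = 4 * mu ^+ 2); [lra | ring].
- have s0e : s0 <= eta by case: c01 => //; lra.
  exfalso; have ha : (1 - 2 * a ^+ 2) * mu <= 7 * eta.
    apply: (cancel_small mu0 aa); last by lra.
    have -> : a ^+ 2 * (1 - 2 * a ^+ 2) = a ^+ 2 - 2 * a ^+ 4 by ring.
    lra.
  have hb : (1 - 2 * b ^+ 2) * mu <= 7 * eta.
    apply: (cancel_small mu0 abm); last by lra.
    have -> : a * b * (1 - 2 * b ^+ 2) = a * b - 2 * (a * b ^+ 3) by ring.
    lra.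
  have : (a + b) ^+ 2 <= 1 by rewrite exprn_ile1 // addr_ge0 // ltW.
  rewrite sqrrD => hab; have : (4 * mu) * mu <= 14 * eta.
    have h5 : 4 * mu <= (1 - 2 * a ^+ 2) + (1 - 2 * b ^+ 2) by lra.
    by have := ler_wpM2r (ltW mu0) h5; rewrite [X in _ <= X]mulrDl; lra.
  rewrite (_ : 4 * mu * mu = 4 * mu ^+ 2); [lra | ring].
- have s4e : s4 <= eta by case: c34 => //; lra.
  have s0e : s0 <= eta by case: c01 => //; lra.
  split; last by right.
  apply: close; apply: (cancel_small mu0 aa); last by lra.
  have -> : a ^+ 2 * (1 - 4 * (a * b)) = a ^+ 2 - 4 * (a ^+ 3 * b) by ring.
  lra.
Qed.
End TypeNumerics.

(** * Counting edges by type *)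

Section EdgeTypes.
Local Open Scope nat_scope.
Variables (V : finType) (H : {set {set V}}) (A B : {set V}).
Local Notation n := #|V|.
Local Notation ed := (edge_word H).
Local Notation C := (~: (A :|: B)).

Definition type_count c1 c2 c3 c4 := typed_edges H A B [:: c1; c2; c3; c4].
Local Notation ty := type_count.
Local Notation sd := (side A B).

Lemma type_countE c1 c2 c3 c4 : ty c1 c2 c3 c4 = \sum_x \sum_y \sum_z \sum_w
  (ed [:: x; y; z; w] && [&& x \in sd c1, y \in sd c2, z \in sd c3 & w \in sd c4]).
Proof.
rewrite /ty /typed_edges /wcount; do 4!(apply: eq_bigr => ? _).
by rewrite asboolb /= andbT.
Qed.

Lemma type_count12 c1 c2 c3 c4 : ty c1 c2 c3 c4 = ty c2 c1 c3 c4.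
Proof.
rewrite !type_countE exchange_big; do 4!(apply: eq_bigr => ? _).
congr (nat_of_bool (_ && _)); last by rewrite andbCA.
by apply: edge_word_perm; rewrite (perm_catCA [:: _] [:: _] [:: _; _]).
Qed.

Lemma type_count23 c1 c2 c3 c4 : ty c1 c2 c3 c4 = ty c1 c3 c2 c4.
Proof.
rewrite !type_countE; apply: eq_bigr => x _; rewrite exchange_big; do 3!(apply: eq_bigr => ? _).
congr (nat_of_bool (_ && _)); last by congr (_ && _); rewrite andbCA.
by apply: edge_word_perm; rewrite perm_cons (perm_catCA [:: _] [:: _] [:: _]).
Qed.

Lemma type_count34 c1 c2 c3 c4 : ty c1 c2 c3 c4 = ty c1 c2 c4 c3.
Proof.
rewrite !type_countE; do 2!(apply: eq_bigr => ? _); rewrite exchange_big; do 2!(apply: eq_bigr => ? _).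
congr (nat_of_bool (_ && _)); last by do 2!congr (_ && _); rewrite andbC.
by apply: edge_word_perm; rewrite !perm_cons (perm_catC [:: _] [:: _]).
Qed.

Lemma sum4_prod (p q r t : V -> nat) : \sum_x \sum_y \sum_z \sum_w p x * (q y * (r z * t w))
  = (\sum_x p x) * ((\sum_x q x) * ((\sum_x r x) * (\sum_x t x))).
Proof.
rewrite big_distrl; apply: eq_bigr => x _; rewrite big_distrl big_distrr; apply: eq_bigr => y _.
rewrite /= big_distrl !big_distrr; apply: eq_bigr => z _.
by rewrite /= !big_distrr.
Qed.

Lemma type_count_ub c1 c2 c3 c4 :
  ty c1 c2 c3 c4 <= #|sd c1| * (#|sd c2| * (#|sd c3| * #|sd c4|)).
Proof.
rewrite type_countE -!sum_mem -sum4_prod; do 4!(apply: leq_sum => ? _).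
by case: (ed _) => //=; do 4!case: (_ \in _).
Qed.

Lemma sum_in_C : [/\ #|C| * n ^ 3 = \sum_(x : V) \sum_(y : V) \sum_(z : V) \sum_(w : V) (x \in C),
  #|C| * n ^ 3 = \sum_(x : V) \sum_(y : V) \sum_(z : V) \sum_(w : V) (y \in C),
  #|C| * n ^ 3 = \sum_(x : V) \sum_(y : V) \sum_(z : V) \sum_(w : V) (z \in C) &
  #|C| * n ^ 3 = \sum_(x : V) \sum_(y : V) \sum_(z : V) \sum_(w : V) (w \in C)].
Proof.
split.
- rewrite -sum_mem big_distrl; apply: eq_bigr => x _; rewrite !sum_constV !expnS expn0.
  by rewrite /= muln1 mulnC -!mulnA.
- rewrite sum_constV; transitivity (n * \sum_y (y \in C) * n ^ 2).
    by rewrite -big_distrl /= sum_mem [n ^ 3]expnS mulnCA.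
  by congr (_ * _); apply: eq_bigr => y _; rewrite /= !sum_constV -mulnn mulnC mulnA.
- rewrite !sum_constV; transitivity (n * (n * \sum_y (y \in C) * n)).
    by rewrite -big_distrl /= sum_mem !expnS expn0; move: (#|V|) (#|C|) => u v; lia.
  by do 2!congr (_ * _); apply: eq_bigr => y _; rewrite /= !sum_constV mulnC.
by rewrite !sum_constV sum_mem !expnS expn0; move: (#|V|) (#|C|) => u v; lia.
Qed.

Lemma sum_side_codeg c1 c2 :
  \sum_x \sum_y (x \in sd c1) * ((y \in sd c2) * codeg H x y) <=
  ty c1 c2 true true + ty c1 c2 true false + ty c1 c2 false true + ty c1 c2 false false
  + 2 * (#|C| * n ^ 3).
Proof.
have [_ _ e1 e2] := sum_in_C; rewrite mul2n -addnn {1}e1 e2 !type_countE -!big_split; apply: leq_sum => x _.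
rewrite -!big_split; apply: leq_sum => y _; rewrite /codeg !big_distrr -!big_split; apply: leq_sum => z _.
rewrite /= !big_distrr -!big_split; apply: leq_sum => w _.
rewrite /side /= in_setC in_setU in_setC in_setU.
case: (ed _); last by rewrite !muln0.
case: (x \in _) => //; case: (y \in _) => //=.
by case: (z \in A); case: (z \in B); case: (w \in A); case: (w \in B).
Qed.

Definition wrong_edges (A' : {set V}) (sigma : bool) : nat :=
  wcount 4 (fun s => ed s && (odd (count (mem A') s) != sigma)).

Local Notation S0 := (ty false false false false).
Local Notation S1 := (ty true false false false).
Local Notation S2 := (ty true true false false).
Local Notation S3 := (ty true true true false).
Local Notation S4 := (ty true true true true).

Lemma type_sym1 : [/\ ty false true false false = S1, ty false false true false = S1
   & ty false false false true = S1].
Proof.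
have h1 : ty false true false false = S1 by rewrite type_count12.
have h2 : ty false false true false = S1 by rewrite type_count23.
by split=> //; rewrite type_count34.
Qed.

Lemma type_sym3 : [/\ ty true true false true = S3, ty true false true true = S3
   & ty false true true true = S3].
Proof.
have h1 : ty true true false true = S3 by rewrite type_count34.
have h2 : ty true false true true = S3 by rewrite type_count23.
by split=> //; rewrite type_count12.
Qed.

Lemma type_sym2 : [/\ ty true false true false = S2, ty true false false true = S2
   & [/\ ty false true true false = S2, ty false true false true = S2 & ty false false true true = S2]].
Proof.
have h1 : ty true false true false = S2 by rewrite type_count23.
have h2 : ty true false false true = S2 by rewrite type_count34.
have h3 : ty false true true false = S2 by rewrite type_count12.
have h4 : ty false true false true = S2 by rewrite type_count34.
by split=> //; split=> //; rewrite type_count23.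
Qed.

(** A word meets [C] or has a type; the edges of odd type have one or three letters in [A], in four
    positions each. *)
Lemma wrong_even : wrong_edges A false <= 4 * S1 + 4 * S3 + 4 * (#|C| * n ^ 3).
Proof.
have [a1 a2 a3] := type_sym1; have [b1 b2 b3] := type_sym3; have [c1 c2 c3 c4] := sum_in_C.
have -> : 4 * S1 = S1 + ty false true false false + ty false false true false + ty false false false true.
  by rewrite a1 a2 a3; move: S1 => u; lia.
have -> : 4 * S3 = S3 + ty true true false true + ty true false true true + ty false true true true.
  by rewrite b1 b2 b3; move: S3 => u; lia.
have -> : 4 * (#|C| * n ^ 3) = #|C| * n ^ 3 + #|C| * n ^ 3 + #|C| * n ^ 3 + #|C| * n ^ 3.
  by move: (_ * n ^ 3) => u; lia.
rewrite {1}c1 {1}c2 {1}c3 c4 !type_countE {a1 a2 a3 b1 b2 b3 c1 c2 c3 c4}.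
rewrite /wrong_edges /wcount -!big_split; apply: leq_sum => x _.
rewrite -!big_split; apply: leq_sum => y _; rewrite -!big_split; apply: leq_sum => z _.
rewrite /= -!big_split; apply: leq_sum => w _; rewrite asboolb /side /=.
rewrite !in_setC !in_setU; case: (ed _) => //=.
by case: (x \in A); case: (x \in B); case: (y \in A); case: (y \in B);
   case: (z \in A); case: (z \in B); case: (w \in A); case: (w \in B).
Qed.

Lemma wrong_odd : wrong_edges A true <= S0 + 6 * S2 + S4 + 4 * (#|C| * n ^ 3).
Proof.
have [a1 a2 [a3 a4 a5]] := type_sym2; have [c1 c2 c3 c4] := sum_in_C.
have -> : 6 * S2 = S2 + ty true false true false + ty true false false true + ty false true true false
    + ty false true false true + ty false false true true.
  by rewrite a1 a2 a3 a4 a5; move: S2 => u; lia.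
have -> : 4 * (#|C| * n ^ 3) = #|C| * n ^ 3 + #|C| * n ^ 3 + #|C| * n ^ 3 + #|C| * n ^ 3.
  by move: (_ * n ^ 3) => u; lia.
rewrite {1}c1 {1}c2 {1}c3 c4 !type_countE {a1 a2 a3 a4 a5 c1 c2 c3 c4}.
rewrite /wrong_edges /wcount -!big_split; apply: leq_sum => x _.
rewrite -!big_split; apply: leq_sum => y _; rewrite -!big_split; apply: leq_sum => z _.
rewrite /= -!big_split; apply: leq_sum => w _; rewrite asboolb /side /=.
rewrite !in_setC !in_setU; case: (ed _) => //=.
by case: (x \in A); case: (x \in B); case: (y \in A); case: (y \in B);
   case: (z \in A); case: (z \in B); case: (w \in A); case: (w \in B).
Qed.
Hypothesis deg : large_codegrees H.

(** Summing the codegree condition over all pairs with prescribed sides; the diagonal accounts for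
    one further term of order [n ^ 3]. *)
Lemma side_degree c1 c2 : #|sd c1| * #|sd c2| * n ^ 2 <=
  2 * (ty c1 c2 true true + ty c1 c2 true false + ty c1 c2 false true + ty c1 c2 false false)
  + 4 * (#|C| * n ^ 3) + 7 * n ^ 3.
Proof.
have := sum_side_codeg c1 c2; set X := \sum_x _; set Y := _ + ty c1 c2 false false => leXY.
suff : #|sd c1| * #|sd c2| * n ^ 2 <= 2 * X + 7 * n ^ 3.
  move=> h; apply: leq_trans h _; rewrite leq_add2r.
  by have := leq_mul (leqnn 2) leXY; rewrite mulnDr mulnA.
have -> : #|sd c1| * #|sd c2| * n ^ 2 = \sum_x \sum_y (x \in sd c1) * ((y \in sd c2) * n ^ 2).
  rewrite -!sum_mem -mulnA big_distrl; apply: eq_bigr => x _.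
  by rewrite big_distrl big_distrr.
have -> : 2 * X + 7 * n ^ 3 = 2 * X + \sum_(x : V) \sum_(y : V) (6 * n) + \sum_(x : V) \sum_y (x == y) * n ^ 2.
  rewrite -addnA; congr (_ + _).
  have -> : \sum_(x : V) \sum_y (x == y) * n ^ 2 = n ^ 3.
    have -> : n ^ 3 = \sum_(x : V) n ^ 2 by rewrite sum_constV -expnS.
    apply: eq_bigr => x _.
    rewrite (bigD1 x) //= eqxx mul1n big1 ?addn0 // => y.
    by rewrite eq_sym => /negPf->.
  by rewrite !sum_constV !expnS expn0; move: #|_| => u; lia.
rewrite /X big_distrr -!big_split; apply: leq_sum => x _.
rewrite /= big_distrr -!big_split; apply: leq_sum => y _ /=.
case: (x \in _); last by rewrite mul0n.
case: (y \in _); last by rewrite !mul0n muln0.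
rewrite !mul1n; have [eqxy|nxy] := eqVneq x y; first by rewrite mul1n leq_addl.
by rewrite mul0n addn0; apply: deg.
Qed.

End EdgeTypes.

(** * Exchangeability or proximity to a parity hypergraph *)

Section NearExtremal.
Variable F : archiRealFieldType.

(** All counts are divided by the corresponding power of [n], so that [type_numerics] applies to the
    two cliques. The parameter [l] controls the proximity: the error terms are of order [1 / l]. *)
Lemma closed_or_near_extremal (l : nat) : exists K n0 : nat,
    forall (V : finType) (H : {set {set V}}), uniform 4 H -> (n0 <= #|V|)%N ->
    large_codegrees H ->
  closed H 31 K \/ exists (A : {set V}) sigma,
    [/\ (wrong_edges H A sigma * l <= #|V| ^ 4)%N, (2 * #|A| * l <= #|V| * l + #|V|)%N
      & (#|V| * l <= 2 * #|A| * l + #|V|)%N].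
Proof.
wlog l_gt0 : l / (0 < l)%N => [wlogl|].
  case: l => [|l]; last exact: wlogl.
  have [K [n0 h]] := wlogl 1%N isT; exists K, n0 => V H Hu n_big deg.
  have [|[A [sigma _]]] := h V H Hu n_big deg; [by left | right].
  by exists A, sigma; rewrite !muln0 !add0n; split.
have [lq lqE] : exists lq : F, lq = l%:R by exists l%:R.
have lq1 : 1 <= lq by rewrite lqE ler1n.
have lq0 : 0 < lq by apply: lt_le_trans lq1.
have [eps eps0 epsl] : exists2 eps : F, 0 < eps & 16 * (eps * lq) = 1.
  exists (16 * lq)^-1; first by rewrite invr_gt0 mulr_gt0.
  by field; rewrite gt_eqF.
have eps1 : eps <= 1.
  have : eps * 1 <= eps * lq by rewrite ler_wpM2l // ltW.
  by rewrite mulr1; move: (eps * lq) epsl => x; clear; lra.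
have [m m0 m160] : exists2 m : F, 0 < m & 160 * m = 1.
  by exists 160^-1; [rewrite invr_gt0 | field].
have m1 : m <= 1 by clear -m0 m160; lra.
have [eta [eta0 eta_eps] numerics] := type_numerics m0 m1 eps0 eps1.
have [N0 N0eta] : exists N0 : nat, 1 <= eta * N0%:R.
  exists (Num.bound eta^-1); rewrite mulrC -(ler_pdivrMr _ _ eta0) div1r; apply: ltW.
  by apply: archi_boundP; rewrite invr_ge0; apply: ltW.
pose g := (160 + 8 * N0 + 16 * l)%N.
have [|K [n1 dich]] := @closed_or_two_cliques g N0; first by rewrite /g -addnA leq_addr.
exists K, (n1 + 14 * N0 + 1)%N => V H Hu n_big deg.
have le_n1 : (n1 <= #|V|)%N by apply: leq_trans n_big; rewrite -addnA leq_addr.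
have [cl|[A [B [dAB leC leA leB small]]]] := dich V H Hu le_n1 deg; [by left | right].
have n_gt0 : (0 < #|V|)%N by apply: leq_trans n_big; rewrite addn1.
pose nu : F := #|V|%:R; have nu0 : 0 < nu by rewrite ltr0n.
have nu4 : 0 < nu ^+ 4 by rewrite exprn_gt0.
pose al : F := #|A|%:R / nu; pose be : F := #|B|%:R / nu; pose ka : F := #|~: (A :|: B)|%:R / nu.
pose s c1 c2 c3 c4 : F := (type_count H A B c1 c2 c3 c4)%:R / nu ^+ 4.
have alE : #|A|%:R = al * nu by rewrite /al divfK // gt_eqF.
have beE : #|B|%:R = be * nu by rewrite /be divfK // gt_eqF.
have kaE : #|~: (A :|: B)|%:R = ka * nu by rewrite /ka divfK // gt_eqF.
have sE c1 c2 c3 c4 : (type_count H A B c1 c2 c3 c4)%:R = s c1 c2 c3 c4 * nu ^+ 4.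
  by rewrite /s divfK // gt_eqF.
have sum1 : al + be + ka = 1.
  have : (#|A| + #|B| + #|~: (A :|: B)| = #|V|)%N.
    rewrite -(cardsC (A :|: B)) cardsU disjoint_setI0 // cards0 subn0 //.
  move/(congr1 (fun k : nat => k%:R : F)); rewrite !natrD alE beE kaE -/nu => h.
  by apply: (mulIf (lt0r_neq0 nu0)); rewrite mul1r -[RHS]h !mulrDl.
have ka0 : 0 <= ka by rewrite divr_ge0.
have kag : ka * g%:R <= 1.
  rewrite -(ler_pM2r nu0) mul1r mulrAC -kaE -natrM ler_nat; exact: ltnW.
have gE : g%:R = 160 + 8 * N0%:R + 16 * lq :> F.
  by rewrite /g (natrD F (160 + 8 * N0) (16 * l)) (natrD F 160 (8 * N0)) (natrM F 8) (natrM F 16) -lqE.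
have N00 : 0 <= N0%:R :> F by [].
have ka_eta : 8 * ka <= eta.
  have h : ka * (8 * N0%:R) <= eta * N0%:R.
    apply: le_trans N0eta; apply: le_trans kag; rewrite ler_wpM2l // gE; clear -lq0; lra.
  have N0p : 0 < N0%:R :> F by rewrite lt_def N00 andbT; apply: contraTneq N0eta => ->; rewrite mulr0; clear; lra.
  by rewrite -(ler_pM2r N0p); apply: le_trans h; rewrite mulrA [8 * ka]mulrC.
have ka_l : 16 * (ka * lq) <= 1.
  by apply: le_trans kag; rewrite gE mulrCA ler_wpM2l //; clear -N00; lra.
have nu_eta : 14 <= eta * nu.
  have : (14 * N0)%:R <= nu :> F.
    by rewrite ler_nat (leq_trans _ n_big) // -addnA addnCA leq_addr.
  rewrite natrM => h; have : eta * (14%:R * N0%:R) <= eta * nu by rewrite ler_wpM2l // ltW.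
  apply: le_trans; rewrite mulrCA -[X in X <= _]mulr1 ler_wpM2l //.
have side_deg c1 c2 (x y : F) : #|side A B c1|%:R = x * nu -> #|side A B c2|%:R = y * nu ->
   x * y <= 2 * (s c1 c2 true true + s c1 c2 true false + s c1 c2 false true + s c1 c2 false false) + eta.
  move=> xE yE; have := side_degree A B deg c1 c2.
  rewrite -(ler_nat F) !(natrX, natrM, natrD) xE yE !sE kaE -/nu => h.
  rewrite -(ler_pM2r nu4); apply: (@le_trans _ _ (x * nu * (y * nu) * nu ^+ 2)).
    by rewrite le_eqVlt; apply/orP; left; apply/eqP; ring.
  apply: le_trans h _; set S := s _ _ _ _ + _ + _ + _.
  have h7 : 7 * nu ^+ 3 <= eta / 2 * nu ^+ 4.
    have -> : eta / 2 * nu ^+ 4 = (eta * nu) / 2 * nu ^+ 3 by field.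
    by rewrite ler_wpM2r ?exprn_ge0 ?(ltW nu0) //; clear -nu_eta; lra.
  have h4 : 4 * (ka * nu * nu ^+ 3) <= eta / 2 * nu ^+ 4.
    have -> : 4 * (ka * nu * nu ^+ 3) = 4 * ka * nu ^+ 4 by ring.
    by rewrite ler_wpM2r ?(ltW nu4) //; clear -ka_eta; lra.
  have -> : (2 * S + eta) * nu ^+ 4 = 2 * (S * nu ^+ 4) + eta / 2 * nu ^+ 4 + eta / 2 * nu ^+ 4 by field.
  have -> : s c1 c2 true true * nu ^+ 4 + s c1 c2 true false * nu ^+ 4 + s c1 c2 false true * nu ^+ 4 +
     s c1 c2 false false * nu ^+ 4 = S * nu ^+ 4 by rewrite /S !mulrDl.
  by rewrite !lerD.
have ub c1 c2 c3 c4 (x1 x2 x3 x4 : F) : #|side A B c1|%:R = x1 * nu -> #|side A B c2|%:R = x2 * nu ->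
    #|side A B c3|%:R = x3 * nu -> #|side A B c4|%:R = x4 * nu ->
    s c1 c2 c3 c4 <= x1 * x2 * x3 * x4.
  move=> e1 e2 e3 e4; have := type_count_ub H A B c1 c2 c3 c4.
  rewrite -(ler_nat F) !natrM e1 e2 e3 e4 sE => h; rewrite -(ler_pM2r nu4).
  by apply: le_trans h _; rewrite le_eqVlt; apply/orP; left; apply/eqP; ring.
have small' b2 b3 b4 : s false b2 b3 b4 <= eta \/ s true b2 b3 b4 <= eta.
  have le_eta c : (typed_edges H A B [:: c; b2; b3; b4] * N0 < #|V| ^ 4)%N -> s c b2 b3 b4 <= eta.
    move=> /ltnW; rewrite -(ler_nat F) natrM natrX -/(type_count _ _ _ _ _ _ _) sE -/nu => h.
    rewrite -(ler_pM2r nu4); have s0 : 0 <= s c b2 b3 b4 * nu ^+ 4 by rewrite -sE.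
    have : s c b2 b3 b4 * nu ^+ 4 * (eta * N0%:R) <= eta * nu ^+ 4.
      by rewrite mulrCA ler_wpM2l // ltW.
    by apply: le_trans; rewrite -[X in X <= _]mulr1 ler_wpM2l.
  by case: (small b2 b3 b4) => /le_eta; [left | right].
have [e11 e12 e13] := type_sym1 H A B; have [e31 e32 e33] := type_sym3 H A B.
have [e21 e22 [e23 e24 e25]] := type_sym2 H A B.
have eqs c1 c2 c3 c4 c1' c2' c3' c4' : type_count H A B c1 c2 c3 c4 = type_count H A B c1' c2' c3' c4' ->
   s c1 c2 c3 c4 = s c1' c2' c3' c4' by rewrite /s => ->.
have AA := side_deg true true al al alE alE.
have AB := side_deg true false al be alE beE.
have BB := side_deg false false be be beE beE.
rewrite (eqs _ _ _ _ _ _ _ _ e21) (eqs _ _ _ _ _ _ _ _ e22) (eqs _ _ _ _ _ _ _ _ e32) in AB.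
rewrite (eqs _ _ _ _ _ _ _ _ e31) in AA.
rewrite (eqs _ _ _ _ _ _ _ _ e25) (eqs _ _ _ _ _ _ _ _ e12) (eqs _ _ _ _ _ _ _ _ e13) in BB.
have u4 := ub true true true true al al al al alE alE alE alE.
have u3 := ub true true true false al al al be alE alE alE beE.
have u2 := ub true true false false al al be be alE alE beE beE.
have u1 := ub true false false false al be be be alE beE beE beE.
have u0 := ub false false false false be be be be beE beE beE beE.
have c34 := small' true true true; rewrite (eqs _ _ _ _ _ _ _ _ e33) in c34.
have c23 := small' true true false; rewrite (eqs _ _ _ _ _ _ _ _ e23) in c23.
have c12 := small' true false false; rewrite (eqs _ _ _ _ _ _ _ _ e11) in c12.
have c01 := small' false false false.
have mle x : 1 <= 160%:R * x -> m <= x by clear -m160; lra.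
have mal : m <= al.
  by apply: mle; rewrite -(ler_pM2r nu0) -mulrA -alE mul1r -natrM ler_nat.
have mbe : m <= be.
  by apply: mle; rewrite -(ler_pM2r nu0) -mulrA -beE mul1r -natrM ler_nat.
have le1 : al + be <= 1 by clear -sum1 ka0; lra.
have := numerics al be (s false false false false) (s true false false false)
  (s true true false false) (s true true true false) (s true true true true) mal mbe le1.
case.
- by clear -AA; lra.
- by clear -AB; lra.
- by clear -BB; lra.
- by rewrite (_ : al ^+ 4 = al * al * al * al) //; ring.
- by rewrite (_ : al ^+ 3 * be = al * al * al * be) //; ring.
- by rewrite (_ : al ^+ 2 * be ^+ 2 = al * al * be * be) //; ring.
- by rewrite (_ : al * be ^+ 3 = al * be * be * be) //; ring.
- by rewrite (_ : be ^+ 4 = be * be * be * be) //; ring.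
- exact: c01.
- exact: c12.
- exact: c23.
- exact: c34.
move=> close wrong.
have [h1 h2] : 2 * al * lq <= lq + 1 /\ lq <= 2 * al * lq + 1.
  move: close; rewrite ler_norml => /andP[k1 k2].
  have k3 : (2 * al - 1) * lq <= eps * lq by rewrite ler_wpM2r ?(ltW lq0) //; clear -k2 sum1 ka0; lra.
  have k4 : (1 - 2 * al - ka) * lq <= eps * lq by rewrite ler_wpM2r ?(ltW lq0) //; clear -k1 sum1 ka0; lra.
  by clear -k3 k4 epsl ka_l; split; lra.
exists A.
suff [sigma wr] : exists sigma, (wrong_edges H A sigma)%:R <= (8 * eta + 4 * ka) * nu ^+ 4.
  exists sigma; split.
  - rewrite -(ler_nat F) natrM natrX -/nu -lqE.
    apply: le_trans (_ : (8 * eta + 4 * ka) * nu ^+ 4 * lq <= _); first by rewrite ler_wpM2r // ltW.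
    rewrite mulrAC -[X in _ <= X]mul1r ler_wpM2r ?(ltW nu4) //.
    have : eta * lq <= eps * lq by rewrite ler_wpM2r // ltW.
    by clear -epsl ka_l; lra.
  - rewrite -(ler_nat F) !(natrM, natrD) alE -/nu -lqE.
    have := ler_wpM2r (ltW nu0) h1; rewrite [X in _ <= X]mulrDl mul1r [lq * nu]mulrC.
    by rewrite (_ : 2 * al * lq * nu = 2 * (al * nu) * lq) //; ring.
  - rewrite -(ler_nat F) !(natrM, natrD) alE -/nu -lqE.
    have := ler_wpM2r (ltW nu0) h2; rewrite [X in _ <= X]mulrDl mul1r [lq * nu]mulrC.
    by rewrite (_ : 2 * al * lq * nu = 2 * (al * nu) * lq) //; ring.
have scale x : x <= eta -> x * nu ^+ 4 <= eta * nu ^+ 4 by move=> h; rewrite ler_wpM2r // ltW.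
have eC : ka * nu * nu ^+ 3 = ka * nu ^+ 4 by ring.
case: wrong => [[/scale w1 /scale w3]|[/scale w0 /scale w2 /scale w4]]; [exists false | exists true].
  have := wrong_even H A B; rewrite -(ler_nat F) !(natrX, natrM, natrD) !sE kaE -/nu eC => h.
  by apply: le_trans h _; rewrite mulrDl; clear -w1 w3; lra.
have := wrong_odd H A B; rewrite -(ler_nat F) !(natrX, natrM, natrD) !sE kaE -/nu eC => h.
apply: le_trans h _; rewrite mulrDl; clear -w0 w2 w4; lra.
Qed.
End NearExtremal.

(** * Perfect matchings from exchangeability *)

Section ClosedCase.
Local Open Scope nat_scope.

Lemma perfect_matchingP (V : finType) (H M : {set {set V}}) :
  matching H M -> cover M = setT -> has_perfect_matching H.
Proof. by move=> /andP[sM tM] cM; exists M; rewrite /perfect_matching sM tM cM eqxx. Qed.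

(** An absorbing set [W] is put aside, all but [4 * q] of the other vertices are matched, and [W]
    absorbs these. *)
Lemma closed_perfect_matching m K : exists n0 : nat, forall (V : finType) (H : {set {set V}}),
    uniform 4 H -> n0 <= #|V| -> 4 %| #|V| ->
    large_codegrees H ->
  closed H m K -> has_perfect_matching H.
Proof.
have [q [L [n1 almost]]] := almost_perfect_matching.
have [n2 absorb] := absorbing_set (4 * q) (q * (4 + (m + (m + (m + m)))))
  ((4 * (K * (K * (K * K)))) ^ q) (L + 2).
exists (n1 + n2 + 8 * q + 14) => V H Hu n_big div4 deg cl.
have d4 : dense 4 4 (fun s => edge_word H s).
  by apply: dense_edges => //; apply: leq_trans n_big; rewrite leq_addl.
have [||W [leW divW absW]] := absorb V H Hu; first by lia.
  exact: dense_absorbers.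
have cW : #|W| + #|~: W| = #|V| by exact: cardsC.
have divX : 4 %| #|~: W| by rewrite -(dvdn_addr _ divW) cW.
have leX : 4 * q <= #|~: W|.
  by move: leW n_big cW; clear; move: #|W| #|~: W| (#|V|) => w x k; nia.
have [j jE] : exists j, #|~: W| = 4 * j + 4 * q.
  case/dvdnP: divX => k kE; exists (k - q); rewrite kE; move: leX; rewrite kE; clear; lia.
have [|||M [mM cM sM]] := almost V H Hu _ deg W j; first by lia.
- by apply: leq_trans leW; rewrite leq_mul2l leq_addr orbT.
- by rewrite jE leq_add2l leq_pmull.
pose Q := ~: W :\: cover M.
have szQ : #|Q| = 4 * q.
  have := cardsID (cover M) (~: W); rewrite (setIidPr cM) (card_cover_matching Hu mM) sM jE.
  by rewrite -/Q => /addnI.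
have dQW : [disjoint Q & W].
  by rewrite disjoints_subset; apply/subsetP=> x; rewrite !inE => /andP[].
have [M' mM' cM'] := absW Q szQ dQW.
apply: (@perfect_matchingP _ _ (M :|: M')).
  apply: matchingU => //; rewrite cM' disjoints_subset; apply/subsetP => x xM.
  by have /subsetP/(_ x xM) := cM; rewrite !inE xM => /negPf->.
rewrite cover_setU cM'; apply/setP=> x; rewrite !inE.
by case: (x \in cover M) => //=; case: (x \in W).
Qed.
End ClosedCase.

(** * Recombining blocks of the same type *)

Section Recombination.
Local Open Scope nat_scope.
Variables (V : finType) (H : {set {set V}}) (A : {set V}) (sigma : bool).
Local Notation ed := (edge_word H).
Implicit Types (s w f e g h : seq V) (ws : seq (seq V)).

Definition right_parity s : bool := odd (count (mem A) s) == sigma.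
Definition missing v : nat := wcount 3 (fun s => right_parity (v :: s) && ~~ ed (v :: s)).
(** Positions matter: letters are exchanged between blocks at equal positions of the type, which
    keeps track of the side of every letter. *)
Definition block_type w : seq bool := map (mem A) w.

Lemma right_parity_perm s t : perm_eq s t -> right_parity s = right_parity t.
Proof. by move=> st; rewrite /right_parity (permP st). Qed.

Lemma right_parity_type w : right_parity w = (odd (count id (block_type w)) == sigma).
Proof. by rewrite /block_type count_map. Qed.

Lemma block_type_nth (x0 : V) w w' j : size w = 4 -> size w' = 4 -> block_type w = block_type w' -> j < 4 ->
  (nth x0 w j \in A) = (nth x0 w' j \in A).
Proof.
move=> sz sz' tw lt_j; have : nth false (block_type w) j = nth false (block_type w') j by rewrite tw.
by rewrite /block_type !(nth_map x0) ?sz ?sz'.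
Qed.

Lemma sum_uniq_le (s : seq V) (F : V -> nat) : uniq s -> \sum_(x <- s) F x <= \sum_x F x.
Proof. by move=> Us; rewrite big_uniq // [X in _ <= X](bigID (mem s)) leq_addr. Qed.

Lemma sum_missing (x0 : V) (cl : seq (seq V)) v a b c :
    uniq [seq nth x0 w a | w <- cl] -> uniq [seq nth x0 w b | w <- cl] ->
    uniq [seq nth x0 w c | w <- cl] ->
    (forall e g h, e \in cl -> g \in cl -> h \in cl ->
      right_parity [:: v; nth x0 e a; nth x0 g b; nth x0 h c]) ->
  \sum_(e <- cl) \sum_(g <- cl) \sum_(h <- cl) ~~ ed [:: v; nth x0 e a; nth x0 g b; nth x0 h c]
    <= missing v.
Proof.
move=> Ua Ub Uc right.
have -> : \sum_(e <- cl) \sum_(g <- cl) \sum_(h <- cl) ~~ ed [:: v; nth x0 e a; nth x0 g b; nth x0 h c] =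
  \sum_(x <- [seq nth x0 w a | w <- cl]) \sum_(y <- [seq nth x0 w b | w <- cl])
  \sum_(z <- [seq nth x0 w c | w <- cl]) (right_parity [:: v; x; y; z] && ~~ ed [:: v; x; y; z]).
  rewrite big_map; apply: eq_big_seq => e ecl; rewrite big_map; apply: eq_big_seq => g gcl.
  by rewrite big_map; apply: eq_big_seq => h hcl; rewrite right.
apply: leq_trans (sum_uniq_le _ Ua) _; apply: leq_sum => x _.
apply: leq_trans (sum_uniq_le _ Ub) _; apply: leq_sum => y _.
apply: leq_trans (sum_uniq_le _ Uc) _; apply: leq_sum => z _.
by rewrite asboolb.
Qed.

(** The four words form a Latin square: each takes one letter from each of the blocks [f], [e], [g],
    [h], in four different positions. As the blocks have the same type, every new word has the type
    of [f], hence the right parity. Each word contains one letter of [f], so that it fails for at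
    most [mu] triples of blocks, and repeated blocks account for at most [3 * size cl ^ 2] triples.
    *)
Lemma recombine (x0 f1 f2 f3 f4 : V) (cl : seq (seq V)) mu :
    uniq (flatten cl) -> (forall w, w \in cl -> size w = 4) ->
    right_parity [:: f1; f2; f3; f4] ->
    (forall w, w \in cl -> block_type w = block_type [:: f1; f2; f3; f4]) ->
    (forall v, v \in [:: f1; f2; f3; f4] -> missing v <= mu) ->
    4 * mu + 3 * size cl ^ 2 < size cl ^ 3 ->
  exists e g h, [/\ [/\ e \in cl, g \in cl & h \in cl], [/\ e != g, g != h & e != h],
    ed [:: f1; nth x0 e 1; nth x0 g 2; nth x0 h 3] /\ ed [:: nth x0 e 0; f2; nth x0 h 2; nth x0 g 3] &
    ed [:: nth x0 g 0; nth x0 h 1; f3; nth x0 e 3] /\ ed [:: nth x0 h 0; nth x0 g 1; nth x0 e 2; f4]].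
Proof.
move=> Ucl sz4 rf tcl mis lt_mu; apply: contrapT => no_ok.
have Ucl' : uniq cl by apply: uniq_of_flatten Ucl _ => w /sz4; case: w.
have Unth a : a < 4 -> uniq [seq nth x0 w a | w <- cl].
  move=> lt_a; rewrite map_inj_in_uniq // => w w' wcl w'cl eq_n.
  apply: (uniq_flatten_disjoint Ucl wcl w'cl (x := nth x0 w a)); first by rewrite mem_nth ?sz4.
  by rewrite eq_n mem_nth ?sz4.
have memA w j : w \in cl -> j < 4 -> (nth x0 w j \in A) = (nth x0 [:: f1; f2; f3; f4] j \in A).
  by move=> wcl lt_j; apply: block_type_nth => //; [exact: sz4 | exact: tcl].
have par a b c i : perm_eq [:: i; a; b; c] [:: 0; 1; 2; 3] ->
    forall e g h, e \in cl -> g \in cl -> h \in cl ->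
    right_parity [:: nth x0 [:: f1; f2; f3; f4] i; nth x0 e a; nth x0 g b; nth x0 h c].
  move=> p e g h ecl gcl hcl; have lt j : j \in [:: i; a; b; c] -> j < 4.
    by rewrite (perm_mem p) !inE => /or4P[] /eqP->.
  rewrite (_ : right_parity _ = right_parity [seq nth x0 [:: f1; f2; f3; f4] j | j <- [:: i; a; b; c]]).
    by rewrite (right_parity_perm (perm_map _ p)).
  rewrite /right_parity /= !memA // ; apply: lt; rewrite !inE eqxx ?orbT //.
pose S3 (F : seq V -> seq V -> seq V -> nat) := \sum_(e <- cl) \sum_(g <- cl) \sum_(h <- cl) F e g h.
set k := size cl in lt_mu.
have kc c : \sum_(w <- cl) c = k * c by rewrite big_const_seq count_predT iter_addn_0 mulnC.
have S3D F G : S3 (fun e g h => F e g h + G e g h) = S3 F + S3 G.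
  rewrite /S3 -big_split; apply: eq_bigr => e _; rewrite -big_split; apply: eq_bigr => g _.
  by rewrite -big_split.
have eq1 w : w \in cl -> \sum_(w' <- cl) (w == w') = 1.
  move=> wcl; rewrite (bigD1_seq w) //= eqxx big1 ?addn0 // => i.
  by rewrite eq_sym => /negPf->.
have d1 : S3 (fun e g h => e == g) = k ^ 2.
  rewrite /S3 -mulnn -kc; apply: eq_big_seq => e ecl.
  rewrite -[k]muln1 -(eq1 e ecl) big_distrr; apply: eq_bigr => g _; exact: kc.
have d2 : S3 (fun e g h => g == h) = k ^ 2.
  rewrite /S3 -mulnn kc; congr (_ * _); rewrite -[k]muln1 -kc; apply: eq_big_seq => g gcl; exact: eq1.
have d3 : S3 (fun e g h => e == h) = k ^ 2.
  rewrite /S3 -mulnn -kc; apply: eq_big_seq => e ecl; rewrite kc.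
  by rewrite -[RHS]muln1; congr (_ * _); apply: eq1.
have b1 := sum_missing (Unth 1 isT) (Unth 2 isT) (Unth 3 isT) (par 1 2 3 0 isT).
have b2 := sum_missing (Unth 0 isT) (Unth 3 isT) (Unth 2 isT) (par 0 3 2 1 isT).
have b3 := sum_missing (Unth 3 isT) (Unth 0 isT) (Unth 1 isT) (par 3 0 1 2 isT).
have b4 := sum_missing (Unth 2 isT) (Unth 1 isT) (Unth 0 isT) (par 2 1 0 3 isT).
rewrite /= in b1 b2 b3 b4.
pose N1 e g h : nat := ~~ ed [:: f1; nth x0 e 1; nth x0 g 2; nth x0 h 3].
pose N2 e g h : nat := ~~ ed [:: f2; nth x0 e 0; nth x0 g 3; nth x0 h 2].
pose N3 e g h : nat := ~~ ed [:: f3; nth x0 e 3; nth x0 g 0; nth x0 h 1].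
pose N4 e g h : nat := ~~ ed [:: f4; nth x0 e 2; nth x0 g 1; nth x0 h 0].
have : S3 (fun _ _ _ => 1) <= S3 (fun e g h => (e == g) + (g == h) + (e == h) + N1 e g h + N2 e g h
   + N3 e g h + N4 e g h).
  rewrite /S3 big_seq [X in _ <= X]big_seq; apply: leq_sum => e ecl.
  rewrite big_seq [X in _ <= X]big_seq; apply: leq_sum => g gcl.
  rewrite big_seq [X in _ <= X]big_seq; apply: leq_sum => h hcl.
  have [_|neg] := eqVneq e g; first by rewrite -!addnA.
  have [_|ngh] := eqVneq g h; first by rewrite -!addnA.
  have [_|neh] := eqVneq e h; first by rewrite -!addnA.
  rewrite !add0n lt0n; apply/negP=> N0; apply: no_ok; exists e, g, h.
  move: N0; rewrite !addn_eq0 => /andP[/andP[/andP[/eqP e1 /eqP e2] /eqP e3] /eqP e4].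
  have ok s : nat_of_bool (~~ ed s) = 0 -> ed s by case: (ed s).
  split=> //; split; first exact: ok e1.
  - rewrite (edge_word_perm _ (t := [:: f2; nth x0 e 0; nth x0 g 3; nth x0 h 2])); first exact: ok e2.
    by apply/permP => P /=; clear; do 4![move: (nat_of_bool (P _)) => ?]; lia.
  - rewrite (edge_word_perm _ (t := [:: f3; nth x0 e 3; nth x0 g 0; nth x0 h 1])); first exact: ok e3.
    by apply/permP => P /=; clear; do 4![move: (nat_of_bool (P _)) => ?]; lia.
  - rewrite (edge_word_perm _ (t := [:: f4; nth x0 e 2; nth x0 g 1; nth x0 h 0])); first exact: ok e4.
    by apply/permP => P /=; clear; do 4![move: (nat_of_bool (P _)) => ?]; lia.
have m1 := mis f1; have m2 := mis f2; have m3 := mis f3; have m4 := mis f4.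
rewrite !inE !eqxx ?orbT in m1 m2 m3 m4.
rewrite !S3D d1 d2 d3 {1}/S3 !kc.
have := leq_trans b1 (m1 isT); have := leq_trans b2 (m2 isT).
have := leq_trans b3 (m3 isT); have := leq_trans b4 (m4 isT).
rewrite -/(S3 N1) -/(S3 N2) -/(S3 N3) -/(S3 N4); move: lt_mu; clear.
rewrite !expnS expn0; move: (S3 N1) (S3 N2) (S3 N3) (S3 N4) => *; lia.
Qed.

Lemma cube_gap_mono u k d : u + 3 * k ^ 2 < k ^ 3 -> u + 3 * (k + d) ^ 2 < (k + d) ^ 3.
Proof.
have [k_small|k_big] := leqP k 3.
  by move: k k_small => [|[|[|[|k]]]] //=; lia.
rewrite -(subnKC k_big); move: (k - 4) => c; rewrite !expnS !expn0 !muln1.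
move=> h; nia.
Qed.

(** A block that is not an edge is recombined with three blocks of its type. Since every new word
    again has this type, all types remain as frequent as before, and the number of blocks that are
    not edges decreases. *)
Lemma blocks_split mu k0 ws : 4 * mu + 3 * k0 ^ 2 < k0 ^ 3 ->
    uniq (flatten ws) -> (forall w, w \in ws -> size w = 4 /\ right_parity w) ->
    (forall v, v \in flatten ws -> missing v <= mu) ->
    (forall w, w \in ws -> k0 < count_mem (block_type w) (map block_type ws)) ->
  splits H (flatten ws).
Proof.
move=> lt_mu; have [m] := ubnP (count (predC ed) ws); elim: m ws => // m IHm ws.
rewrite ltnS => le_m Uws okws mis freq.
have [all_ed|] := boolP (all ed ws); first by exists ws.
case/allPn=> f fws ned_f; have [sz_f rf] := okws f fws.
pose cl := [seq w <- ws | (block_type w == block_type f) && (w != f)].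
have Uws' : uniq ws by apply: uniq_of_flatten Uws _ => w /okws[]; case: w.
have sz_cl : k0 <= size cl.
  have := freq f fws; rewrite count_map size_filter.
  have -> : count (preim block_type (pred1 (block_type f))) ws =
            count (pred1 f) ws + count (fun w => (block_type w == block_type f) && (w != f)) ws.
    rewrite -count_predUI -[LHS]addn0; congr (_ + _); last first.
      by apply/esym/eqP; rewrite -leqn0 leqNgt -has_count; apply/hasPn => w _ /=; case: (w == f); rewrite ?andbF.
    by apply: eq_count => w /=; case: (eqVneq w f) => [->|nwf]; rewrite ?eqxx ?andbT.
  by rewrite (count_uniq_mem _ Uws') fws.
have clws w : w \in cl -> [/\ w \in ws, block_type w = block_type f & w != f].
  by rewrite mem_filter => /andP[/andP[/eqP tw nw] wws].
have f_dec : exists f1 f2 f3 f4 : V, f = [:: f1; f2; f3; f4].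
  by case: (f) sz_f => [|f1 [|f2 [|f3 [|f4 [|? ?]]]]] // _; exists f1, f2, f3, f4.
case: f_dec => f1 [f2 [f3 [f4 def_f]]].
have [||||||e [g [h [[ecl gcl hcl] [neg ngh neh] [ed1 ed2] [ed3 ed4]]]]] :=
  @recombine f1 f1 f2 f3 f4 cl mu.
- by apply: uniq_flatten_sub Uws _ _ => [|w /clws[]]; rewrite ?filter_uniq.
- by move=> w /clws[/okws[]].
- by rewrite -def_f.
- by move=> w /clws[_ ->]; rewrite def_f.
- move=> v vf; apply: mis; apply/flattenP; exists f => //; by rewrite def_f.
- by rewrite -(subnKC sz_cl); apply: cube_gap_mono.
have [ews te nef] := clws e ecl; have [gws tg ngf] := clws g gcl; have [hws th nhf] := clws h hcl.
have [[sz_e _] [sz_g _] [sz_h _]] := And3 (okws e ews) (okws g gws) (okws h hws).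
set n1 := [:: f1; _; _; _] in ed1; set n2 := [:: _; f2; _; _] in ed2.
set n3 := [:: _; _; f3; _] in ed3; set n4 := [:: _; _; _; f4] in ed4.
pose rest := rem h (rem g (rem e (rem f ws))).
have perm_ws : perm_eq ws [:: f, e, g, h & rest].
  have eR : e \in rem f ws by rewrite (mem_rem_uniq f Uws') inE nef.
  have UR : uniq (rem f ws) by rewrite rem_uniq.
  have gR : g \in rem e (rem f ws).
    by rewrite (mem_rem_uniq e UR) inE eq_sym neg (mem_rem_uniq f Uws') inE ngf.
  have UR' : uniq (rem e (rem f ws)) by rewrite rem_uniq.
  have hR : h \in rem g (rem e (rem f ws)).
    rewrite (mem_rem_uniq g UR') inE eq_sym ngh (mem_rem_uniq e UR) inE eq_sym neh.
    by rewrite (mem_rem_uniq f Uws') inE nhf.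
  apply: perm_trans (perm_to_rem fws) _; rewrite perm_cons.
  apply: perm_trans (perm_to_rem eR) _; rewrite perm_cons.
  by apply: perm_trans (perm_to_rem gR) _; rewrite perm_cons perm_to_rem.
pose ws1 := [:: n1, n2, n3, n4 & rest].
have def4 w : size w = 4 -> w = [:: nth f1 w 0; nth f1 w 1; nth f1 w 2; nth f1 w 3].
  by case: w => [|? [|? [|? [|? [|? ?]]]]].
have perm_fl : perm_eq (flatten ws) (flatten ws1).
  apply: perm_trans (perm_flatten perm_ws) _.
  rewrite -[flatten ws1]/(n1 ++ n2 ++ n3 ++ n4 ++ flatten rest).
  rewrite -[flatten _]/(f ++ e ++ g ++ h ++ flatten rest) !catA perm_cat2r.
  rewrite def_f (def4 e sz_e) (def4 g sz_g) (def4 h sz_h) /n1 /n2 /n3 /n4.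
  by apply/permP => P /=; clear; do 16![move: (nat_of_bool (P _)) => ?]; lia.
have tn : [/\ block_type n1 = block_type f, block_type n2 = block_type f,
  block_type n3 = block_type f & block_type n4 = block_type f].
  have A_of w j : size w = 4 -> block_type w = block_type f -> j < 4 -> (nth f1 w j \in A) = (nth f1 f j \in A).
    by move=> szw tw; apply: block_type_nth.
  by rewrite /block_type /n1 /n2 /n3 /n4 /= !A_of // def_f.
have [t1 t2 t3 t4] := tn.
have perm_ty : perm_eq (map block_type ws) (map block_type ws1).
  apply: perm_trans (perm_map _ perm_ws) _.
  have -> : map block_type ws1 = [:: block_type n1, block_type n2, block_type n3, block_type n4 & map block_type rest] by [].
  have -> : map block_type [:: f, e, g, h & rest] = [:: block_type f, block_type e, block_type g, block_type h & map block_type rest] by [].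
  by rewrite t1 t2 t3 t4 te tg th.
apply: (splits_perm (s := flatten ws1)); first by rewrite perm_sym.
have in1 w : w \in ws1 -> exists2 u, u \in ws & block_type w = block_type u /\ size w = 4.
  rewrite !inE => /or4P[/eqP->|/eqP->|/eqP->|/orP[/eqP->|wr]]; try by exists f; rewrite ?t1 ?t2 ?t3 ?t4.
  exists w; last by split=> //; have [] := okws w; rewrite // (perm_mem perm_ws) !inE wr !orbT.
  by rewrite (perm_mem perm_ws) !inE wr !orbT.
apply: IHm.
- have := permP perm_ws (predC ed).
  rewrite -[count _ [:: f, e, g, h & rest]]/(~~ ed f + (~~ ed e + (~~ ed g + (~~ ed h + count (predC ed) rest)))).
  rewrite -[count _ ws1]/(~~ ed n1 + (~~ ed n2 + (~~ ed n3 + (~~ ed n4 + count (predC ed) rest)))).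
  rewrite ed1 ed2 ed3 ed4 ned_f /= !add0n => cnt; apply: leq_trans le_m; rewrite cnt add1n ltnS.
  by rewrite !addnA leq_addl.
- by rewrite -(perm_uniq perm_fl).
- move=> w /in1[u uws [tw ->]]; split=> //; have [_] := okws u uws.
  by rewrite !right_parity_type tw.
- by move=> v; rewrite -(perm_mem perm_fl); apply: mis.
move=> w /in1[u uws [-> _]]; rewrite -(permP perm_ty); exact: freq.
Qed.
End Recombination.

(** * Perfect matchings of a clean parity structure *)

Section BlockPartition.
Local Open Scope nat_scope.
Variables (V : finType) (A : {set V}).
Implicit Types (s : seq V).

Definition sorted_type i : seq bool := nseq i true ++ nseq (4 - i) false.

Lemma blocks_of_type i k sA sB : i <= 4 -> size sA = k * i -> size sB = k * (4 - i) ->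
    {subset sA <= A} -> {in sB, forall x, x \notin A} ->
  exists ws, [/\ size ws = k, perm_eq (flatten ws) (sA ++ sB) &
    forall w, w \in ws -> size w = 4 /\ block_type A w = sorted_type i].
Proof.
move=> le_i4; elim: k sA sB => [|k IHk] sA sB.
  by rewrite !mul0n => /size0nil-> /size0nil-> _ _; exists [::].
move=> szA szB subA subB.
have [||||ws [sz_ws perm_ws ok_ws]] := IHk (drop i sA) (drop (4 - i) sB).
- by rewrite size_drop szA mulSn addKn.
- by rewrite size_drop szB mulSn addKn.
- by move=> x /mem_drop/subA.
- by move=> x /mem_drop/subB.
exists ((take i sA ++ take (4 - i) sB) :: ws); split; first by rewrite /= sz_ws.
  rewrite /= -catA; apply: perm_trans (_ : perm_eq _ (take i sA ++ take (4 - i) sB ++ drop i sA ++ drop (4 - i) sB)) _.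
    by rewrite !perm_cat2l.
  rewrite -[X in perm_eq _ (X ++ _)](cat_take_drop i sA).
  rewrite -[X in perm_eq _ (_ ++ X)](cat_take_drop (4 - i) sB) -catA perm_cat2l.
  by rewrite perm_catCA.
have tA : size (take i sA) = i by rewrite size_takel // szA mulSn leq_addr.
have tB : size (take (4 - i) sB) = 4 - i by rewrite size_takel // szB mulSn leq_addr.
move=> w; rewrite inE => /predU1P[->|]; last exact: ok_ws.
rewrite size_cat tA tB subnKC //; split=> //; rewrite /block_type map_cat /sorted_type.
congr (_ ++ _).
  rewrite -[in RHS]tA -(size_map (mem A)); apply/all_pred1P/allP => _ /mapP[x /mem_take/subA xA ->].
  exact/eqP.
rewrite -[in RHS]tB -(size_map (mem A)); apply/all_pred1P/allP => _ /mapP[x /mem_take/subB xA ->].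
by rewrite -[pred1 _ _]/((x \in A) == false) (negPf xA).
Qed.

Lemma parity_sorted_type i : i <= 4 -> odd (count id (sorted_type i)) = odd i.
Proof. by move=> le_i; rewrite count_cat !count_nseq mul1n mul0n addn0. Qed.
End BlockPartition.

Section BlockNumbers.
Local Open Scope nat_scope.
Variables (a b z N k0 : nat).
Hypotheses (N_big : 10 * (10 * 10) <= N) (div4 : 4 %| a + b).
Hypotheses (c1 : 32 * k0 <= N) (c2 : 99 * N <= 200 * (a + z)) (c3 : 200 * a <= 101 * N).
Hypotheses (c4 : 100 * z <= N) (c5 : a + b + z = N).

(** Blocks with two letters in [A] and blocks inside one side. The number [k2] of mixed blocks is
    about [N / 16], with the parity that makes the rest of [A] divisible by four. *)
Lemma even_block_numbers : ~~ odd a -> exists k2 p r,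
  [/\ a = k2 * 2 + p * 4, b = k2 * 2 + r * 4, k0 < k2, k0 < p & k0 < r].
Proof.
move=> a_even; have [m abm] : exists m, a + b = 4 * m by exists ((a + b) %/ 4); lia.
have [x ax] : exists x, a = 2 * x by exists (a %/ 2); lia.
have [K [K1 K2]] : exists K, 16 * K <= N /\ N < 16 * K + 16 by exists (N %/ 16); lia.
have [k2 [p [kK Kk xp]]] : exists k2 p, [/\ K <= k2, k2 <= K + 1 & x = k2 + 2 * p].
  exists (K + (x - K) %% 2), ((x - K) %/ 2); split; lia.
by exists k2, p, (m - k2 - p); split; lia.
Qed.

(** Both numbers of blocks are determined by their sum and the size of [A], and the parity condition
    is the integrality of the solution. *)
Lemma odd_block_numbers : odd a = odd ((a + b) %/ 4) -> exists k3 k1,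
  [/\ a = k3 * 3 + k1 * 1, b = k3 * 1 + k1 * 3, k0 < k3 & k0 < k1].
Proof.
have [m abm] : exists m, a + b = 4 * m by exists ((a + b) %/ 4); lia.
rewrite abm mulKn // => par.
have le_ma : m <= a by lia.
have [k3 k3E] : exists k3, a = m + 2 * k3 by exists ((a - m) %/ 2); lia.
by exists k3, (m - k3); split; lia.
Qed.
End BlockNumbers.

Section ExtremalMatching.
Local Open Scope nat_scope.
Variables (V : finType) (H : {set {set V}}) (A : {set V}) (sigma : bool).
Local Notation ed := (edge_word H).
Local Notation n := #|V|.
Hypothesis Hunif : uniform 4 H.

(** Each part is a list of blocks with the same number of letters in [A], and long enough for
    [blocks_split]. *)
Lemma matching_from_blocks mu k0 (Z : {set V}) (parts : seq (nat * seq (seq V))) :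
    4 * mu + 3 * k0 ^ 2 < k0 ^ 3 ->
    (forall v, v \notin Z -> missing H A sigma v <= mu) ->
    (forall p, p \in parts -> [/\ p.1 <= 4, odd p.1 = sigma, k0 < size p.2 &
       forall w, w \in p.2 -> size w = 4 /\ block_type A w = sorted_type p.1]) ->
    perm_eq (flatten (flatten [seq p.2 | p <- parts])) (enum (~: Z)) ->
  exists2 M, matching H M & cover M = ~: Z.
Proof.
move=> lt_mu mis ok perm_fl; set ws := flatten [seq p.2 | p <- parts] in perm_fl.
have Uws : uniq (flatten ws) by rewrite (perm_uniq perm_fl) enum_uniq.
have wsP w : w \in ws -> exists2 p, p \in parts & w \in p.2.
  by case/flattenP => _ /mapP[p pp ->] wp; exists p.
have sp : splits H (flatten ws).
  apply: (@blocks_split V H A sigma mu k0) => //.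
  - move=> w /wsP[p /ok[le4 par _ okp] /okp[sz_w tw]]; split=> //.
    by rewrite right_parity_type tw parity_sorted_type // par.
  - by move=> v; rewrite (perm_mem perm_fl) mem_enum inE; apply: mis.
  move=> w /wsP[p pp wp]; have [le4 _ big okp] := ok p pp.
  apply: leq_trans big _; have [_ ->] := okp w wp.
  have -> : size p.2 = count_mem (sorted_type p.1) (map (block_type A) p.2).
    apply/esym; rewrite count_map; apply/eqP; rewrite -all_count.
    by apply/allP => u /okp[_ /eqP].
  rewrite /ws; elim: (parts) pp => //= q ps IHps; rewrite inE map_cat count_cat.
  by case/predU1P=> [<-|/IHps le]; [exact: leq_addr | apply: leq_trans le (leq_addl _ _)].
have [M mM cM] := splits_matching Hunif sp Uws.
by exists M => //; rewrite cM; apply/setP=> x; rewrite !inE (perm_mem perm_fl) mem_enum inE.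
Qed.

(** When almost all edges of the right parity are present at every vertex, only divisibility
    matters: the complement of [Z] is cut into blocks of the types [2], [4], [0], or of the types
    [3], [1], according to the parity. *)
Lemma extremal_matching l (Z : {set V}) :
    8 * (64 * (64 * 64)) <= l -> 10 * (10 * 10) <= n -> 4 %| #|~: Z| ->
    odd #|A :\: Z| = sigma && odd (#|~: Z| %/ 4) ->
    100 * #|Z| <= n -> 200 * #|A| <= 101 * n -> 99 * n <= 200 * #|A| ->
    (forall v, v \notin Z -> missing H A sigma v * l <= n ^ 3) ->
  exists2 M, matching H M & cover M = ~: Z.
Proof.
move=> l_big n_big div4 par leZ leA geA mis.
pose sA := enum (A :\: Z); pose sB := enum (~: Z :\: A).
have subA : {subset sA <= A} by move=> x; rewrite mem_enum inE => /andP[].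
have subB : {in sB, forall x, x \notin A} by move=> x; rewrite mem_enum inE => /andP[].
have perm_AB : perm_eq (sA ++ sB) (enum (~: Z)).
  apply: uniq_perm; rewrite ?enum_uniq //.
    rewrite cat_uniq !enum_uniq andbT /=; apply/hasPn => x /subB xA; apply/negP=> /subA.
    by rewrite (negPf xA).
  by move=> x; rewrite mem_cat !mem_enum !inE; case: (x \in A); case: (x \in Z).
set a := #|A :\: Z| in par; pose b := #|~: Z :\: A|.
have szA : size sA = a by rewrite -cardE.
have szB : size sB = b by rewrite -cardE.
have ab : a + b = #|~: Z| by have := perm_size perm_AB; rewrite size_cat szA szB -cardE.
have cZ : #|Z| + #|~: Z| = n by rewrite cardsC.
have le_a : a <= #|A| by apply: subset_leq_card; exact: subsetDl.
have ge_a : #|A| <= a + #|Z|.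
  by rewrite -(cardsID Z A) addnC leq_add2l subset_leq_card // subsetIr.
pose k0 := n %/ 32.
have k0_le : 32 * k0 <= n by rewrite mulnC leq_trunc_div.
have k0_ge : n < 32 * k0 + 32 by have := ltn_ceil n (isT : 0 < 32); rewrite -/k0; lia.
pose mu := n ^ 3 %/ l.
have lt_mu : 4 * mu + 3 * k0 ^ 2 < k0 ^ 3.
  have h1 : mu * l <= n ^ 3 by exact: leq_trunc_div.
  have h2 : n <= 64 * k0 by move: k0_ge n_big; clear; lia.
  have h3 : n ^ 3 <= (64 * (64 * 64)) * k0 ^ 3.
    have -> : (64 * (64 * 64)) * k0 ^ 3 = (64 * k0) ^ 3 by rewrite expnMn.
    by rewrite leq_exp2r.
  have h4 : mu * (8 * (64 * (64 * 64))) <= (64 * (64 * 64)) * k0 ^ 3.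
    by apply: leq_trans h3; apply: leq_trans h1; rewrite leq_mul2l l_big orbT.
  have h5 : mu * 8 <= k0 ^ 3.
    by rewrite -(@leq_pmul2l (64 * (64 * 64))) // mulnCA [_ * 8]mulnC.
  have h6 : 8 <= k0 by move: k0_ge n_big; clear; lia.
  have h7 := leq_mul h6 (leqnn (k0 ^ 2)); rewrite -expnS in h7.
  have h8 : 0 < k0 ^ 2 by rewrite expn_gt0 (leq_trans _ h6).
  by move: h5 h7 h8; clear; move: (k0 ^ 3) (k0 ^ 2) => u v; lia.
have mis' v : v \notin Z -> missing H A sigma v <= mu.
  by move=> vZ; rewrite leq_divRL ?mis // (leq_trans _ l_big).
have bounds : [/\ 32 * k0 <= n, 99 * n <= 200 * (a + #|Z|), 200 * a <= 101 * n, 100 * #|Z| <= n & a + b + #|Z| = n].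
  split=> //; last by rewrite ab addnC.
  - by apply: leq_trans geA _; rewrite leq_mul2l.
  - by apply: leq_trans leA; rewrite leq_mul2l.
have [c1 c2 c3 c4 c5] := bounds; rewrite -ab in div4 par.
have tk (s : seq V) i x y : size s = x + y -> i = x -> size (take i s) = x /\ size (drop i s) = y.
  by move=> sz ->; rewrite size_takel ?size_drop sz ?leq_addr // addKn.
have tsub (s : seq V) i : {subset take i s <= s} /\ {subset drop i s <= s}.
  by split=> x; [exact: mem_take | exact: mem_drop].
move: par; case def_sig: sigma => /= par.
- have [k3 [k1 [aE bE k3_big k1_big]]] := odd_block_numbers n_big div4 c1 c2 c3 c4 c5 par.
  have [tA dA] := tk sA (k3 * 3) _ _ (etrans szA aE) erefl.
  have [tB dB] := tk sB (k3 * 1) _ _ (etrans szB bE) erefl.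
  have [tAs dAs] := tsub sA (k3 * 3); have [tBs dBs] := tsub sB (k3 * 1).
  have [||ws3 [sz3 p3 ok3]] := @blocks_of_type V A 3 k3 _ _ isT tA tB.
  + by move=> x /tAs/subA.
  + by move=> x /tBs/subB.
  have [||ws1 [sz1 p1 ok1]] := @blocks_of_type V A 1 k1 _ _ isT dA dB.
  + by move=> x /dAs/subA.
  + by move=> x /dBs/subB.
  apply: (@matching_from_blocks mu k0 Z [:: (3, ws3); (1, ws1)] lt_mu mis') => [p|].
    rewrite !inE => /orP[] /eqP-> /=; rewrite ?sz3 ?sz1 def_sig; split=> //.
  apply: perm_trans perm_AB; rewrite /= cats0 flatten_cat.
  apply: perm_trans (perm_cat p3 p1) _.
  rewrite -[X in perm_eq _ (X ++ _)](cat_take_drop (k3 * 3) sA).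
  by rewrite -[X in perm_eq _ (_ ++ X)](cat_take_drop (k3 * 1) sB) -!catA perm_cat2l perm_catCA.
have [k2 [p [r [aE bE k2_big p_big r_big]]]] := even_block_numbers n_big div4 c1 c2 c3 c4 c5 (negbT par).
have [tA dA] := tk sA (k2 * 2) _ _ (etrans szA aE) erefl.
have [tB dB] := tk sB (k2 * 2) _ _ (etrans szB bE) erefl.
have [tAs dAs] := tsub sA (k2 * 2); have [tBs dBs] := tsub sB (k2 * 2).
have [||ws2 [sz2 p2 ok2]] := @blocks_of_type V A 2 k2 _ _ isT tA tB.
- by move=> x /tAs/subA.
- by move=> x /tBs/subB.
have [|||ws4 [sz4 p4 ok4]] := @blocks_of_type V A 4 p _ [::] isT dA.
- by rewrite muln0.
- by move=> x /dAs/subA.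
- by [].
have [|||ws0 [sz0 p0 ok0]] := @blocks_of_type V A 0 r [::] _ isT _ dB.
- by rewrite muln0.
- by [].
- by move=> x /dBs/subB.
apply: (@matching_from_blocks mu k0 Z [:: (2, ws2); (4, ws4); (0, ws0)] lt_mu mis') => [q|].
  rewrite !inE => /or3P[] /eqP-> /=; rewrite ?sz2 ?sz4 ?sz0 def_sig; split=> //.
apply: perm_trans perm_AB; rewrite /= cats0 !flatten_cat.
apply: perm_trans (perm_cat p2 (perm_cat p4 p0)) _; rewrite cats0 /=.
rewrite -[X in perm_eq _ (X ++ _)](cat_take_drop (k2 * 2) sA).
by rewrite -[X in perm_eq _ (_ ++ X)](cat_take_drop (k2 * 2) sB) -!catA perm_cat2l perm_catCA.
Qed.
End ExtremalMatching.

(** * Relocating the badly placed vertices *)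

Section ParityCount.
Local Open Scope nat_scope.
Variables (V : finType) (A : {set V}).
Local Notation n := #|V|.

Definition parity_words m tau : nat := wcount m (fun s => odd (count (mem A) s) == tau).

Lemma parity_wordsS m tau :
  parity_words m.+1 tau = #|A| * parity_words m (~~ tau) + #|~: A| * parity_words m tau.
Proof.
rewrite {1}/parity_words /wcount /= -!sum_mem !big_distrl -big_split; apply: eq_bigr => x _.
rewrite /= inE; case: (boolP (x \in A)) => xA /=; rewrite ?mul1n ?mul0n ?addn0 ?add0n.
  by apply: eq_wsum => s _; rewrite !asboolb add0n; case: (odd _); case: tau.
by apply: eq_wsum => s _; rewrite !asboolb.
Qed.

(** The difference between the numbers of even and odd words is the fourth power of the difference
    of the sizes of the two sides. *)
Lemma parity_words4 tau d : #|A| = #|~: A| + d \/ #|~: A| = #|A| + d ->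
  2 * parity_words 4 tau <= n ^ 4 + d ^ 4.
Proof.
rewrite -(cardsC A) => dE; rewrite !parity_wordsS /parity_words /wcount /= !asboolb.
have two (x y : nat) (H : x = y + d) : (x + y) ^ 4 + d ^ 4 = 2 * (x ^ 4 + 6 * (x ^ 2 * y ^ 2) + y ^ 4) /\
    (x + y) ^ 4 = 2 * (4 * x ^ 3 * y + 4 * x * y ^ 3) + d ^ 4.
  by rewrite H !expnS !expn0; split; lia.
have [h1 h2] : (#|A| + #|~: A|) ^ 4 + d ^ 4 = 2 * (#|A| ^ 4 + 6 * (#|A| ^ 2 * #|~: A| ^ 2) + #|~: A| ^ 4) /\
    (#|A| + #|~: A|) ^ 4 = 2 * (4 * #|A| ^ 3 * #|~: A| + 4 * #|A| * #|~: A| ^ 3) + d ^ 4.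
  case: dE => /two //; rewrite [#|~: A| + _]addnC => -[-> ->]; move: (#|A|) #|~: A| => x y.
  by rewrite !expnS !expn0; split; lia.
case: tau => /=.
  apply: (@leq_trans ((#|A| + #|~: A|) ^ 4)); last exact: leq_addr.
  rewrite h2; apply: leq_trans (leq_addr _ _); rewrite leq_eqVlt; apply/orP; left; apply/eqP.
  by clear; move: #|A| #|~: A| => x y; rewrite !expnS !expn0; lia.
rewrite h1 leq_eqVlt; apply/orP; left; apply/eqP.
by clear; move: #|A| #|~: A| => x y; rewrite !expnS !expn0; lia.
Qed.
End ParityCount.

Section Relocation.
Local Open Scope nat_scope.
Variables (V : finType) (H : {set {set V}}) (A0 : {set V}) (sigma : bool).
Local Notation ed := (edge_word H).
Local Notation n := #|V|.
Hypothesis deg : large_codegrees H.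

Lemma sum_missing_total : \sum_v missing H A0 sigma v + edge_total H <=
  parity_words A0 4 sigma + wrong_edges H A0 sigma.
Proof.
rewrite -wcount4_edges /parity_words /wrong_edges.
have -> : \sum_v missing H A0 sigma v = wcount 4 (fun s => right_parity A0 sigma s && ~~ ed s).
  by apply: eq_bigr => v _.
rewrite /wcount -!wsum_add; apply: leq_wsum => s _; rewrite !asboolb /right_parity.
by case: (ed s); case: (_ == sigma).
Qed.

Lemma sum_missing_le l d : 0 < l -> 7 * l <= n -> wrong_edges H A0 sigma * l <= n ^ 4 ->
    d * l <= n -> #|A0| = #|~: A0| + d \/ #|~: A0| = #|A0| + d ->
  l * \sum_v missing H A0 sigma v <= 2 * n ^ 4.
Proof.
move=> l0 n_big lew led dE; have h1 := parity_words4 sigma dE.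
have h2 := edge_total_lb deg; have h3 := sum_missing_total.
have h4 : d ^ 4 * l <= n ^ 4.
  have ledn : d <= n by apply: leq_trans led; rewrite leq_pmulr.
  by rewrite !expnS !expn0 !muln1 -!mulnA; do 3!(apply: leq_mul => //).
have h5 : 7 * l * n ^ 3 <= n ^ 4 by rewrite [n ^ 4]expnS leq_mul2r n_big orbT.
move: h1 h2 h3 h4 h5 lew; clear.
move: (n ^ 4) (n ^ 3) (d ^ 4) (edge_total H) (parity_words _ _ _) (wrong_edges _ _ _) (\sum_v _) => N4 N3 D E P W S.
move=> h1 h2 h3 h4 h5 h6.
have k : 2 * S <= D + 7 * N3 + 2 * W by lia.
have := leq_mul (leqnn l) k; lia.
Qed.

Definition bad_set L1 : {set V} := [set v | n ^ 3 < L1 * missing H A0 sigma v].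

(** Almost half of all words are edges and almost all of these have the right parity, which also has
    about half of all words. So few words of the right parity are missing in total, and few vertices
    miss many. *)
Lemma bad_set_small l d L1 L2 : 0 < n -> 0 < L1 -> 0 < L2 -> l = 2 * L1 * L2 -> 7 * l <= n ->
    wrong_edges H A0 sigma * l <= n ^ 4 -> d * l <= n -> #|A0| = #|~: A0| + d \/ #|~: A0| = #|A0| + d ->
  #|bad_set L1| * L2 <= n.
Proof.
move=> n0 L10 L20 lE n_big lew led dE.
have l0 : 0 < l by rewrite lE !muln_gt0 L10.
have h := sum_missing_le l0 n_big lew led dE.
have h1 : #|bad_set L1| * n ^ 3 <= L1 * \sum_v missing H A0 sigma v.
  rewrite -sum_mem big_distrl big_distrr; apply: leq_sum => v _ /=.
  by case: (boolP (v \in bad_set L1)); rewrite ?mul0n // mul1n inE => /ltnW.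
have n3 : 0 < n ^ 3 by rewrite expn_gt0 n0.
have L21 : 0 < 2 * L1 by rewrite muln_gt0.
have h2 : 2 * L1 * (#|bad_set L1| * L2 * n ^ 3) <= 2 * L1 * (n * n ^ 3).
  have k1 := leq_mul (leqnn (2 * L1 * L2)) h1; have k2 := leq_mul (leqnn L1) h.
  rewrite lE [n ^ 4]expnS in k2; move: k1 k2; clear.
  by move: (n ^ 3) (#|V|) (#|_|) (\sum_v _) => N3 N x S; lia.
by move: h2; rewrite leq_pmul2l // leq_pmul2r.
Qed.

Variable L1 : nat.
Local Notation X := (bad_set L1).

(** A bad vertex joins the side on which it has more right edges; edges that meet further bad
    vertices are too few to matter. *)
Definition relocated : {set V} := [set v | if v \in X
  then wcount 3 (fun s => ed (v :: s) && right_parity A0 sigma s)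
     <= wcount 3 (fun s => ed (v :: s) && ~~ right_parity A0 sigma s)
  else v \in A0].
Local Notation A := relocated.

Lemma relocated_count s : ~~ has (mem X) s -> count (mem A) s = count (mem A0) s.
Proof.
move=> /hasPn sX; apply: eq_in_count => x /sX xX.
suff : (x \in A) = (x \in A0) by [].
by rewrite inE ifN.
Qed.

Definition touching : nat := wcount 3 (fun s => ~~ (uniq s && ~~ has (mem X) s)).

Lemma touching_le : 0 < n -> touching <= 3 * (3 + #|X|) * n ^ 2.
Proof.
move=> n0; have := wcount_not_fresh 3 X; rewrite -/touching => h.
by rewrite -(leq_pmul2l n0); apply: leq_trans h _; rewrite [n ^ 3]expnS mulnCA.
Qed.

(** A triple that avoids the bad vertices keeps its parity, so each edge through [v] is right for
    one of the two sides that [v] may join. *)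
Lemma link_size_relocated v : v \in X ->
  link_size H v <= 2 * (wcount 3 (fun s => right_parity A sigma (v :: s) && ed (v :: s)) + touching).
Proof.
move=> vX; set g0 := wcount 3 (fun s => ed (v :: s) && right_parity A0 sigma s).
set g1 := wcount 3 (fun s => ed (v :: s) && ~~ right_parity A0 sigma s).
have -> : link_size H v = g0 + g1.
  rewrite -wsum_add; apply: eq_wsum => s _; rewrite !asboolb.
  by case: (ed _); case: (right_parity _ _ _).
suff h : (if g0 <= g1 then g1 else g0) <=
    wcount 3 (fun s => right_parity A sigma (v :: s) && ed (v :: s)) + touching.
  apply: leq_trans (_ : 2 * (if g0 <= g1 then g1 else g0) <= _); last by rewrite leq_mul2l h orbT.
  by case: (leqP g0 g1); lia.
have vA : (v \in A) = (g0 <= g1) by rewrite inE vX.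
have pt s : right_parity A sigma (v :: s) = (if g0 <= g1 then ~~ right_parity A sigma s else right_parity A sigma s).
  have e : count (mem A) (v :: s) = (g0 <= g1) + count (mem A) s by rewrite -vA.
  rewrite /right_parity e oddD.
  by case: (g0 <= g1) => /=; case: (odd _); case: sigma.
have ptX s : ~~ has (mem X) s -> right_parity A sigma s = right_parity A0 sigma s.
  by move=> sX; rewrite /right_parity relocated_count.
rewrite /touching -wsum_add (_ : (if _ then _ else _) =
   wcount 3 (fun s => ed (v :: s) && (if g0 <= g1 then ~~ right_parity A0 sigma s else right_parity A0 sigma s))).
  apply: leq_wsum => s _; rewrite !asboolb pt.
  by case: (boolP (has _ s)) => [|sX]; [rewrite andbF; case: (_ && _); case: (_ && _) | rewrite ptX // andbC leq_addr].
by case: ifP.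
Qed.

Lemma missing_relocated v : v \notin X -> missing H A sigma v <= missing H A0 sigma v + touching.
Proof.
move=> vX; rewrite /missing /touching -wsum_add; apply: leq_wsum => s _; rewrite !asboolb.
case: (boolP (has _ s)) => [|sX]; first by rewrite andbF addn1; case: (_ && _).
by rewrite /right_parity relocated_count ?leq_addr //= negb_or vX.
Qed.

Lemma card_relocated : #|A0| <= #|A| + #|X| /\ #|A| <= #|A0| + #|X|.
Proof.
have h (P Q : {set V}) : P :\: X = Q :\: X -> #|P| <= #|Q| + #|X|.
  move=> e; rewrite -(cardsID X P) e addnC leq_add //.
    by rewrite subset_leq_card // subsetDl.
  by rewrite subset_leq_card // subsetIr.
have e : A :\: X = A0 :\: X.
  by apply/setP=> x; rewrite !inE; case: (n ^ 3 < _).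
by split; apply: h.
Qed.
End Relocation.

(** * Perfect matchings near a parity hypergraph *)

Section GreedyCover.
Local Open Scope nat_scope.
Variables (V : finType) (H : {set {set V}}) (A : {set V}) (sigma : bool).
Local Notation ed := (edge_word H).
Local Notation n := #|V|.
Local Notation right := (right_parity A sigma).
Hypothesis Hunif : uniform 4 H.

Definition right_degree v : nat := wcount 3 (fun s => right (v :: s) && ed (v :: s)).

(** Each of the vertices in turn has a positive proportion of right triples, and only a small
    proportion of the triples meets the vertices used before. *)
Lemma greedy_cover (xs : seq V) (Z0 : {set V}) :
    (forall x, x \in xs -> n ^ 3 <= 8 * right_degree x) ->
    24 * (3 + #|Z0| + 4 * size xs) < n ->
  exists es, [/\ all ed es /\ all right es, uniq (flatten es), {in flatten es, forall x, x \notin Z0},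
    {in xs, forall x, (x \in Z0) || (x \in flatten es)} & size es <= size xs].
Proof.
elim: xs Z0 => [|x xs IHxs] Z0 rich small; first by exists [::]; split.
have rich' y : y \in xs -> n ^ 3 <= 8 * right_degree y by move=> yxs; apply: rich; rewrite inE yxs orbT.
have [xZ|xZ] := boolP (x \in Z0).
  have [|es [ok Ues out cov sz]] := IHxs Z0 rich'; first by move: small => /=; lia.
  exists es; split=> //; last exact: leqW.
  by move=> y; rewrite inE => /predU1P[->|/cov //]; rewrite xZ.
have n0 : 0 < n by apply: leq_ltn_trans small.
have [s sz_s [rs es sZ]] : exists2 s, size s = 3 & [/\ right (x :: s), ed (x :: s) & ~~ has (mem Z0) s].
  apply: contrapT => none.
  have le_bad : right_degree x <= wcount 3 (fun s => ~~ (uniq s && ~~ has (mem Z0) s)).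
    apply: leq_wcount => s sz_s /andP[rs es]; rewrite negb_and negbK; apply/orP; right.
    by apply: contrapT => /negP sZ; apply: none; exists s.
  have := wcount_not_fresh 3 Z0; have := rich x (mem_head _ _) => h1 h2.
  have h3 := leq_mul (leqnn n) (leq_trans h1 (leq_mul (leqnn 8) le_bad)).
  have n3 : 0 < n ^ 3 by rewrite expn_gt0 n0.
  have h4 : n * n ^ 3 <= 24 * (3 + #|Z0|) * n ^ 3.
    by move: h2 h3; clear; move: (n ^ 3) (n * _) (wcount _ _) => N3 *; lia.
  by move: h4; rewrite leq_pmul2r // leqNgt; apply/negP/negPn; move: small => /=; lia.
pose Z1 := Z0 :|: [set y in x :: s].
have leZ1 : #|Z1| <= #|Z0| + 4.
  apply: leq_trans (leq_card_setU _ _) _; rewrite leq_add2l cardsE.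
  by apply: leq_trans (card_size _) _; rewrite /= sz_s.
have [|es' [[ok1 ok2] Ues out cov sz]] := IHxs Z1 rich'; first by move: small leZ1 => /=; lia.
have outZ0 y : y \in flatten es' -> y \notin Z0 /\ y \notin x :: s.
  by move=> /out; rewrite in_setU in_set negb_or => /andP[].
have fl : flatten ((x :: s) :: es') = (x :: s) ++ flatten es' by [].
exists ((x :: s) :: es'); split.
- by split; apply/andP.
- rewrite fl cat_uniq (edge_word_uniq Hunif es) Ues andbT /=.
  by apply/hasPn => y /outZ0[].
- move=> y; rewrite fl mem_cat => /orP[|/outZ0[]//].
  by rewrite inE => /predU1P[-> //|ys]; move/hasPn: sZ => /(_ y ys).
- move=> y; rewrite fl mem_cat => yxs.
  have [->|nyx] := eqVneq y x; first by rewrite mem_head orbT.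
  move: yxs; rewrite inE (negPf nyx) /= => /cov; rewrite in_setU in_set => /orP[/orP[->//|->]|->].
    by rewrite orbT.
  by rewrite !orbT.
by rewrite /= ltnS.
Qed.

Lemma odd_count_right es : all right es -> odd (count (mem A) (flatten es)) = sigma && odd (size es).
Proof.
elim: es => [|w es IHes] /=; first by rewrite andbF.
case/andP=> /eqP rw /IHes IH; rewrite count_cat oddD rw IH.
by case: sigma; case: (odd _).
Qed.

Lemma card_setI_seq (s : seq V) : uniq s -> #|A :&: [set x in s]| = count (mem A) s.
Proof.
move=> Us; rewrite -size_filter -(card_uniqP (filter_uniq _ Us)); apply: eq_card => x.
by rewrite !inE mem_filter.
Qed.
End GreedyCover.

Section ExtremalCase.
Local Open Scope nat_scope.

(** No nearly balanced parity hypergraph contains [H]. This is what the exact threshold provides. *)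
Definition both_parities (V : finType) (H : {set {set V}}) : Prop :=
  forall (A : {set V}) sigma, 99 * #|V| <= 200 * #|A| -> 200 * #|A| <= 101 * #|V| ->
    exists s, edge_word H s && ~~ right_parity A sigma s.

(** After relocation, every vertex outside the bad set misses few right edges and every bad vertex
    has many right edges. The parity condition of [extremal_matching] may fail for [A] itself; a
    single edge of the wrong parity then restores it. Removing this edge and right edges covering
    the bad vertices leaves a set to which [extremal_matching] applies. *)
Lemma extremal_perfect_matching : exists l n0 : nat, forall (V : finType) (H : {set {set V}}),
    uniform 4 H -> n0 <= #|V| -> 4 %| #|V| ->
    large_codegrees H -> both_parities H ->
    forall (A0 : {set V}) sigma, wrong_edges H A0 sigma * l <= #|V| ^ 4 ->
    2 * #|A0| * l <= #|V| * l + #|V| -> #|V| * l <= 2 * #|A0| * l + #|V| ->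
  has_perfect_matching H.
Proof.
have [l' l'E] : exists l', l' = 8 * (64 * (64 * 64)) by eexists.
have l'0 : 0 < l' by rewrite l'E.
(* Good vertices miss a proportion [1 / L1] of the right triples, and relocation costs another [1 /
   L1] of all triples; together this is the bound [1 / l'] required from [extremal_matching]. The
   bad set has size at most [n / L2], small enough for these costs. *)
pose L1 := 2 * l'; pose L2 := 12 * l' + 20 * (10 * 10); pose l := 2 * L1 * L2.
have L10 : 0 < L1 by rewrite muln_gt0.
have L2big : 20 * (10 * 10) <= L2 by exact: leq_addl.
have L20 : 0 < L2 by apply: leq_trans L2big.
have lbig : 20 * (10 * 10) <= l by apply: leq_trans L2big _; rewrite leq_pmull // muln_gt0 L10.
have l0 : 0 < l by apply: leq_trans lbig.
exists l, (7 * l + 36 * l' + 10 * (10 * 10)) => V H Hunif n_big div4 deg breaking A0 sigma lew le1 le2.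
have n_big1 : 7 * l <= #|V| by apply: leq_trans n_big; rewrite -addnA leq_addr.
have n_big2 : 36 * l' <= #|V| by apply: leq_trans n_big; rewrite addnAC leq_addl.
have n_big3 : 10 * (10 * 10) <= #|V| by apply: leq_trans n_big; rewrite leq_addl.
have n0 : 0 < #|V| by apply: leq_trans n_big3.
have [d dE led] : exists2 d, #|A0| = #|~: A0| + d \/ #|~: A0| = #|A0| + d & d * l <= #|V|.
  have cA := cardsC A0; case: (leqP #|~: A0| #|A0|) => le_A.
    exists (#|A0| - #|~: A0|); first by left; rewrite subnKC.
    by rewrite mulnBl leq_subLR; move: le1; rewrite -cA; clear; move: #|A0| #|~: A0| => x y; lia.
  exists (#|~: A0| - #|A0|); first by right; rewrite subnKC // ltnW.
  by rewrite mulnBl leq_subLR; move: le2; rewrite -cA; clear; move: #|A0| #|~: A0| => x y; lia.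
have leX := bad_set_small deg n0 L10 L20 erefl n_big1 lew led dE.
set X := bad_set H A0 sigma L1 in leX; pose A := relocated H A0 sigma L1.
have t_le := touching_le H A0 sigma L1 n0; rewrite -/X in t_le.
set t := touching H A0 sigma L1 in t_le.
have X2000 : 20 * (10 * 10) * #|X| <= #|V| by apply: leq_trans leX; rewrite mulnC leq_mul2l L2big orbT.
have Xl' : 12 * l' * #|X| <= #|V| by apply: leq_trans leX; rewrite mulnC leq_mul2l leq_addr orbT.
have missA v : v \notin X -> missing H A sigma v * l' <= #|V| ^ 3.
  move=> vX; have h1 := missing_relocated vX; rewrite -/A -/t in h1.
  have h2 : L1 * missing H A0 sigma v <= #|V| ^ 3 by move: vX; rewrite inE -leqNgt.
  have h3 : 2 * (l' * t) <= #|V| ^ 3.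
    have h4 := leq_mul (leqnn (2 * l')) t_le.
    rewrite mulnA; apply: leq_trans h4 _; rewrite mulnA [#|V| ^ 3]expnS leq_mul2r; apply/orP; right.
    by move: Xl' n_big2; clear; move: (#|X|) (#|V|) => x k; lia.
  have h5 := leq_mul h1 (leqnn (2 * l')); move: h5 h2 h3; rewrite /L1; clear.
  by move: (missing H A sigma v) (missing H A0 sigma v) (_ ^ 3) => m m0 N3; lia.
have rich v : v \in X -> #|V| ^ 3 <= 8 * right_degree H A sigma v.
  move=> vX; have := link_size_relocated vX; rewrite -/A -/t -/(right_degree H A sigma v) => h1.
  have h2 := link_size_lb deg v; have h3 := leq_mul (leqnn 8) t_le.
  have h4 : (14 + 24 * (3 + #|X|)) * #|V| ^ 2 <= #|V| ^ 3.
    rewrite [#|V| ^ 3]expnS leq_mul2r; apply/orP; right.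
    by move: X2000 n_big3; clear; move: (#|X|) (#|V|) => x k; lia.
  move: h1 h2 h3 h4; clear.
  move: (link_size H v) (right_degree _ _ _ _) (#|V| ^ 3) (#|V| ^ 2) (#|X|) => L R N3 N2 x; lia.
have [geA leA] : 99 * #|V| <= 200 * #|A| /\ 200 * #|A| <= 101 * #|V|.
  have [c1 c2] := card_relocated H A0 sigma L1; rewrite -/A -/X in c1 c2.
  have ld : d * (20 * (10 * 10)) <= #|V| by apply: leq_trans led; rewrite leq_mul2l lbig orbT.
  have cA := cardsC A0; move: c1 c2 ld X2000 cA dE; clear.
  by move: #|A0| #|~: A0| (#|A|) (#|X|) (#|V|) => a0 a0' a x k; lia.
(* The correcting edge, when one is needed. Right edges change both sides of the parity condition
   equally. *)
have [ws0 [ed0 U0 sz0 par0]] : exists ws0, [/\ all (edge_word H) ws0, uniq (flatten ws0), size ws0 <= 1 &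
    odd (#|A| + count (mem A) (flatten ws0)) = sigma && (odd (#|V| %/ 4) (+) odd (size ws0))].
  have [eq_par|] := eqVneq (odd #|A|) (sigma && odd (#|V| %/ 4)).
    by exists [::]; split=> //=; rewrite addn0 addbF.
  move=> bad; have [s /andP[ed_s wrong]] := breaking A sigma geA leA.
  exists [:: s]; split=> //=; rewrite ?ed_s ?cats0 //; first exact: (edge_word_uniq Hunif ed_s).
  rewrite oddD; move: bad wrong; rewrite /right_parity.
  by case: (odd #|A|); case: (odd (count _ _)); case: (sigma); case: (odd (_ %/ 4)).
pose Z0 := [set x in flatten ws0].
have size_fl ws : all (edge_word H) ws -> size (flatten ws) = 4 * size ws.
  elim: ws => //= w ws IH /andP[/andP[/eqP sz_w _] /IH sz]; rewrite size_cat sz sz_w mulnS //.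
have leZ0 : #|Z0| <= 4.
  by rewrite cardsE; apply: leq_trans (card_size _) _; rewrite size_fl //; lia.
have [||es [[ed1 right1] U1 out1 cov1 sz1]] := @greedy_cover V H A sigma Hunif (enum X) Z0.
- by move=> x; rewrite mem_enum; apply: rich.
- rewrite -cardE; move: leZ0 X2000 n_big3; clear; move: #|Z0| (#|X|) (#|V|) => *; lia.
pose ws := ws0 ++ es; have ed_ws : all (edge_word H) ws by rewrite all_cat ed0.
have Uws : uniq (flatten ws).
  rewrite flatten_cat cat_uniq U0 U1 andbT /=; apply/hasPn => x /out1; by rewrite in_set.
have [M1 [mM1 cM1 _]] := words_matching Hunif ed_ws Uws.
pose Z := [set x in flatten ws]; have cZ : #|Z| = 4 * size ws.
  by rewrite cardsE -(size_fl _ ed_ws); apply/card_uniqP.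
have sz_ws : size ws <= 1 + #|X| by rewrite size_cat leq_add // (leq_trans sz1) -?cardE.
have cZC : #|Z| + #|~: Z| = #|V| by rewrite cardsC.
have XZ v : v \notin Z -> v \notin X.
  apply: contra => vX; rewrite in_set flatten_cat mem_cat.
  by have := cov1 v; rewrite mem_enum => /(_ vX); rewrite [v \in Z0]in_set.
have l_ok : 8 * (64 * (64 * 64)) <= l' by rewrite -l'E.
have [||||M2 mM2 cM2] := @extremal_matching V H A sigma Hunif l' Z l_ok n_big3 _ _ _ leA geA.
- by rewrite -(@dvdn_addr #|Z|) ?cZC // cZ dvdn_mulr.
- have [m mE] : exists m, #|V| = 4 * m by case/dvdnP: div4 => m ->; exists m; rewrite mulnC.
  have leZm : size ws <= m by move: cZC; rewrite cZ mE; clear; lia.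
  have -> : #|~: Z| %/ 4 = m - size ws.
    have -> : #|~: Z| = 4 * (m - size ws) by move: cZC; rewrite cZ mE; clear; lia.
    by rewrite mulKn.
  rewrite mE mulKn // in par0.
  have oddAZ : odd #|A :\: Z| = odd #|A| (+) odd (count (mem A) (flatten ws)).
    by rewrite -(card_setI_seq A Uws) -(cardsID Z A) oddD addbAC addbb addFb.
  rewrite oddAZ flatten_cat count_cat oddD (odd_count_right right1) addbA -oddD par0.
  by rewrite oddB // size_cat oddD; case: (sigma) => //=; rewrite addbA.
- by move: sz_ws X2000 n_big3; rewrite cZ; clear; move: (#|X|) (#|V|) => x k; lia.
- by move=> v /XZ; apply: missA.
apply: (@perfect_matchingP _ _ (M1 :|: M2)).
  by apply: matchingU => //; rewrite cM1 cM2 -/Z disjoints_subset setCK.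
by rewrite cover_setU cM1 cM2 -/Z setUCr.
Qed.
End ExtremalCase.

(** * Degrees and parity hypergraphs *)

Section Degrees.
Local Open Scope nat_scope.
Variables (V : finType) (H : {set {set V}}).
Hypothesis Hunif : uniform 4 H.
Local Notation n := #|V|.
Local Notation ed := (edge_word H).

Lemma codeg_degree x y : x != y -> codeg H x y = 2 * degree H [set x; y].
Proof.
move=> nxy; rewrite /codeg /degree -sum1_card big_distrr /= pair_bigA /=.
pose f (p : V * V) : {set V} := [set t in [:: x; y; p.1; p.2]].
rewrite (eq_bigr (fun p => if f p \in H then 1 else 0)); last first.
  by move=> [z w] _; rewrite /edge_word /f /=; case: (_ \in H).
rewrite -big_mkcond (partition_big f (mem [set e in H | [set x; y] \subset e])) /=; last first.
  move=> [z w] fH; rewrite inE fH /=; apply/subsetP => t; rewrite !inE.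
  by case/orP=> ->; rewrite ?orbT.
apply: eq_bigr => e; rewrite inE => /andP[eH sub].
have /cards2P[z [w [nzw ezw]]] : #|e :\: [set x; y]| == 2.
  by rewrite cardsD (setIidPr sub) cards2 nxy (card_edge Hunif eH).
have out t : t \in e :\: [set x; y] -> t != x /\ t != y.
  by rewrite !inE negb_or => /andP[/andP[]].
have [zx zy] : z != x /\ z != y by apply: out; rewrite ezw !inE eqxx.
have [wx wy] : w != x /\ w != y by apply: out; rewrite ezw !inE eqxx orbT.
have eE : e = [set x; y] :|: [set z; w].
  by rewrite -ezw -[LHS](setID e [set x; y]) (setIidPr sub).
rewrite (eq_bigl (mem [:: (z, w); (w, z)])) ?muln1.
  rewrite -big_uniq /= ?big_cons ?big_nil //.
  by rewrite !inE andbT xpair_eqE negb_and nzw.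
move=> [z' w']; rewrite !inE !xpair_eqE /f /=; apply/andP/idP => [[_ /eqP fe]|].
  have Ue : uniq [:: x; y; z'; w'].
    apply/card_uniqP; rewrite /= -(card_edge Hunif eH) -fe cardsE; apply: eq_card => t; by rewrite !inE.
  have inzw t : t \in [:: z'; w'] -> (t == z) || (t == w).
    move=> tin; have : t \in e by rewrite -fe inE; move: tin; rewrite !inE => /orP[]->; rewrite ?orbT.
    rewrite eE !inE => /orP[|//] txy.
    by move: Ue tin txy; rewrite /= !inE !negb_or => /and4P[/and3P[_ n1 n2] /andP[n3 n4] _ _];
      case/orP=> /eqP->; rewrite ?(eq_sym z') ?(eq_sym w') ?(negPf n1) ?(negPf n2) ?(negPf n3) ?(negPf n4).
  have := inzw z'; have := inzw w'; rewrite !inE !eqxx ?orbT => /(_ isT) h1 /(_ isT) h2.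
  move: Ue h1 h2; rewrite /= !inE => /and4P[_ _ nzw' _].
  by case/orP=> /eqP ew /orP[] /eqP ez; move: nzw'; rewrite ew ez !eqxx ?orbT.
move=> h; have fe : [set t in [:: x; y; z'; w']] = e.
  by rewrite eE; apply/setP=> t; rewrite !inE; case/orP: h => /andP[/eqP-> /eqP->];
    case: (t == x); case: (t == y); case: (t == z); case: (t == w).
by rewrite fe eqxx.
Qed.

Lemma min_degree_le (S : {set V}) : #|S| = 2 -> min_degree 2 H <= degree H S.
Proof.
move=> /eqP szS; rewrite /min_degree; have : S \in index_enum _ by rewrite mem_index_enum.
elim: (index_enum _) => // T r IHr; rewrite inE big_cons => /predU1P[<-|/IHr le_r].
  by rewrite szS geq_minl.
by case: ifP => // _; apply: leq_trans (geq_minr _ _) le_r.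
Qed.

(** The bound on [#|H|] takes care of the neutral value of the minimum. *)
Lemma min_degree_ge k : (forall S : {set V}, #|S| = 2 -> k <= degree H S) -> k <= #|H| ->
  k <= min_degree 2 H.
Proof.
move=> h hk; rewrite /min_degree; apply: (big_ind (fun d => k <= d)) => // [u v hu hv|S /eqP]; last exact: h.
by rewrite leq_min hu.
Qed.

Lemma min_degree_codeg x y : x != y -> 2 * min_degree 2 H <= codeg H x y.
Proof. by move=> nxy; rewrite codeg_degree // leq_mul2l min_degree_le // cards2 nxy. Qed.
End Degrees.

Section ParityHypergraph.
Local Open Scope nat_scope.
Variables (V : finType) (A : {set V}) (sigma : bool).
Local Notation n := #|V|.

Definition parity_hypergraph : {set {set V}} := [set e : {set V} | (#|e| == 4) && (odd #|A :&: e| == sigma)].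
Local Notation E := parity_hypergraph.

Lemma parity_hypergraph_uniform : uniform 4 E.
Proof. by apply/forall_inP => e; rewrite inE => /andP[]. Qed.

Lemma parity_edge_word s : edge_word E s = [&& size s == 4, uniq s & right_parity A sigma s].
Proof.
rewrite /edge_word inE; case: eqP => //= sz_s; rewrite cardsE.
have -> : (#|s| == 4) = uniq s by rewrite -sz_s; apply/eqP/card_uniqP.
by case: (boolP (uniq s)) => //= Us; rewrite card_setI_seq.
Qed.

Lemma ordered_pairs (P Q : {set V}) tau : [disjoint P & Q] ->
  \sum_z \sum_w [&& z \in P :|: Q, w \in P :|: Q, z != w & (z \in P) (+) (w \in P) == tau] =
  if tau then 2 * (#|P| * #|Q|) else #|P| * #|P|.-1 + #|Q| * #|Q|.-1.
Proof.
move=> dPQ; pose F z := \sum_w [&& z \in P :|: Q, w \in P :|: Q, z != w & (z \in P) (+) (w \in P) == tau].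
have QP z : z \in Q -> (z \in P) = false by move=> zQ; rewrite (disjointFl dPQ).
have FP z : z \in P -> F z = if tau then #|Q| else #|P|.-1.
  move=> zP; have hE w : z == w -> w \in P by move/eqP<-.
  rewrite /F (cardsD1 z P) zP /= -!sum_mem; case: (tau); apply: eq_bigr => w _;
  move: (QP w) (hE w); rewrite !inE zP ?(eq_sym w z); case: (w \in P); case: (w \in Q); case: (z == w) => //= h1 h2;
    by [have := h1 isT | have := h2 isT].
have FQ z : z \in Q -> F z = if tau then #|P| else #|Q|.-1.
  move=> zQ; have hE w : z == w -> w \in Q by move/eqP<-.
  rewrite /F (cardsD1 z Q) zQ /= -!sum_mem; case: (tau); apply: eq_bigr => w _;
  move: (QP w) (hE w); rewrite !inE zQ (QP z zQ) ?(eq_sym w z) orbT /=;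
  case: (w \in P); case: (w \in Q); case: (z == w) => //= h1 h2;
    by [have := h1 isT | have := h2 isT].
have -> : \sum_z F z = \sum_(z in P) F z + \sum_(z in Q) F z.
  rewrite (bigID (mem P)) /=; congr (_ + _); rewrite (bigID (mem Q)) /= [X in _ + X]big1 ?addn0.
    apply: eq_bigl => z; case: (boolP (z \in Q)) => [/QP->|]; rewrite ?andbF //.
  move=> z /andP[zP zQ]; rewrite /F big1 // => w _; by rewrite !inE (negPf zP) (negPf zQ).
rewrite (eq_bigr _ FP) (eq_bigr _ FQ) !sum_nat_const; case: tau {F FP FQ} => //.
by rewrite [#|Q| * _]mulnC addnn mul2n.
Qed.

(** The parity of [[set x; y]] relative to [A] prescribes whether the other two vertices lie on the
    same side. *)
Lemma parity_codeg x y : x != y ->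
  let P := A :\: [set x; y] in let Q := ~: A :\: [set x; y] in
  codeg E x y = if ((x \in A) (+) (y \in A)) (+) sigma then 2 * (#|P| * #|Q|)
                else #|P| * #|P|.-1 + #|Q| * #|Q|.-1.
Proof.
move=> nxy P Q; have dPQ : [disjoint P & Q].
  by rewrite -setI_eq0; apply/eqP/setP => z; rewrite !inE; case: (z \in A); rewrite ?andbF.
rewrite -ordered_pairs //; apply: eq_bigr => z _; apply: eq_bigr => w _; congr nat_of_bool.
rewrite parity_edge_word eqxx /= /right_parity /= !inE !negb_or nxy /= !oddD !oddb.
rewrite (eq_sym x z) (eq_sym y z) (eq_sym x w) (eq_sym y w).
case: (z == x); case: (z == y); case: (w == x); case: (w == y); rewrite ?andbF //=.
rewrite !andbT; case: (z == w); rewrite ?andbF //=.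
by case: (x \in A); case: (y \in A); case: (z \in A); case: (w \in A); case: sigma.
Qed.
End ParityHypergraph.

(** * The threshold *)

Section Threshold.
Variable R : realType.

Lemma threshold_root (n : nat) : (12 <= n)%N -> exists s : R,
  [/\ 3 <= s, s ^+ 2 = n%:R - 3 & threshold R n = n%:R ^+ 2 / 4 - 5 * n%:R / 4 - s / 2 + 3 / 2].
Proof.
move=> n12; have n12R : 12 <= n%:R :> R by rewrite (ler_nat R 12).
have n3 : 0 <= n%:R - 3 :> R by lra.
exists (Num.sqrt (n%:R - 3)); rewrite sqr_sqrtr //; split=> //.
have e3 : Num.sqrt (3 ^+ 2) = 3 :> R by rewrite sqrtr_sqr ger0_norm.
by rewrite -[leLHS]e3 ler_sqrt //; lra.
Qed.

(** The square root is absorbed by the linear term. *)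
Lemma threshold_codeg (V : finType) (H : {set {set V}}) : uniform 4 H -> (12 <= #|V|)%N ->
    threshold R #|V| < (min_degree 2 H)%:R ->
  large_codegrees H.
Proof.
move=> Hu n12; have [s [s3 s2 ->]] := threshold_root n12 => lt x y nxy.
have := min_degree_codeg Hu nxy; rewrite -!(ler_nat R) natrX natrD !natrM => le.
have n12R : 12 <= #|V|%:R :> R by rewrite (ler_nat R 12).
have : 0 <= (s - 1) ^+ 2 by exact: sqr_ge0.
by rewrite sqrrB1 s2; move: lt le; rewrite -[2%:R]/(2 : R) -[6%:R]/(6 : R); lra.
Qed.

(** Here [n / 2 + d] is the size of one side and [s ^ 2 = n - 3]. The pairs across give [4 * d ^ 2 <
    (s + 1) ^ 2]. The pairs on the larger side give [(s - 1) ^ 2 < (2 * |d| - 2) ^ 2], that is, [s +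
    1 < 2 * |d|]. *)
Lemma even_degrees_small (s n d delta : R) : 3 <= s -> s ^+ 2 = n - 3 ->
    n ^+ 2 / 4 - 5 * n / 4 - s / 2 + 3 / 2 < delta ->
    delta <= (n / 2 + d - 1) * (n / 2 - d - 1) ->
    2 * delta <= (n / 2 + d - 2) * (n / 2 + d - 3) + (n / 2 - d) * (n / 2 - d - 1) ->
    2 * delta <= (n / 2 + d) * (n / 2 + d - 1) + (n / 2 - d - 2) * (n / 2 - d - 3) ->
  False.
Proof.
move=> s3 s2 lt AB AA BB.
have nE : n = s ^+ 2 + 3 by rewrite s2; ring.
have h1 : 4 * d ^+ 2 < (s + 1) ^+ 2 by rewrite sqrrD1; move: lt AB; rewrite nE; nra.
have h2 : (s - 3) * (s + 1) < 4 * d ^+ 2 - 8 * `|d|.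
  by case: (ger0P d) => _; move: lt AA BB; rewrite nE; nra.
have d2 : d ^+ 2 = `|d| ^+ 2 by rewrite real_normK ?num_real.
have d0 : 0 <= `|d| by exact: normr_ge0.
rewrite d2 in h1 h2; move: `|d| d0 h1 h2 => e e0 h1 h2.
have h3 : 2 * e < s + 1 by rewrite ltNge; apply/negP => ?; nra.
nra.
Qed.

(** As in the even case: the pairs across give [s - 1 < 2 * |d|], and the pairs on one of the sides
    give [(2 * |d| + 2) ^ 2 < (s + 1) ^ 2]. *)
Lemma odd_degrees_small (s n d delta : R) : 3 <= s -> s ^+ 2 = n - 3 ->
    n ^+ 2 / 4 - 5 * n / 4 - s / 2 + 3 / 2 < delta ->
    2 * delta <= (n / 2 + d - 1) * (n / 2 + d - 2) + (n / 2 - d - 1) * (n / 2 - d - 2) ->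
    delta <= (n / 2 + d - 2) * (n / 2 - d) ->
    delta <= (n / 2 + d) * (n / 2 - d - 2) ->
  False.
Proof.
move=> s3 s2 lt AB AA BB.
have nE : n = s ^+ 2 + 3 by rewrite s2; ring.
have h1 : (s - 1) ^+ 2 < 4 * d ^+ 2 by rewrite sqrrB1; move: lt AB; rewrite nE; nra.
have h2 : 4 * d ^+ 2 + 8 * `|d| < (s + 3) * (s - 1).
  by case: (ger0P d) => _; move: lt AA BB; rewrite nE; nra.
have d2 : d ^+ 2 = `|d| ^+ 2 by rewrite real_normK ?num_real.
have d0 : 0 <= `|d| by exact: normr_ge0.
rewrite d2 in h1 h2; move: `|d| d0 h1 h2 => e e0 h1 h2.
have h3 : s - 1 < 2 * e by rewrite ltNge; apply/negP => ?; nra.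
nra.
Qed.
End Threshold.

(** * Sharpness *)

Section Sharpness.
Local Open Scope nat_scope.

Lemma card_setD_pair (V : finType) (P : {set V}) x y : x != y ->
  #|P :\: [set x; y]| + (x \in P) + (y \in P) = #|P|.
Proof.
move=> nxy; have -> : P :\: [set x; y] = (P :\ x) :\ y.
  by apply/setP=> z; rewrite !inE negb_or; case: (z == y); case: (z == x).
rewrite [RHS](cardsD1 x P) (cardsD1 y (P :\ x)) !inE eq_sym nxy /=.
by move: (nat_of_bool _) (nat_of_bool _) #|_| => b c k; lia.
Qed.

Lemma codeg_one_parity (V : finType) (H : {set {set V}}) (A : {set V}) sigma x y : uniform 4 H ->
    (forall s, edge_word H s -> right_parity A sigma s) ->
  codeg H x y <= codeg (parity_hypergraph A sigma) x y.
Proof.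
move=> Hu right; apply: leq_sum => z _; apply: leq_sum => w _.
rewrite parity_edge_word; case: (boolP (edge_word H _)) => // e.
by rewrite eqxx (edge_word_uniq Hu e) (right _ e).
Qed.

(** If all edges of [H] had the same parity relative to [A], then [H] would be contained in a parity
    hypergraph, two vertices of which have a small degree whatever the size of [A]. *)
Lemma threshold_both_parities (R : realType) (V : finType) (H : {set {set V}}) : uniform 4 H ->
  (12 <= #|V|)%N -> (threshold R #|V| < (min_degree 2 H)%:R)%R -> both_parities H.
Proof.
move=> Hu n12 lt A sigma geA leA; apply: contrapT => none.
have right s : edge_word H s -> right_parity A sigma s.
  by move=> e; apply: contrapT => /negP r; apply: none; exists s; rewrite e.
have [s [s3 s2 thE]] := threshold_root R n12; rewrite thE in lt.
have cA := cardsC A.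
have /card_gt1P[x1 [x2 [x1A x2A nx]]] : 1 < #|A| by move: geA n12; clear; lia.
have /card_gt1P[y1 [y2 [y1A y2A ny]]] : 1 < #|~: A| by move: leA n12; rewrite -cA; clear; lia.
rewrite !inE in y1A y2A; set delta := min_degree 2 H in lt.
have bound x y : x != y -> 2 * delta <= codeg (parity_hypergraph A sigma) x y.
  by move=> nxy; apply: leq_trans (min_degree_codeg Hu nxy) (codeg_one_parity _ _ Hu right).
have nxy : x1 != y1 by apply: contraNneq y1A => <-.
have AA := bound _ _ nx; have BB := bound _ _ ny; have AB := bound _ _ nxy.
rewrite parity_codeg // x1A x2A /= in AA; rewrite parity_codeg // (negPf y1A) (negPf y2A) /= in BB.
rewrite parity_codeg // x1A (negPf y1A) /= in AB.
have a1 := card_setD_pair A nx; have a2 := card_setD_pair (~: A) nx.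
have b1 := card_setD_pair A ny; have b2 := card_setD_pair (~: A) ny.
have c1 := card_setD_pair A nxy; have c2 := card_setD_pair (~: A) nxy.
rewrite !inE ?x1A ?x2A ?(negPf y1A) ?(negPf y2A) /= in a1 a2 b1 b2 c1 c2.
have [a aA] : exists a, #|A| = a + 3 by exists (#|A| - 3); move: geA n12; clear; lia.
have [b bA] : exists b, #|~: A| = b + 3 by exists (#|~: A| - 3); move: leA n12; rewrite -cA; clear; lia.
rewrite aA in a1 b1 c1 cA; rewrite bA in a2 b2 c2 cA.
have {}a1 : #|A :\: [set x1; x2]| = a + 1 by clear -a1; lia.
have {}a2 : #|~: A :\: [set x1; x2]| = b + 3 by clear -a2; lia.
have {}b1 : #|A :\: [set y1; y2]| = a + 3 by clear -b1; lia.
have {}b2 : #|~: A :\: [set y1; y2]| = b + 1 by clear -b2; lia.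
have {}c1 : #|A :\: [set x1; y1]| = a + 2 by clear -c1; lia.
have {}c2 : #|~: A :\: [set x1; y1]| = b + 2 by clear -c2; lia.
rewrite a1 a2 in AA; rewrite b1 b2 in BB; rewrite c1 c2 in AB.
have pred k j : (k + j.+1).-1 = k + j by rewrite addnS.
rewrite !pred in AA BB AB; move: AA BB AB s2 lt; rewrite -cA; move: (delta) => delta'; clear -s3.
pose n : R := (a + 3 + (b + 3))%:R; pose d : R := ((a + 3)%:R - n / 2)%R.
have ae : (n / 2 + d = a%:R + 3)%R by rewrite /d [(a + 3)%:R]natrD; ring.
have be : (n / 2 - d = b%:R + 3)%R by rewrite /d /n !natrD; field.
rewrite -/n -!(ler_nat R); case: sigma => /= AA BB AB s2 lt.
  apply: (odd_degrees_small (d := d) s3 s2 lt); rewrite ae be.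
  - by move: AB; rewrite !(natrD, natrM); lra.
  - by move: AA; rewrite !(natrD, natrM); lra.
  - by move: BB; rewrite !(natrD, natrM); lra.
apply: (even_degrees_small (d := d) s3 s2 lt); rewrite ae be.
- by move: AB; rewrite !(natrD, natrM); lra.
- by move: AA; rewrite !(natrD, natrM); lra.
- by move: BB; rewrite !(natrD, natrM); lra.
Qed.

(** Disjoint edges that meet [A] evenly cannot cover a set in which [A] is odd. *)
Lemma parity_no_perfect_matching (V : finType) (A : {set V}) : odd #|A| ->
  ~ has_perfect_matching (parity_hypergraph A false).
Proof.
move=> odd_A [M /and3P[sM tM /eqP cM]]; move: odd_A.
have -> : #|A| = \sum_(e in M) #|A :&: e|.
  transitivity (\sum_(x in cover M) (x \in A : nat)).
    by rewrite -sum_mem; apply: eq_bigl => x; rewrite cM inE.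
  rewrite big_trivIset //=; apply: eq_bigr => e _.
  rewrite -sum1_card big_mkcond [RHS]big_mkcond; apply: eq_bigr => x _.
  by rewrite !inE; case: (x \in e); case: (x \in A).
apply/negP; rewrite -dvdn2; apply: dvdn_sum => e /(subsetP sM).
by rewrite inE dvdn2 eqbF_neg => /andP[].
Qed.

Lemma small_side_pairs k r : r.+2 = 8 * (k * k) + 2 * k ->
  2 * ((r.+2 + 4 * k + 2) * r.+2) <= (r.+2 + 4 * k + 2).+1 * (r.+2 + 4 * k + 2) + r.+1 * r.
Proof. by have : k * k <= k * k by []; nia. Qed.

(** With [i = j.+1], the root of [n - 3] is [4 * i + 1] and the sides have sizes [n / 2 + d] and [n
    / 2 - d] for [2 * d = 4 * i + 2], where the bounds of [even_degrees_small] meet. The larger side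
    [A] is odd. The pairs across and the pairs inside [A] all have degree [p * q], and the pairs
    outside [A] have at least this degree. *)
Lemma sharp_example (R : realType) j : exists (V : finType) (H : {set {set V}}),
  [/\ #|V| = 16 * (j.+1 * j.+1) + 8 * j.+1 + 4, uniform 4 H,
     ((min_degree 2 H)%:R = threshold R #|V|)%R & ~ has_perfect_matching H].
Proof.
pose i := j.+1; pose p := 8 * (i * i) + 6 * i + 2; pose q := 8 * (i * i) + 2 * i.
pose n := p.+1 + q.+1; have nE : n = 16 * (i * i) + 8 * i + 4.
  by rewrite /n /p /q; move: (i * i); clear; lia.
pose A : {set 'I_n} := [set k : 'I_n | k < p.+1].
have cA : #|A| = p.+1.
  rewrite -sum1_card (eq_bigl (fun k : 'I_n => k < p.+1)); last by move=> k; rewrite inE.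
  have le : p.+1 <= n := leq_addr _ _.
  by rewrite -(big_ord_widen n (fun=> 1) le) sum_nat_const card_ord muln1.
have cB : #|~: A| = q.+1 by apply: (@addnI #|A|); rewrite cardsC card_ord cA.
pose H := parity_hypergraph A false; have Hu : uniform 4 H := parity_hypergraph_uniform A false.
have codegE x y : x != y -> 2 * (p * q) <= codeg H x y /\
    ((x \in A) (+) (y \in A) -> codeg H x y = 2 * (p * q)).
  have lia1 k m : k + 1 + 1 = m.+1 -> k = m.-1 by lia.
  have lia2 k m : k + 1 = m.+1 -> k = m by lia.
  move=> nxy; rewrite parity_codeg // addbF.
  have := card_setD_pair A nxy; have := card_setD_pair (~: A) nxy; rewrite cA cB !in_setC.
  case: (x \in A); case: (y \in A) => /=; rewrite ?addn0 => eQ eP.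
  - have {}eP : #|A :\: [set x; y]| = p.-1 by exact: lia1.
    split=> //; rewrite eP eQ; apply: eq_leq.
    have pE : p = (8 * (i * i) + 6 * i).+2 by rewrite /p addn2.
    rewrite pE /= /q; clear; nia.
  - have {}eP : #|A :\: [set x; y]| = p by exact: lia2.
    have {}eQ : #|~: A :\: [set x; y]| = q by exact: lia2.
    by rewrite eP eQ.
  - have {}eP : #|A :\: [set x; y]| = p by exact: lia2.
    have {}eQ : #|~: A :\: [set x; y]| = q by exact: lia2.
    by rewrite eP eQ.
  have {}eQ : #|~: A :\: [set x; y]| = q.-1 by exact: lia1.
  split=> //; rewrite eP eQ.
  have [r rE] : exists r, q = r.+2.
    by exists (8 * (i * i) + 2 * j); rewrite /q /i; clear; lia.
  have pq : p = q + 4 * i + 2 by rewrite /p /q; clear; lia.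
  by rewrite pq rE; apply: small_side_pairs; rewrite -rE.
have [x [y [nxy xyA]]] : exists x y : 'I_n, x != y /\ (x \in A) (+) (y \in A).
  have /card_gt0P[x xA] : 0 < #|A| by rewrite cA.
  have /card_gt0P[y yA] : 0 < #|~: A| by rewrite cB.
  rewrite in_setC in yA; exists x, y; rewrite xA (negPf yA); split=> //.
  by apply: contraNneq yA => <-.
have degE : degree H [set x; y] = p * q.
  apply/eqP; rewrite -(eqn_pmul2l (m := 2)) // -codeg_degree //.
  by have [_ ->] := codegE _ _ nxy.
have minE : min_degree 2 H = p * q.
  apply/eqP; rewrite eqn_leq -{1}degE min_degree_le ?cards2 ?nxy //=.
  apply: min_degree_ge => [S /eqP/cards2P[z [w [nzw ->]]]|].
    by have [le _] := codegE _ _ nzw; rewrite -(leq_pmul2l (m := 2)) // -codeg_degree.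
  by rewrite -degE; apply/subset_leq_card/subsetP => e; rewrite inE => /andP[].
exists 'I_n, H; split=> //; first by rewrite card_ord nE.
- have cast : (n%:R = 16 * (i%:R * i%:R) + 8 * i%:R + 4 :> R)%R by rewrite nE !(natrD, natrM).
  rewrite minE card_ord /threshold cast.
  have -> : (16 * (i%:R * i%:R) + 8 * i%:R + 4 - 3 = (4 * i%:R + 1) ^+ 2 :> R)%R by ring.
  rewrite sqrtr_sqr ger0_norm; last by rewrite addr_ge0 ?mulr_ge0 ?ler0n.
  rewrite natrM; have -> : (p%:R = 8 * (i%:R * i%:R) + 6 * i%:R + 2 :> R)%R by rewrite /p !(natrD, natrM).
  have -> : (q%:R = 8 * (i%:R * i%:R) + 2 * i%:R :> R)%R by rewrite /q !(natrD, natrM).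
  by field.
apply: parity_no_perfect_matching; rewrite cA oddS /p !oddD !oddM.
by case: (odd i).
Qed.
End Sharpness.

(** * The theorem *)

Theorem theorem1p2 (R : realType) :
  (exists n0 : nat, forall (n : nat) (V : finType) (H : {set {set V}}),
      (n0 <= n)%N -> (4 %| n)%N -> #|V| = n -> uniform 4 H ->
      threshold R n < (min_degree 2 H)%:R ->
      has_perfect_matching H)
  /\
  (forall N : nat, exists n : nat,
      [/\ (N <= n)%N, (4 %| n)%N
        & exists (V : finType) (H : {set {set V}}),
            [/\ #|V| = n, uniform 4 H,
                (min_degree 2 H)%:R = threshold R n
              & ~ has_perfect_matching H]]).
Proof.
split=> [|N].
  have [l [n1 extremal]] := extremal_perfect_matching.
  have [K [n2 dichotomy]] := closed_or_near_extremal R l.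
  have [n3 generic] := closed_perfect_matching 31 K.
  exists (12 + n1 + n2 + n3)%N => n V H n_big div4 szV Hu; rewrite -szV in n_big div4 *.
  move=> lt; have n12 : (12 <= #|V|)%N by move: n_big; move: (#|V|) => m; clear; lia.
  have deg := threshold_codeg Hu n12 lt.
  have n2le : (n2 <= #|V|)%N by move: n_big; move: (#|V|) => m; clear; lia.
  have [cl|[A [sigma [wrong le1 le2]]]] := dichotomy V H Hu n2le deg.
    by apply: generic => //; move: n_big; move: (#|V|) => m; clear; lia.
  apply: (extremal V H Hu _ div4 deg (threshold_both_parities Hu n12 lt) A sigma) => //.
  by move: n_big; move: (#|V|) => m; clear; lia.
have [V [H [szV Hu minE noM]]] := sharp_example R N.
exists #|V|; split; last by exists V, H.
  by rewrite szV -addnA; apply: leq_trans (leq_addr _ _); move: (N) => k; clear; nia.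
by rewrite szV !dvdn_addr ?dvdn_mulr.
Qed.
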